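(* Let $\Delta\subseteq\mathbb{R}^2$ be a finite simplicial complex homeomorphic to a disk and let $0\le r\le s\le d$ be integers. Let $\mathcal S_d^{r,s}(\Delta)$ be the space of splines of degree at most $d$ with smoothness $r$ across all interior edges and supersmoothness $s$ at all vertices of $\Delta$. Then $$\dim \mathcal S_d^{r,s}(\Delta)\ \ge\ \binom{d+2}{2}+\left[(d-s)^2-\binom{d-2s+r}{2}\right]f_1^\circ-\sum_{\gamma\in\Delta_0^\circ}\dim\overline J(\gamma)_d ,$$ where $$\dim\overline J(\gamma)_d=\begin{cases}\dfrac{t_\gamma}{2}(d-s)(d+s-2r+1)-b_\gamma\dbinom{d+2-\Omega_\gamma}{2}-a_\gamma\dbinom{d+1-\Omega_\gamma}{2} & \text{if } s<\Omega_\gamma-1,\\[2mm] \dbinom{d+2}{2}-\dbinom{s+2}{2} & \text{otherwise,}\end{cases}$$ with $t_\gamma$ the number of different slopes of the edges containing $\gamma$, $\Omega_\gamma=\left\lfloor \frac{t_\gamma r}{t_\gamma-1}\right\rfloor+1$, $a_\gamma=t_\gamma(r+1)+(1-t_\gamma)\Omega_\gamma$, and $b_\gamma=t_\gamma-a_\gamma-1$.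
   Context: $\Delta_i$ is the set of $i$-dimensional faces of $\Delta$, $\Delta_i^\circ$ the subset of interior ones (not contained in the boundary of $\Delta$), and $f_1^\circ=|\Delta_1^\circ|$. Dimensions are over $\mathbb R$; subscript $d$ on an ideal denotes the degree $d$ part. Convention: $\binom{a}{b}=0$ whenever $a<b$ (including negative $a$). $\mathcal S_d^{r,s}(\Delta)$ is the real vector space of $C^r$ functions $f$ on $\Delta$ such that on each triangle $\sigma\in\Delta_2$, $f|_\sigma$ is a polynomial of total degree at most $d$, and for each vertex $\gamma\in\Delta_0$ (interior or boundary) the polynomials $f|_\sigma$, for all triangles $\sigma$ containing $\gamma$, have the same partial derivatives at $\gamma$ up to order $s$. $S=\mathbb{R}[x,y,z]$ with the standard grading. Embed $\mathbb R^2$ in $\mathbb R^3$ as the plane $z=1$; for a face $\beta$, $\hat\beta$ is the convex hull of the origin and the image of $\beta$. For an edge $\tau$, $\ell_\tau\in S$ is a nonzero linear form vanishing on $\hat\tau$. For a vertex $\gamma$, $\hat{\mathfrak m}_\gamma\subset S$ is the ideal of polynomials vanishing on the line through $\hat\gamma$. For $\gamma\in\Delta_0^\circ$, $\overline J(\gamma)=\sum_{\tau\in\Delta_1^\circ,\,\tau\ni\gamma}\bigl(\langle \ell_\tau^{r+1}\rangle\cap\hat{\mathfrak m}_\gamma^{s+1}\bigr)$. *)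

(* Defs.v *)
From HB Require Import structures.
From mathcomp Require Import all_boot all_order all_algebra finmap.
(* The notations of mpoly clash with those of mathcomp-analysis. *)
From mathcomp Require Import -(notations) mpoly.
From mathcomp Require Import all_classical all_reals all_analysis.

Set Implicit Arguments.
Unset Strict Implicit.
Unset Printing Implicit Defensive.

Import Order.TTheory GRing.Theory Num.Theory.
Import numFieldNormedType.Exports.

Local Open Scope classical_set_scope.
Local Open Scope fset_scope.
Local Open Scope ring_scope.

Notation "{ 'mpoly' T [ n ] }" := (mpoly n T)
  (at level 0, T, n at level 2, format "{ 'mpoly'  T [ n ] }").

Local Notation plane R := 'rV[R]_2 (only parsing).
(* A simplex is represented by its (finite) vertex set. *)
Local Notation simplex R := {fset 'rV[R]_2} (only parsing).

Section LinearAlgebra.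
Context {R : realType}.

(* [A] is a linear subspace of [V] with a basis of [n] elements. *)
Definition has_dim (V : lmodType R) (A : set V) (n : nat) : Prop :=
  exists b : 'I_n -> V,
    A = [set x | exists c : 'I_n -> R, x = \sum_(i < n) c i *: b i] /\
    (forall c : 'I_n -> R, \sum_(i < n) c i *: b i = 0 -> forall i, c i = 0).

Definition convex_hull (V : lmodType R) (A : set V) : set V :=
  [set x | exists (n : nat) (w : 'I_n -> R) (a : 'I_n -> V),
    [/\ forall i, 0 <= w i, \sum_(i < n) w i = 1, forall i, A (a i)
      & x = \sum_(i < n) w i *: a i]].

Definition affinely_independent (V : lmodType R) (sigma : {fset V}) : Prop :=
  forall c : V -> R,
    \sum_(v <- sigma) c v = 0 -> \sum_(v <- sigma) c v *: v = 0 ->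
    forall v, v \in sigma -> c v = 0.

End LinearAlgebra.

Section SimplicialComplexes.
Context {R : realType}.
Implicit Types (Delta : {fset simplex R}) (sigma tau : simplex R) (v : plane R).

Definition realization sigma : set (plane R) := convex_hull [set` sigma].

Definition simplicial_complex Delta : Prop :=
  [/\ forall sigma, sigma \in Delta ->
        sigma != fset0 /\ affinely_independent sigma,
      forall sigma tau, sigma \in Delta -> tau != fset0 -> tau `<=` sigma ->
        tau \in Delta
    & forall sigma tau, sigma \in Delta -> tau \in Delta ->
        (realization sigma `&` realization tau)%classic =
        realization (sigma `&` tau)].

Definition carrier Delta : set (plane R) :=
  (\bigcup_(sigma in [set` Delta]) realization sigma)%classic.

Definition homeomorphic (A B : set (plane R)) : Prop :=
  exists f g : plane R -> plane R,
    [/\ {within A, continuous f}, {within B, continuous g},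
        forall x, A x -> B (f x) /\ g (f x) = x
      & forall y, B y -> A (g y) /\ f (g y) = y].

Definition closed_disk : set (plane R) :=
  [set p | p 0 0 ^+ 2 + p 0 1 ^+ 2 <= 1].

Definition faces Delta (i : nat) : {fset simplex R} :=
  [fset sigma in Delta | #|` sigma| == i.+1].

(* The boundary of a disk embedded in the plane is its topological frontier. *)
Definition boundary Delta : set (plane R) :=
  (carrier Delta `\` interior (carrier Delta))%classic.

Definition interior_faces Delta (i : nat) : {fset simplex R} :=
  [fset sigma in faces Delta i |
    `[< ~ (realization sigma `<=` boundary Delta)%classic >]].

Definition vertices Delta : {fset plane R} :=
  [fset v in \bigcup_(sigma <- Delta) sigma | [fset v] \in faces Delta 0].

Definition interior_vertices Delta : {fset plane R} :=
  [fset v in vertices Delta | [fset v] \in interior_faces Delta 0].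

(* [None] is the slope of vertical lines. *)
Definition slope (u v : plane R) : option R :=
  if u 0 0 == v 0 0 then None
  else Some ((v 0 1 - u 0 1) / (v 0 0 - u 0 0)).

Definition neighbors Delta v : {fset plane R} :=
  [fset u in vertices Delta | [fset v; u] \in faces Delta 1].

Definition nb_slopes Delta v : nat :=
  #|` [fset slope v u | u in neighbors Delta v]|.

End SimplicialComplexes.

Section Splines.
Context {R : realType}.
Implicit Types (Delta : {fset simplex R}) (sigma tau : simplex R) (v : plane R).

Definition peval n (p : {mpoly R[n]}) (u : 'rV[R]_n) : R :=
  meval (fun i => u 0 i) p.

(* [A] is meant to be the closure of its interior.  [g i j] is the continuous
   extension to [A] of the partial derivative of [f] of order [i] in the first
   variable and [j] in the second one. *)
Definition Cr_on (A : set (plane R)) (r : nat) (f : A -> R) : Prop :=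
  exists g : nat -> nat -> plane R -> R,
    [/\ forall x : A, g 0%N 0%N (val x) = f x,
        forall i j, (i + j <= r)%N -> {within A, continuous (g i j)}
      & forall i j p, (i + j < r)%N -> interior A p ->
          is_derive p (delta_mx 0 0) (g i j) (g i.+1 j p) /\
          is_derive p (delta_mx 0 1) (g i j) (g i j.+1 p)].

Definition splines Delta (r s d : nat) : set (carrier Delta -> R^o) :=
  [set f | Cr_on r f /\
    exists p : simplex R -> {mpoly R[2]},
      (forall sigma, sigma \in faces Delta 2 ->
         (mmeasure mdeg (p sigma) <= d.+1)%N /\
         forall x : carrier Delta,
           realization sigma (val x) -> f x = peval (p sigma) (val x)) /\
      (forall v, v \in vertices Delta ->
       forall sigma sigma', sigma \in faces Delta 2 ->
         sigma' \in faces Delta 2 -> v \in sigma -> v \in sigma' ->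
       forall m : multinom 2, (mdeg m <= s)%N ->
         peval (mderivm m (p sigma)) v =
         peval (mderivm m (p sigma')) v)].

End Splines.

Arguments splines {R} Delta r s d _.

Section Ideals.
Context {S : comNzRingType}.

Definition ideal_gen (A : set S) : set S :=
  [set F | exists (n : nat) (c a : 'I_n -> S),
    (forall i, A (a i)) /\ F = \sum_(i < n) c i * a i].

Definition ideal_pow (I : set S) (k : nat) : set S :=
  ideal_gen [set F | exists a : 'I_k -> S,
    (forall i, I (a i)) /\ F = \prod_(i < k) a i].

Definition ideal_sum (T : choiceType) (E : {fset T}) (I : T -> set S) : set S :=
  [set F | exists G : T -> S,
    (forall t, t \in E -> I t (G t)) /\ F = \sum_(t <- E) G t].

End Ideals.

Section Jbar.
Context {R : realType}.
Implicit Types (Delta : {fset simplex R}) (sigma tau : simplex R) (v : plane R).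
Implicit Types (F : {mpoly R[3]}).

Definition embed v : 'rV[R]_3 := row_mx v (1%:M : 'rV[R]_1).

Definition cone sigma : set 'rV[R]_3 :=
  convex_hull ([set 0] `|` embed @` realization sigma)%classic.

Definition edge_form tau F : Prop :=
  [/\ F \is ishomog1 1 mdeg, F != 0
    & forall u, cone tau u -> peval F u = 0].

Definition vertex_ideal v : set {mpoly R[3]} :=
  [set F | forall (t : R) u, cone [fset v] u -> peval F (t *: u) = 0].

Definition Jbar Delta (ell : simplex R -> {mpoly R[3]}) (r s : nat) v :
    set {mpoly R[3]} :=
  ideal_sum [fset tau in interior_faces Delta 1 | v \in tau]
    (fun tau => ideal_gen [set ell tau ^+ r.+1] `&`
                ideal_pow (vertex_ideal v) s.+1)%classic.

Definition degree_part (J : set {mpoly R[3]}) (d : nat) : set {mpoly R[3]} :=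
  (J `&` [set F | F \is ishomog1 d mdeg])%classic.

End Jbar.

(* Zero for a < b, in particular for negative a. *)
Definition binz (a : int) (b : nat) : rat :=
  if a is Posz n then 'C(n, b)%:R else 0.

Definition Omega (t r : nat) : nat := ((t * r) %/ (t - 1) + 1)%N.

Definition coef_a (t r : nat) : int :=
  t%:Z * (r%:Z + 1) + (1 - t%:Z) * (Omega t r)%:Z.

Definition coef_b (t r : nat) : int := t%:Z - coef_a t r - 1.

Definition Jbar_dim (t r s d : nat) : rat :=
  if (s < Omega t r - 1)%N then
    t%:R / 2 * (d%:R - s%:R) * (d%:R + s%:R - 2 * r%:R + 1)
    - (coef_b t r)%:~R * binz (d%:Z + 2 - (Omega t r)%:Z) 2
    - (coef_a t r)%:~R * binz (d%:Z + 1 - (Omega t r)%:Z) 2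
  else 'C(d + 2, 2)%:R - 'C(s + 2, 2)%:R.

(* Main.v *)
Require Import Defs.
From HB Require Import structures.
From mathcomp Require Import all_boot all_order all_algebra finmap.
From mathcomp Require Import -(notations) mpoly.
From mathcomp Require Import all_classical all_reals all_analysis.
From mathcomp Require Import ring lra zify.

Set Implicit Arguments.
Unset Strict Implicit.
Unset Printing Implicit Defensive.

Import Order.TTheory GRing.Theory Num.Theory.
Import numFieldNormedType.Exports.

Local Open Scope classical_set_scope.
Local Open Scope fset_scope.
Local Open Scope ring_scope.

(** Fix a triangulated disk. A family of polynomials on its triangles is a spline
    as soon as its jump across every interior edge [tau] is divisible by
    [ell_tau ^+ r.+1] and vanishes to order [s] at both ends of [tau]; here the fan
    connectedness of vertex stars in a disk gives the supersmoothness. Conversely,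
    jumps prescribed on the interior edges come from such a family as soon as they
    sum to zero around each interior vertex, because the disk is simply connected.

    On one edge [tau = {a, b}], with coordinates X, Y, Z of R^3 dual to
    (a, b, third vector) so that Z is proportional to [ell_tau], the monomials
    X^i Y^j Z^(d-i-j) with i, j < d - s and i + j < d - r are admissible jumps, and
    there are (d-s)^2 - binz (d-2s+r) 2 of them. The condition at an interior vertex
    [gamma] takes values in [Jbar gamma] in degree d, so it costs at most the
    dimension of that space; adding the global polynomials gives the bound.

    In coordinates centred at [gamma], the degree d part of [Jbar gamma] splits by the
    order k > s of vanishing at [gamma] into the spaces of binary forms of degree k
    spanned by the multiples of the (r+1)-st powers of [nb_slopes gamma] pairwise
    independent linear forms; their dimension min(k+1, t(k-r)) follows by apolarity. *)

(** * Dimensions of subspaces *)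

Section LinearFamilies.
Context {R : realType} {V : lmodType R}.

(** The only global hypothesis is a homeomorphism with the closed disk, so the combinatorics of the
    triangulation has to be extracted from point-set topology. Two facts about the disk suffice.
    Small punctured neighbourhoods of its points are nonempty and connected: hence every face lies
    in a triangle, and the triangles at a vertex, also at a boundary one, are linked through common
    edges. And differences that are additive on nearby points are differences of a function,
    obtained by summing along radii; this replaces homology. The potential of given jumps is built
    around each vertex by partial sums in angular order. Going once around an interior vertex
    requires the total jump to vanish. At a boundary vertex the summation starts in a direction that
    lies in no triangle, and no condition arises. Potentials of two vertices differ by constants on
    the triangles that they share, and this is the local data that is summed along the radii. Vertex
    conditions are charged the full dimension of the space where they take values; nothing is said
    about their being onto or independent, whence an inequality. *)

Definition free_family n (b : 'I_n -> V) : Prop :=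
  forall c : 'I_n -> R, \sum_(i < n) c i *: b i = 0 -> forall i, c i = 0.

Definition spanned n (b : 'I_n -> V) : set V :=
  [set x | exists c : 'I_n -> R, x = \sum_(i < n) c i *: b i].

Definition linear_subspace (A : set V) : Prop :=
  A 0 /\ forall (a : R) x y, A x -> A y -> A (a *: x + y).

Lemma linear_subspace_sum (A : set V) (I : Type) (s : seq I) (P : pred I)
    (c : I -> R) (F : I -> V) :
  linear_subspace A -> (forall i, P i -> A (F i)) ->
  A (\sum_(i <- s | P i) c i *: F i).
Proof.
move=> [A0 AD] AF; elim: s => [|i s IH]; first by rewrite big_nil.
by rewrite big_cons; case: ifP => // Pi; apply: AD => //; apply: AF.
Qed.

(** The coordinates of [f] with respect to [e] form an m by n matrix. Freeness of [f] makes its left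
    kernel trivial, so its rank is m. *)
Lemma free_family_leq m n (f : 'I_m -> V) (e : 'I_n -> V) :
  free_family f -> (forall i, spanned e (f i)) -> (m <= n)%N.
Proof.
move=> free_f /(_ _)/cid spanf.
pose M := \matrix_(i < m, j < n) projT1 (spanf i) j.
suff /eqP <- : row_free M by exact: rank_leq_col.
rewrite -kermx_eq0; apply/eqP/row_matrixP => i; rewrite row0.
have : row i (kermx M) *m M = 0 by apply/sub_kermxP/row_sub.
move: (row i _) => u uM.
apply/rowP => j; rewrite [RHS]mxE; apply: (free_f (fun j => u 0 j)).
under eq_bigr => k _ do rewrite (projT2 (spanf k)) scaler_sumr.
rewrite exchange_big big1 // => k _.
under eq_bigr => l _ do rewrite scalerA.
rewrite -scaler_suml; have /rowP/(_ k) := uM.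
by rewrite !mxE; under eq_bigr => l _ do rewrite mxE; move=> ->; rewrite scale0r.
Qed.

Lemma free_family_extend n (f : 'I_n -> V) x :
  free_family f -> ~ spanned f x ->
  free_family (fun i : 'I_n.+1 => if unlift ord_max i is Some j then f j else x).
Proof.
move=> free_f nfx c; rewrite big_ord_recr /= unlift_none.
under eq_bigr => i _.
  have -> : widen_ord (leqnSn n) i = lift ord_max i.
    by apply: val_inj; rewrite /= /bump leqNgt ltn_ord.
  rewrite liftK; over.
move=> e0.
have c0 : c ord_max = 0.
  apply: contra_notP nfx => /eqP nc.
  exists (fun i => - (c ord_max)^-1 * c (lift ord_max i)).
  under eq_bigr => i _ do rewrite -scalerA.
  rewrite -scaler_sumr; move/eqP: e0; rewrite addr_eq0 => /eqP ->.
  by rewrite scaleNr scalerN opprK scalerA mulVf // scale1r.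
move: e0; rewrite c0 scale0r addr0 => /free_f c0' i.
by case: (unliftP ord_max i) => [j|] ->.
Qed.

Lemma has_dimP (A : set V) n :
  has_dim A n <-> exists2 b : 'I_n -> V, A = spanned b & free_family b.
Proof. by split=> [[b [? ?]]|[b ? ?]]; exists b. Qed.

(** A free family of maximal length inside [A] spans it; the family [e] bounds the lengths. *)
Lemma has_dim_subspace (A : set V) n (e : 'I_n -> V) :
  linear_subspace A -> (A `<=` spanned e)%classic -> exists m, has_dim A m.
Proof.
move=> linA Ae.
pose P m := `[< exists2 f : 'I_m -> V, free_family f & forall i, A (f i) >].
have P0 : exists m, P m.
  by exists 0%N; apply/asboolP; exists (fun=> 0) => [c _|] [].
have Pn m : P m -> (m <= n)%N.
  by move=> /asboolP[f free_f Af]; apply: free_family_leq free_f _ => i; apply/Ae.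
case: (ex_maxnP P0 Pn) => m /asboolP[f free_f Af] maxm; exists m.
apply/has_dimP; exists f => //; apply/seteqP; split => [x Ax|x [c ->]]; last first.
  exact: linear_subspace_sum.
apply: contrapT => nx; have /maxm : P m.+1; last by rewrite ltnn.
apply/asboolP; eexists; first exact: free_family_extend free_f nx.
by move=> i /=; case: (unlift ord_max i).
Qed.

Lemma has_dim_geq (A : set V) m n (f : 'I_n -> V) :
  has_dim A m -> free_family f -> (forall i, A (f i)) -> (n <= m)%N.
Proof.
by move=> /has_dimP[b -> _] free_f Af; apply: free_family_leq free_f Af.
Qed.

Lemma has_dim0 : has_dim [set 0 : V]%classic 0.
Proof.
apply/has_dimP; exists (fun=> 0); last by move=> ? ? [].
by apply/seteqP; split => x; [move=> ->; exists (fun=> 0); rewrite big_ord0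
  | case=> c; rewrite big_ord0].
Qed.

Lemma has_dim_add (A B : set V) m n :
  has_dim A m -> has_dim B n -> (forall x, A x -> B x -> x = 0) ->
  has_dim [set x + y | x in A & y in B]%classic (m + n).
Proof.
move=> /has_dimP[a -> fa] /has_dimP[b -> fb] AB; apply/has_dimP.
exists (fun i : 'I_(m + n) => match fintype.split i with inl j => a j | inr k => b k end).
  apply/seteqP; split=> [_ [_ [c ->] [_ [e ->] <-]]|_ [c ->]].
    exists (fun i : 'I_(m + n) => match fintype.split i with inl j => c j | inr k => e k end).
    rewrite big_split_ord /=; congr (_ + _); apply: eq_bigr => i _.
      by rewrite (unsplitK (inl i)).
    by rewrite (unsplitK (inr i)).
  rewrite big_split_ord /=.
  exists (\sum_(i < m) c (lshift n i) *: a i); first by exists (fun i => c (lshift n i)).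
  exists (\sum_(i < n) c (rshift m i) *: b i); first by exists (fun i => c (rshift m i)).
  congr (_ + _); apply: eq_bigr => i _.
    by rewrite (unsplitK (inl i)).
  by rewrite (unsplitK (inr i)).
move=> c; rewrite big_split_ord /=.
under eq_bigr => i _ do rewrite (unsplitK (inl i)).
under [X in _ + X]eq_bigr => i _ do rewrite (unsplitK (inr i)).
set x := \sum_i _; set y := \sum_i _ => xy0.
have x0 : x = 0.
  apply: AB; first by exists (fun i => c (lshift n i)).
  move/eqP: xy0; rewrite addr_eq0 => /eqP ->; exists (fun i => - c (rshift m i)).
  by rewrite -sumrN; apply: eq_bigr => i _; rewrite scaleNr.
have y0 : y = 0 by move: xy0; rewrite x0 add0r.
move=> i; rewrite -(splitK i); case: (fintype.split i) => j /=.
  exact: (fa (fun i => c (lshift n i))).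
exact: (fb (fun i => c (rshift m i))).
Qed.

End LinearFamilies.

Lemma has_dim_image (R : realType) (V W : lmodType R) (f : {linear V -> W})
    (A : set V) n :
  has_dim A n -> (forall x, A x -> f x = 0 -> x = 0) -> has_dim (f @` A)%classic n.
Proof.
move=> /has_dimP[b -> fb] inj; apply/has_dimP; exists (f \o b).
  apply/seteqP; split=> [_ [_ [c ->] <-]|_ [c ->]].
    by exists c; rewrite linear_sum; apply: eq_bigr => i _; rewrite linearZ.
  exists (\sum_(i < n) c i *: b i); first by exists c.
  by rewrite linear_sum; apply: eq_bigr => i _; rewrite linearZ.
move=> c c0; apply: fb; apply: inj; first by exists c.
by rewrite linear_sum -[RHS]c0; apply: eq_bigr => i _; rewrite linearZ.
Qed.

Lemma has_dim_rowspace (R : realType) m n (M : 'M[R]_(m, n)) :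
  has_dim [set x : 'rV[R]_n | (x <= M)%MS]%classic (\rank M).
Proof.
apply/has_dimP; exists (fun i => row i (row_base M)).
  apply/seteqP; split=> x /=; rewrite -[(x <= M)%MS](eq_row_base M).
    by move=> /submxP[u ->]; exists (fun i => u 0 i); rewrite mulmx_sum_row.
  by case=> c ->; apply: summx_sub => i _; apply/scalemx_sub/row_sub.
move=> c c0 i.
have : (\row_i c i) *m row_base M == 0.
  by rewrite mulmx_sum_row -[X in _ == X]c0; apply/eqP/eq_bigr => j _; rewrite mxE.
rewrite mulmx_free_eq0 ?row_base_free // => /eqP/rowP/(_ i).
by rewrite !mxE.
Qed.

(** Imposing a condition with values in a space of dimension [b t] lowers the dimension by at most
    [b t]. The ambient [V] may be infinite-dimensional, hence matrices are taken in a basis of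
    [B t]. *)
Lemma common_kernel (R : realType) (V : lmodType R) n (T : Type)
    (s : seq T) (L : T -> {linear 'rV[R]_n -> V}) (B : T -> set V) (b : T -> nat) :
  (forall t, List.In t s -> has_dim (B t) (b t) /\ forall x, B t (L t x)) ->
  exists k (K : 'M[R]_(k, n)),
    [/\ (n <= k + \sum_(t <- s) b t)%N, row_free K &
        forall i t, List.In t s -> L t (row i K) = 0].
Proof.
(* The induction runs on row spaces, which can be intersected with kernels; a basis is extracted at
   the end. *)
move=> hs; suff [m [K [nK K0]]] : exists m (K : 'M[R]_(m, n)),
    (n <= \rank K + \sum_(t <- s) b t)%N /\
    forall x, (x <= K)%MS -> forall t, List.In t s -> L t x = 0.
  exists (\rank K), (row_base K); split; rewrite ?row_base_free // => i t ts.
  by apply: K0 => //; rewrite -(eq_row_base K) row_sub.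
elim: s hs => [|t s IH] hs.
  exists n, 1%:M; rewrite mxrank1 leq_addr; split=> // x _ t [].
have [|m [K [nK K0]]] := IH; first by move=> t' ts; apply: hs; right.
have [/has_dimP[c Bc fc] BL] := hs t (or_introl erefl).
have /(_ _)/cid spanL : forall i : 'I_n, spanned c (L t (delta_mx 0 i)).
  by move=> i; rewrite -Bc.
pose M := \matrix_(i < n, j < b t) projT1 (spanL i) j.
have LM x : L t x = \sum_j (x *m M) 0 j *: c j.
  rewrite [in LHS](row_sum_delta x) linear_sum.
  under eq_bigr => i _ do
    rewrite linearZ /= (projT2 (spanL i)) scaler_sumr.
  rewrite exchange_big; apply: eq_bigr => j _ /=.
  rewrite mxE scaler_suml; apply: eq_bigr => i _.
  by rewrite scalerA mxE.
exists _, (K :&: kermx M)%MS; split.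
  rewrite big_cons; have := mxrank_sum_cap K (kermx M).
  rewrite mxrank_ker; have := rank_leq_col (K + kermx M)%MS.
  by have := rank_leq_col M; have := rank_leq_row M; lia.
move=> x; rewrite sub_capmx => /andP[xK xM] t' [<-|]; last exact: K0.
rewrite LM; move/sub_kermxP: xM => ->.
by rewrite big1 // => j _; rewrite mxE scale0r.
Qed.

(** * Ideals of powers of linear forms in two variables *)

Section PowersOfLinearForms.
Context {R : realType}.
Implicit Types (p f g : {poly R}) (a : R).

Lemma dvdp_Xn p n : ('X^n %| p) = [forall i : 'I_n, p`_i == 0].
Proof.
apply/idP/forallP => [/dvdpP[q ->] i|p0]; first by rewrite coefMXn ltn_ord.
rewrite -(poly_take_drop n p) (_ : take_poly n p = 0) ?add0r ?dvdp_mull //.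
apply/polyP => i; rewrite coef_take_poly coef0; case: ltnP => // ltin.
by have /eqP := p0 (Ordinal ltin).
Qed.

Lemma dvdp_exp_XsubC p a n :
  (('X - a%:P) ^+ n %| p) = [forall i : 'I_n, (p \Po ('X + a%:P))`_i == 0].
Proof.
rewrite -dvdp_Xn; apply/idP/idP.
  move=> /(dvdp_comp_poly ('X + a%:P)); rewrite rmorphXn /=.
  by rewrite comp_polyB comp_polyX comp_polyC addrK.
move=> /(dvdp_comp_poly ('X - a%:P)).
by rewrite comp_polyXaddC_K rmorphXn /= comp_polyX.
Qed.

Lemma dvdp_prod_exp_XsubC (s : seq R) p n : uniq s ->
  (\prod_(a <- s) ('X - a%:P) ^+ n %| p) = all (fun a => ('X - a%:P) ^+ n %| p) s.
Proof.
elim: s => [|a s IH] /=; first by rewrite big_nil dvd1p.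
move=> /andP[nas us]; rewrite big_cons Gauss_dvdp ?IH //.
rewrite coprimep_expl // coprimep_sym coprimep_XsubC.
apply: contraNN nas; rewrite /root horner_prod prodf_seq_eq0 => /hasP[b bs].
by rewrite !hornerE expf_eq0 subr_eq0 => /andP[_ /eqP ->].
Qed.

Lemma size_prod_exp_XsubC (s : seq R) n :
  size (\prod_(a <- s) ('X - a%:P) ^+ n) = (size s * n).+1.
Proof.
rewrite size_prod_seq => [|a _]; last by rewrite expf_neq0 ?polyXsubC_eq0.
under eq_bigr => a _ do rewrite size_exp_XsubC.
by rewrite big_const_seq count_predT iter_addn_0 mulSn -addnS addKn mulnC.
Qed.

Variable k : nat.
Implicit Types u v : 'rV[R]_k.+1.

Definition coef_pairing u f : R := \sum_(j < k.+1) u 0 j * f`_j.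

(* The generating function [a |-> <u, ('X - a)^k>]; its Taylor coefficients at
   [a] pair [u] with the lower powers of ['X - a], which turns membership in
   the annihilator of those powers into divisibility. *)
Definition apolar_poly u : {poly R} :=
  \poly_(i < k.+1) ((-1) ^+ i * 'C(k, i)%:R * u 0 (inord (k - i))).

Lemma coef_pairingE u f : coef_pairing u f = (poly_rV f *m u^T) 0 0.
Proof. by rewrite mxE; apply: eq_bigr => j _; rewrite !mxE mulrC. Qed.

Lemma coef_exp_XaddC a n j : (('X + a%:P) ^+ n)`_j = a ^+ (n - j) *+ 'C(n, j).
Proof.
rewrite addrC exprDn coef_sum.
under eq_bigr => i _ do rewrite -polyC_exp coefMn coefCM coefXn.
case: (ltnP j n.+1) => [ltjn|lenj].
  rewrite (bigD1 (Ordinal ltjn)) //= eqxx mulr1 big1 ?addr0 // => i.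
  by rewrite -val_eqE /= eq_sym => /negbTE ->; rewrite mulr0 mul0rn.
rewrite bin_small // mulr0n big1 // => i _.
by rewrite gtn_eqF ?mulr0 ?mul0rn // (leq_trans (ltn_ord i)).
Qed.

(** Expand (X - a - T)^k in powers of T: the coefficient of T^l is a signed binomial multiple of (X
    - a)^(k - l), and pairing with [u] is linear. *)
Lemma apolar_poly_shift u a l : (l <= k)%N ->
  (apolar_poly u \Po ('X + a%:P))`_l =
  (-1) ^+ l * 'C(k, l)%:R * coef_pairing u (('X - a%:P) ^+ (k - l)).
Proof.
move=> lelk; rewrite /apolar_poly poly_def raddf_sum coef_sum /=.
under eq_bigr => i _ do rewrite comp_polyZ comp_Xn_poly coefZ coef_exp_XaddC.
rewrite /coef_pairing mulr_sumr (reindex_inj rev_ord_inj) /=.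
apply: eq_bigr => j _; rewrite subSS subKn -1?ltnS //.
have -> : inord j = j by apply: val_inj; rewrite /= inordK.
rewrite -polyCN coef_exp_XaddC.
have lejk : (j <= k)%N by rewrite -ltnS.
case: (leqP l (k - j)) => [lel|ltl]; last first.
  rewrite (@bin_small (k - j)) // (@bin_small (k - l)) ?mulr0n ?mulr0 //; lia.
(* Trinomial revision: both sides are k! / (j! l! (k - j - l)!). *)
have bin_eq : ('C(k, k - j) * 'C(k - j, l) = 'C(k, l) * 'C(k - l, j))%N.
  have h1 := bin_fact lejk; have h2 := bin_fact lel.
  have h3 := bin_fact lelk; have lej : (j <= k - l)%N by lia.
  have h4 := bin_fact lej.
  have h5 : (k - l - j = k - j - l)%N by lia.
  rewrite bin_sub //; move: h1 h2 h3 h4; rewrite h5.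
  move: (fact_gt0 j) (fact_gt0 l) (fact_gt0 (k - j - l)).
  move: (j`!) (l`!) ((k - j - l)`!) ((k - j)`!) ((k - l)`!) (k`!).
  move: 'C(k, j) 'C(k - j, l) 'C(k, l) 'C(k - l, j).
  move=> c1 c2 c3 c4 x y z fu fv fw x0 y0 z0 <- <-.
  move=> + h; rewrite -h => e; apply/eqP.
  have xyz0 : (0 < x * y * z)%N by rewrite !muln_gt0 x0 y0.
  rewrite -(eqn_pmul2r xyz0); apply/eqP.
  transitivity (c3 * (y * (c4 * (x * z))))%N; last by ring.
  by rewrite e; ring.
rewrite -[_ *+ 'C(k - j, l)]mulr_natr -[_ *+ 'C(k - l, j)]mulr_natr.
rewrite (_ : (k - l - j = k - j - l)%N); last lia.
have e1 : (- a) ^+ (k - j - l) = (-1) ^+ (k - j) * (-1) ^+ l * a ^+ (k - j - l).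
  rewrite -exprD -signr_odd oddD -oddB ?signr_odd; last lia.
  by rewrite [in LHS]exprNn.
rewrite e1.
have := congr1 (fun m : nat => m%:R : R) bin_eq; rewrite !natrM => e2.
have e3 : (-1 : R) ^+ l * (-1) ^+ l = 1 by rewrite -expr2 sqrr_sign.
transitivity ((-1) ^+ (k - j) * u 0 j * a ^+ (k - j - l) * ('C(k, k - j)%:R * 'C(k - j, l)%:R)).
  by ring.
rewrite e2 -[LHS]mul1r -[X in X * _ = _]e3; ring.
Qed.

(** In characteristic zero the binomial factors of the Taylor coefficients are nonzero for [l <= k],
    so the low coefficients vanish exactly when the pairings do. *)
Lemma apolar_poly_dvd u a n : (n <= k.+1)%N ->
  (('X - a%:P) ^+ n %| apolar_poly u) <->
  forall l, (l < n)%N -> coef_pairing u (('X - a%:P) ^+ (k - l)) = 0.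
Proof.
move=> lenk; rewrite dvdp_exp_XsubC; split=> [/forallP u0 l ltln|u0].
  have := u0 (Ordinal ltln); rewrite /= apolar_poly_shift; last lia.
  rewrite !mulf_eq0 signr_eq0 pnatr_eq0 -leqn0 leqNgt bin_gt0.
  by rewrite (_ : l <= k)%N ?orFb; [move=> /eqP | lia].
by apply/forallP => l; rewrite apolar_poly_shift ?u0 ?mulr0 //; have := ltn_ord l; lia.
Qed.

Lemma apolar_poly_inj u : apolar_poly u = 0 -> u = 0.
Proof.
move=> u0; apply/rowP => j; rewrite mxE.
have /eqP := congr1 (fun p : {poly R} => p`_(k - j)) u0.
have lejk : (j <= k)%N by rewrite -ltnS.
rewrite coef_poly coef0 ltnS leq_subr !mulf_eq0 signr_eq0 pnatr_eq0.
rewrite -leqn0 leqNgt bin_gt0 leq_subr /= subKn // => /eqP <-.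
by congr (u 0 _); apply: val_inj; rewrite /= inordK.
Qed.

(** The invertible matrix of [apolar_poly], through which the dimension of an annihilator becomes
    that of a space of polynomials. *)
Definition apolar_mx : 'M[R]_k.+1 :=
  \matrix_(j, i) ((-1) ^+ i * 'C(k, i)%:R * (j == inord (k - i))%:R).

Lemma mul_apolar_mx u : u *m apolar_mx = poly_rV (apolar_poly u).
Proof.
apply/rowP => i; rewrite !mxE coef_poly ltn_ord.
rewrite (bigD1 (inord (k - i))) //= !mxE eqxx mulr1 mulrC big1 ?addr0 // => j.
by rewrite !mxE => /negbTE ->; rewrite !mulr0.
Qed.

Lemma size_apolar_poly u : (size (apolar_poly u) <= k.+1)%N.
Proof. exact: size_poly. Qed.

Lemma apolar_mx_unit : row_free apolar_mx.
Proof.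
rewrite -kermx_eq0; apply/eqP/row_matrixP => i; rewrite row0.
have : row i (kermx apolar_mx) *m apolar_mx = 0 by apply/sub_kermxP/row_sub.
move: (row i _) => u; rewrite mul_apolar_mx => u0.
apply: apolar_poly_inj; rewrite -[LHS](poly_rV_K (size_apolar_poly u)) u0.
by rewrite raddf0.
Qed.

Variables (s : seq R) (n : nat).
Hypotheses (uniq_s : uniq s) (lenk : (n <= k.+1)%N).

(** A basis of the multiples of degree at most k of the lowest power (X - a)^(k + 1 - n). For n = k
    - r this power has the exponent r + 1 of the smoothness condition. *)
Definition powers_mx a : 'M[R]_(n, k.+1) :=
  \matrix_(l < n) poly_rV (('X - a%:P) ^+ (k - l)).

(** The Taylor expansion of the cofactor [q] at [a] turns multiples of the lowest power into
    combinations of the higher ones. *)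
Lemma sub_powers_mx a v : (v <= powers_mx a)%MS <->
  exists2 q : {poly R}, (size q <= n)%N & v = poly_rV (('X - a%:P) ^+ (k.+1 - n) * q).
Proof.
split=> [/submxP[w ->]|[q sq ->]].
  exists (\sum_(l < n) w 0 l *: ('X - a%:P) ^+ (n - l.+1)).
    apply: leq_trans (size_sum _ _ _) _; apply/bigmax_leqP => l _.
    apply: leq_trans (size_scale_leq _ _) _.
    by rewrite size_exp_XsubC; have := ltn_ord l; lia.
  rewrite mulr_sumr mulmx_sum_row linear_sum; apply: eq_bigr => l _.
  rewrite rowK -scalerAr linearZ -exprD; congr (_ *: poly_rV (_ ^+ _)).
  by have := ltn_ord l; lia.
rewrite -(comp_polyXaddC_K q a) comp_polyE mulr_sumr linear_sum.
apply: summx_sub => i _; rewrite -scalerAr linearZ; apply: scalemx_sub.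
have lin : (i < n)%N.
  by rewrite (leq_trans (ltn_ord i)) // size_comp_poly2 // size_XaddC.
have lt_n : (n - i.+1 < n)%N by lia.
apply: (eq_row_sub (Ordinal lt_n)).
rewrite rowK -exprD; congr (poly_rV (_ ^+ _)).
by move: lenk lin lt_n; rewrite /=; move: (nat_of_ord i) => m; lia.
Qed.

Definition powers_sum_mx := (\sum_(i < size s) <<powers_mx s`_i>>)%MS.

Lemma ker_powers_sum u : (u <= kermx powers_sum_mx^T)%MS <->
  (\prod_(a <- s) ('X - a%:P) ^+ n %| apolar_poly u).
Proof.
rewrite dvdp_prod_exp_XsubC //.
have -> : (u <= kermx powers_sum_mx^T)%MS = (powers_sum_mx <= kermx u^T)%MS.
  apply/sub_kermxP/sub_kermxP => /(congr1 trmx);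
    by rewrite trmx_mul ?trmxK trmx0.
split=> [/sumsmx_subP us|/allP us].
  apply/allP => _ /(nthP 0)[i lti <-]; apply/apolar_poly_dvd => // l ltl.
  have := us (Ordinal lti) isT; rewrite genmxE => /row_subP/(_ (Ordinal ltl)).
  by rewrite rowK coef_pairingE => /sub_kermxP ->; rewrite mxE.
apply/sumsmx_subP => i _; rewrite genmxE; apply/row_subP => l.
have /apolar_poly_dvd/(_ _ (ltn_ord l)) := us _ (mem_nth 0 (ltn_ord i)).
move=> /(_ lenk) p0; apply/sub_kermxP; rewrite rowK; apply/matrixP => x y.
by rewrite !ord1 -coef_pairingE p0 mxE.
Qed.

(** By apolarity the annihilator corresponds to the polynomials of degree at most k that are
    divisible by [P]. They form a space of dimension k + 1 minus the degree of [P], truncated at 0,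
    and the rank is the complement. *)
Lemma rank_powers_sum : \rank powers_sum_mx = minn k.+1 (size s * n).
Proof.
pose P := \prod_(a <- s) ('X - a%:P) ^+ n.
have sP : size P = (size s * n).+1 by exact: size_prod_exp_XsubC.
move: sP; move: (size s * n)%N => m sP.
have P0 : P != 0 by rewrite -size_poly_eq0 sP.
(* The multiples of [P] by monomials; truncated subtraction leaves no rows when the degree of [P]
   exceeds k. *)
pose N := \matrix_(j < k.+1 - m) poly_rV (P * 'X^j) : 'M[R]_(_, k.+1).
have mulN (w : 'rV[R]_(k.+1 - m)) : w *m N = poly_rV (P * rVpoly w).
  rewrite mulmx_sum_row /rVpoly poly_def mulr_sumr linear_sum.
  apply: eq_bigr => j _; rewrite rowK -scalerAr linearZ; congr (_ *: _).
  by rewrite valK.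
have sPw (w : 'rV[R]_(k.+1 - m)) : (size (P * rVpoly w)%R <= k.+1)%N.
  have [->|w0] := eqVneq (rVpoly w) 0; first by rewrite mulr0 size_poly0.
  have sw : (size (rVpoly w) <= k.+1 - m)%N by exact: size_poly.
  have : (0 < size (rVpoly w))%N by rewrite size_poly_gt0.
  rewrite size_mul // sP; move: (size (rVpoly w)) sw => x; lia.
have freeN : row_free N.
  rewrite -kermx_eq0; apply/eqP/row_matrixP => i; rewrite row0.
  have : row i (kermx N) *m N = 0 by apply/sub_kermxP/row_sub.
  move: (row i _) => w; rewrite mulN => w0.
  have /eqP : P * rVpoly w = 0.
    by rewrite -(poly_rV_K (sPw w)) w0 raddf0.
  by rewrite mulf_eq0 (negbTE P0) /= => /eqP w1; rewrite -(rVpolyK w) w1 raddf0.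
have eqN : (kermx powers_sum_mx^T *m apolar_mx :=: N)%MS.
  apply/eqmxP/andP; split; apply/rV_subP => v.
    move=> /submxP[w ->]; rewrite mulmxA mul_apolar_mx.
    have /ker_powers_sum : (w *m kermx powers_sum_mx^T <= kermx powers_sum_mx^T)%MS.
      exact: submxMl.
    move: (w *m _) => u; rewrite -/P => /dvdpP[q qu].
    have sq : (size q <= k.+1 - m)%N.
      have := size_apolar_poly u; rewrite qu.
      have [->|q0] := eqVneq q 0; first by rewrite size_poly0.
      rewrite size_mul // sP; move: (size q); lia.
    rewrite qu mulrC -(poly_rV_K sq) -mulN; exact: submxMl.
  move=> /submxP[w ->].
  have /row_fullP[B BA] : row_full apolar_mx by rewrite row_full_unit -row_free_unit apolar_mx_unit.
  rewrite -[w *m N]mulmx1 -BA mulmxA; apply: submxMr.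
  apply/ker_powers_sum; rewrite -/P.
  rewrite -[apolar_poly _](poly_rV_K (size_apolar_poly _)) -mul_apolar_mx.
  by rewrite -(mulmxA _ B) BA mulmx1 mulN poly_rV_K // dvdp_mulr.
have := mxrankMfree (kermx powers_sum_mx^T) apolar_mx_unit.
rewrite eqN mxrank_ker mxrank_tr (eqP freeN).
by have := rank_leq_col powers_sum_mx; lia.
Qed.

Lemma has_dim_powers_ideal :
  has_dim [set f : {poly R} | exists2 q : R -> {poly R},
     forall a, (size (q a) <= n)%N &
     f = \sum_(a <- s) ('X - a%:P) ^+ (k.+1 - n) * q a]%classic
  (minn k.+1 (size s * n)).
Proof.
rewrite -rank_powers_sum.
have := has_dim_image (f := [the {linear _ -> {poly R}} of rVpoly (d := k.+1)]) (has_dim_rowspace powers_sum_mx).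
set B := (X in has_dim X _); set A := (X in _ -> has_dim X _).
suff -> : A = B.
  by apply=> u _ /= u0; rewrite -(rVpolyK u) u0 raddf0.
have sq (q : {poly R}) a : (size q <= n)%N -> (size (('X - a%:P) ^+ (k.+1 - n) * q)%R <= k.+1)%N.
  move=> sq; have [->|q0] := eqVneq q 0; first by rewrite mulr0 size_poly0.
  rewrite size_mul ?expf_neq0 ?polyXsubC_eq0 // size_exp_XsubC.
  by move: lenk sq; move: (size q) => m; lia.
apply/seteqP; split=> [_ [q qn ->]|_ [u /= /sub_sumsmxP[w ->] <-]].
  exists (\sum_(a <- s) poly_rV (('X - a%:P) ^+ (k.+1 - n) * q a)).
    rewrite (big_nth 0) big_mkord /=; apply: summx_sub_sums => i _.
    by rewrite genmxE; apply/sub_powers_mx; exists (q s`_i).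
  by rewrite linear_sum; apply: eq_bigr => a _ /=; rewrite poly_rV_K // sq.
have /choice[q hq] : forall i : 'I_(size s), exists q : {poly R},
    (size q <= n)%N /\
    w i *m <<powers_mx s`_i>>%MS = poly_rV (('X - (s`_i)%:P) ^+ (k.+1 - n) * q).
  move=> i; suff [q] : exists2 q : {poly R}, (size q <= n)%N &
    w i *m <<powers_mx s`_i>>%MS = poly_rV (('X - (s`_i)%:P) ^+ (k.+1 - n) * q).
    by exists q.
  by apply/sub_powers_mx; apply: submx_trans (submxMl _ _) _; rewrite genmxE.
(* The size bound is required at every [a], so the cofactor is set to 0 outside [s]. *)
exists (fun a => if insub (index a s) is Some i then q i else 0).
  move=> a; case: insubP => [i _ _|_]; last by rewrite size_poly0.
  by case: (hq i).
rewrite linear_sum (big_nth 0) big_mkord; apply: eq_bigr => i _ /=.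
have [qn ->] := hq i; rewrite poly_rV_K ?sq // index_uniq // insubT //= => lti.
by have -> : Sub (nat_of_ord i) lti = i :> 'I_(size s) by apply: val_inj.
Qed.

End PowersOfLinearForms.

Local Notation mvar i := (mpolyX _ (mnm1 i)).

(** * Homogeneous polynomials in a frame of R^3 *)

Section Frames.
Context {R : realType}.
Implicit Types (F G : {mpoly R[3]}) (M : 'M[R]_3).

Definition linear_form (u : 'cV[R]_3) : {mpoly R[3]} := \sum_i u i 0 *: (mvar i).

Lemma peval_linear_form u x : peval (linear_form u) x = (x *m u) 0 0.
Proof.
rewrite /peval /linear_form linear_sum mxE /=; apply: eq_bigr => i _.
by rewrite linearZ /= mevalXU mulrC.
Qed.

Lemma linear_form_homog u : linear_form u \is ishomog1 1 mdeg.
Proof.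
by apply: rpred_sum => i _; apply: rpredZ; rewrite dhomogX /= mdeg1.
Qed.

Lemma homog1E F : F \is ishomog1 1 mdeg -> F = linear_form (\col_i mcoeff (mnm1 i) F).
Proof.
move=> hF; apply/mpolyP => m; rewrite /linear_form.
under eq_bigr => i _ do rewrite mxE.
rewrite linear_sum /=; under eq_bigr => i _ do rewrite linearZ /= mcoeffX.
have [/eqP/mdeg1P[i /eqP ->]|m1] := eqVneq (mdeg m) 1%N.
  rewrite (bigD1 i) //= eqxx mulr1 big1 ?addr0 // => j ji.
  rewrite (_ : (mnm1 j == mnm1 i) = false) ?mulr0 //; apply/eqP => /mnmP/(_ j).
  by rewrite !mnm1E eqxx eq_sym (negbTE ji).
rewrite (dhomog_nemf_coeff hF m1) big1 // => i _.
rewrite (_ : (mnm1 i == m) = false) ?mulr0 //; apply/eqP => e.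
by move: m1; rewrite -e mdeg1.
Qed.

(* The coordinate forms of the basis of R^3 formed by the rows of [M]. *)
Definition coord M (j : 'I_3) : {mpoly R[3]} := linear_form (col j (invmx M)).

(** The index [k] is the order of vanishing at the point [row 2 M], and [j] is the first exponent
    inside the binary form of degree [k] in the two other coordinates. *)
Definition frame_monomial M (d k j : nat) : {mpoly R[3]} :=
  coord M 0 ^+ j * coord M 1 ^+ (k - j) * coord M 2 ^+ (d - k).

(* In the coordinates (X, Y, Z) of the frame [M], this is [F |-> F (x T, T, 1)]. *)
Definition polar_var M (i : 'I_3) : {poly {poly R}} :=
  ((M 0 i)%:P * 'X + (M 1 i)%:P)%:P * 'X + (M 2 i)%:P%:P.

Definition polar M : {mpoly R[3]} -> {poly {poly R}} :=
  mmap (polyC \o polyC) (polar_var M).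

HB.instance Definition _ M := GRing.RMorphism.on (polar M).

Lemma polarZ M c F : polar M (c *: F) = c%:P%:P * polar M F.
Proof. exact: (mmapZ _ [the {rmorphism R -> {poly {poly R}}} of polyC \o polyC]). Qed.

Lemma polarX M i : polar M (mvar i) = polar_var M i.
Proof.
rewrite /polar (mmapX _ [the {rmorphism R -> {poly {poly R}}} of polyC \o polyC]).
by rewrite mmap1U.
Qed.

Lemma polar_linear_form M u : polar M (linear_form u) =
  (((M *m u) 0 0)%:P * 'X + ((M *m u) 1 0)%:P)%:P * 'X + ((M *m u) 2 0)%:P%:P.
Proof.
rewrite /linear_form rmorph_sum /=.
under eq_bigr => i _ do rewrite polarZ polarX.
rewrite !mxE !big_ord_recl !big_ord0 /polar_var; ring.
Qed.

Lemma peval_polar M F (u w : R) :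
  peval F (row 2 M + w *: (u *: row 0 M + row 1 M)) = (polar M F).[w%:P].[u].
Proof.
rewrite /peval /meval /polar /mmap horner_sum horner_sum.
apply: eq_bigr => m _; rewrite !hornerM /= !hornerC; congr (_ * _).
rewrite /mmap1 horner_prod horner_prod; apply: eq_bigr => i _.
rewrite !horner_exp /polar_var !hornerE !mxE; congr (_ ^+ _); ring.
Qed.

Lemma polar_coord M : M \in unitmx ->
  [/\ polar M (coord M 0) = 'X%:P * 'X, polar M (coord M 1) = 'X
    & polar M (coord M 2) = 1].
Proof.
move=> uM; have e j i : (M *m col j (invmx M)) i 0 = (i == j)%:R.
  by rewrite colE mulmxA mulmxV // mul1mx mxE eqxx andbT.
by split; rewrite polar_linear_form !e /= ?(polyC0, mul0r, add0r, addr0, polyC1, mul1r).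
Qed.

Lemma polar_frame_monomial M d k j : M \in unitmx -> (j <= k)%N ->
  polar M (frame_monomial M d k j) = ('X^j)%:P * 'X^k.
Proof.
move=> /polar_coord[e0 e1 e2] jk.
rewrite /frame_monomial !rmorphM !rmorphXn /= e0 e1 e2 expr1n mulr1.
by rewrite exprMn -mulrA -exprD subnKC // -rmorphXn.
Qed.

Definition frame_sum M d (c : nat -> nat -> R) : {mpoly R[3]} :=
  \sum_(k < d.+1) \sum_(j < k.+1) c k j *: frame_monomial M d k j.

(** Distinct frame monomials go to distinct monomials in x and T, so the coefficients of a form in a
    frame can be read off its image under [polar]. *)
Lemma polar_frame_sum M d c k j : M \in unitmx ->
  (polar M (frame_sum M d c))`_k`_j = if (j <= k <= d)%N then c k j else 0.
Proof.
move=> uM; rewrite /frame_sum rmorph_sum /=.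
have -> : \sum_(i < d.+1) polar M (\sum_(j < i.+1) c i j *: frame_monomial M d i j) =
    \poly_(i < d.+1) \poly_(j < i.+1) c i j.
  rewrite poly_def; apply: eq_bigr => i _.
  rewrite rmorph_sum /= -mul_polyC poly_def rmorph_sum mulr_suml.
  apply: eq_bigr => l _; rewrite polarZ polar_frame_monomial // -1?ltnS //.
  by rewrite mulrA -polyCM !mul_polyC.
rewrite coef_poly ltnS; case: leqP => kd; rewrite ?coef0 ?andbF //.
by rewrite coef_poly ltnS andbT.
Qed.

Lemma frame_monomial_sum M d k j : (j <= k <= d)%N ->
  frame_monomial M d k j = frame_sum M d (fun k' j' => ((k' == k) && (j' == j))%:R).
Proof.
move=> /andP[jk kd]; rewrite /frame_sum.
have kd' : (k < d.+1)%N by []. have jk' : (j < k.+1)%N by [].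
rewrite (bigD1 (Ordinal kd')) //= (bigD1 (Ordinal jk')) //= !eqxx scale1r.
rewrite [X in _ + X + _]big1 ?addr0; last first.
  by move=> i; rewrite -val_eqE /= => /negbTE ->; rewrite scale0r.
rewrite big1 ?addr0 // => i; rewrite -val_eqE /= => /negbTE ik.
by rewrite big1 // => l _; rewrite ik scale0r.
Qed.

Lemma linear_subspace_frame_sum M d : linear_subspace (range (frame_sum M d)).
Proof.
split.
  exists (fun _ _ => 0) => //; rewrite /frame_sum big1 // => k _.
  by rewrite big1 // => j _; rewrite scale0r.
move=> a _ _ [c _ <-] [e _ <-]; exists (fun k j => a * c k j + e k j) => //.
rewrite /frame_sum scaler_sumr -big_split; apply: eq_bigr => k _ /=.
rewrite scaler_sumr -big_split; apply: eq_bigr => j _ /=.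
by rewrite scalerDl scalerA.
Qed.

Lemma mpolyX_coord M i : M \in unitmx -> (mvar i) = \sum_j M j i *: coord M j.
Proof.
move=> uM; rewrite /coord /linear_form.
under eq_bigr => j _ do rewrite scaler_sumr.
rewrite exchange_big /= (bigD1 i) //=.
have e l : \sum_(j < 3) M j i *: (col j (invmx M) l 0 *: (mvar l)) =
    ((l == i)%:R : R) *: (mvar l).
  have /matrixP/(_ l i) := mulVmx uM; rewrite !mxE => <-.
  by rewrite scaler_suml; apply: eq_bigr => j _; rewrite scalerA mxE mulrC.
rewrite e eqxx scale1r big1 ?addr0 // => l li.
by rewrite e (negbTE li) scale0r.
Qed.

(** By induction on the degree: a coordinate times a frame monomial is a frame monomial, and each
    variable is a combination of the coordinates. *)
Lemma homog_frame_sum M d F : M \in unitmx -> F \is ishomog1 d mdeg ->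
  exists c, F = frame_sum M d c.
Proof.
move=> uM hF; suff [c _ <-] : range (frame_sum M d) F by exists c.
have coordM i k G : range (frame_sum M k) G -> range (frame_sum M k.+1) (coord M i * G).
  move=> [c _ <-]; rewrite [X in range _ (_ * X)]/frame_sum mulr_sumr.
  have lin := linear_subspace_frame_sum M k.+1.
  rewrite (eq_bigr (fun l : 'I_k.+1 => 1 *: (coord M i *
      \sum_(j < l.+1) c l j *: frame_monomial M k l j))) => [|l _]; last by rewrite scale1r.
  apply: linear_subspace_sum => // l _; rewrite mulr_sumr.
  under eq_bigr => j _ do rewrite -scalerAr.
  apply: linear_subspace_sum => // j _.
  have := ltn_ord l; have := ltn_ord j; rewrite !ltnS => jl lk.
  case: i => -[|[|[|//]]] i3; rewrite /frame_monomial.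
  - rewrite (_ : Ordinal i3 = 0); last exact: val_inj.
    exists (fun k' j' : nat => ((k' == l.+1) && (j' == j.+1))%:R) => //.
    rewrite -(@frame_monomial_sum M k.+1 l.+1 j.+1); last by rewrite !ltnS jl.
    by rewrite /frame_monomial exprS !subSS !mulrA.
  - rewrite (_ : Ordinal i3 = 1); last exact: val_inj.
    exists (fun k' j' : nat => ((k' == l.+1) && (j' == j))%:R) => //.
    rewrite -(@frame_monomial_sum M k.+1 l.+1 j); last by rewrite !ltnS lk leqW.
    by rewrite /frame_monomial !subSS subSn // exprS; ring.
  - rewrite (_ : Ordinal i3 = 2); last exact: val_inj.
    exists (fun k' j' : nat => ((k' == l) && (j' == j))%:R) => //.
    rewrite -(@frame_monomial_sum M k.+1 l j); last by rewrite jl leqW.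
    by rewrite /frame_monomial subSn // exprS; ring.
have XM i k G : range (frame_sum M k) G -> range (frame_sum M k.+1) ((mvar i) * G).
  move=> hG; rewrite (mpolyX_coord i uM) mulr_suml.
  under eq_bigr => j _ do rewrite -scalerAl.
  by apply: linear_subspace_sum; [exact: linear_subspace_frame_sum | move=> j _; exact: coordM].
have hX m k : mdeg m = k -> range (frame_sum M k) (mpolyX R m).
  elim: k m => [|k IH] m mk.
    have -> : m = @mnm0 3 by apply/eqP; rewrite -mdeg_eq0 mk.
    exists (fun _ _ => 1) => //; rewrite /frame_sum !big_ord1 scale1r mpolyX0.
    by rewrite /frame_monomial !expr0 !mulr1.
  have [i mi] : exists i, (0 < m i)%N.
    apply/existsP; apply: contraPT mk => /existsPn m0.
    rewrite mdegE big1 // => i _; apply/eqP; rewrite -leqn0 leqNgt; exact: m0.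
  have Um : mpoly.lem (mnm1 i) m by rewrite lep1mP -lt0n.
  rewrite -(submK Um) addmC mpolyXD; apply/XM/IH; apply: succn_inj.
  by rewrite -mk -{2}(submK Um) mdegD mdeg1 addn1.
rewrite [X in range _ X](mpolyE F) big_seq; apply: linear_subspace_sum; first exact: linear_subspace_frame_sum.
by move=> m mF; apply: hX; apply: (dhomogP _ _ _ hF).
Qed.

Lemma homog_polarE M d F : M \in unitmx -> F \is ishomog1 d mdeg ->
  F = frame_sum M d (fun k j => (polar M F)`_k`_j).
Proof.
move=> uM hF; have [c Fc] := homog_frame_sum uM hF.
rewrite {1}Fc; apply: eq_bigr => k _; apply: eq_bigr => j _.
by rewrite Fc polar_frame_sum // -ltnS ltn_ord /= -ltnS ltn_ord.
Qed.

Lemma frame_sum_homog M d c : frame_sum M d c \is ishomog1 d mdeg.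
Proof.
apply: rpred_sum => k _; apply: rpred_sum => j _; apply: rpredZ.
have h i n : coord M i ^+ n \is ishomog1 n mdeg.
  by have := dhomogMn n (linear_form_homog (col i (invmx M))); rewrite mul1n.
have := dhomogM (dhomogM (h 0 j) (h 1 (k - j)%N)) (h 2 (d - k)%N).
by rewrite !subnKC // -ltnS.
Qed.

Lemma polar_homog_size M d F k j : M \in unitmx -> F \is ishomog1 d mdeg ->
  ~~ (j <= k <= d)%N -> (polar M F)`_k`_j = 0.
Proof.
move=> uM hF /negbTE jkd; have [c ->] := homog_frame_sum uM hF.
by rewrite polar_frame_sum // jkd.
Qed.

Lemma poly_eq0_roots (T : idomainType) (p : {poly T}) (x : nat -> T) :
  injective x -> (forall n, p.[x n] = 0) -> p = 0.
Proof.
move=> inj_x px; apply/eqP/contraT => p0.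
have := max_poly_roots p0 (rs := map x (iota 0 (size p))).
rewrite size_map size_iota ltnn; apply=> //; last by rewrite map_inj_uniq ?iota_uniq.
by apply/allP => _ /mapP[n _ ->]; apply/rootP.
Qed.

(** A polynomial in two parameters that vanishes on an infinite grid is 0; applied to [polar M F],
    this kills all frame coefficients of [F]. *)
Lemma homog_eq0_cone M d F : M \in unitmx -> F \is ishomog1 d mdeg ->
  (forall u w : R, 0 <= u -> 0 <= w -> w * (u + 1) <= 1 ->
     peval F (row 2 M + w *: (u *: row 0 M + row 1 M)) = 0) -> F = 0.
Proof.
move=> uM hF F0.
have inj_inv : injective (fun n : nat => (n.+2%:R : R)^-1).
  by move=> m n /invr_inj/eqP; rewrite eqr_nat => /eqP[].
suff pF : polar M F = 0.
  rewrite (homog_polarE uM hF) pF /frame_sum big1 // => k _.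
  by rewrite big1 // => j _; rewrite !coef0 scale0r.
(* The grid of values 1/(n+2) stays in the region: both parameters are at most 1/2, so w (u + 1) is
   at most 3/4. *)
apply: (@poly_eq0_roots _ _ (fun n : nat => (n.+2%:R : R)^-1%:P)).
  by move=> m n /polyC_inj/inj_inv.
move=> n; apply: (@poly_eq0_roots _ _ (fun n : nat => (n.+2%:R : R)^-1)) => // m.
rewrite -peval_polar; apply: F0; rewrite ?invr_ge0 ?ler0n //.
have le2 k : (k.+2%:R : R)^-1 <= 2^-1.
  by rewrite lef_pV2 ?posrE ?ltr0n // ler_nat.
have := le2 n; have := le2 m.
have : 0 <= (n.+2%:R : R)^-1 by rewrite invr_ge0 ler0n.
have : 0 <= (m.+2%:R : R)^-1 by rewrite invr_ge0 ler0n.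
move: (_^-1) => x; move: (_^-1) => y; nra.
Qed.

End Frames.

(** * Powers of the ideal of a vertex *)

Section JbarDimension.
Context {R : realType}.
Implicit Types (M : 'M[R]_3) (v : 'rV[R]_2) (F G : {mpoly R[3]}).

Lemma has_dim_image_lin (V W : lmodType R) (f : V -> W) (A : set V) n :
  linear f -> has_dim A n -> (forall x, A x -> f x = 0 -> x = 0) ->
  has_dim (f @` A)%classic n.
Proof.
move=> lin_f; pose fl : {linear V -> W} := HB.pack f (GRing.isLinear.Build _ _ _ _ f lin_f).
exact: (has_dim_image (f := fl)).
Qed.

Lemma size_polar_coef M F k : M \in unitmx -> (size ((polar M F)`_k)%R <= k.+1)%N.
Proof.
move=> uM; rewrite (mpolyE F) rmorph_sum /= coef_sum.
apply: leq_trans (size_sum _ _ _) _; apply/bigmax_leqP_seq => m _ _.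
rewrite polarZ coefCM mul_polyC; apply: leq_trans (size_scale_leq _ _) _.
apply/leq_sizeP => j lekj.
apply: (polar_homog_size (d := mdeg m)) => //; first by rewrite dhomogX /=.
by rewrite negb_and -ltnNge lekj.
Qed.

Lemma homog_polar_inj M d F G : M \in unitmx ->
  F \is ishomog1 d mdeg -> G \is ishomog1 d mdeg ->
  (forall k, (k <= d)%N -> (polar M F)`_k = (polar M G)`_k) -> F = G.
Proof.
move=> uM hF hG e; rewrite (homog_polarE uM hF) (homog_polarE uM hG).
by apply: eq_bigr => k _; apply: eq_bigr => j _; rewrite e // -ltnS.
Qed.

Lemma ideal_gen0 (S : comNzRingType) (A : set S) : ideal_gen A 0.
Proof. by exists 0%N, (fun=> 0), (fun=> 0); split=> [[]//|]; rewrite big_ord0. Qed.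

Lemma ideal_gen_linear (S : comNzRingType) (A : set S) (I : Type) (s : seq I)
    (P : pred I) (c F : I -> S) :
  (forall i, P i -> ideal_gen A (F i)) -> ideal_gen A (\sum_(i <- s | P i) c i * F i).
Proof.
move=> AF; elim: s => [|i s IH].
  by rewrite big_nil; exact: ideal_gen0.
rewrite big_cons; case: ifP => // /AF[m [e [a [Aa ->]]]].
case: IH => n [e' [a' [Aa' ->]]]; exists (m + n)%N.
exists (fun j => match fintype.split j with inl k => c i * e k | inr k => e' k end).
exists (fun j => match fintype.split j with inl k => a k | inr k => a' k end).
split=> [j|]; first by case: fintype.split.
rewrite big_split_ord /= mulr_sumr; congr (_ + _); apply: eq_bigr => j _.
  by rewrite (unsplitK (inl j)) mulrA.
by rewrite (unsplitK (inr j)).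
Qed.

Lemma ideal_genM (S : comNzRingType) (A : set S) (c F : S) :
  ideal_gen A F -> ideal_gen A (c * F).
Proof.
move=> AF; have := @ideal_gen_linear S A _ [:: tt] predT (fun=> c) (fun=> F).
by rewrite big_seq1; apply.
Qed.

Lemma ideal_gen_mem (S : comNzRingType) (A : set S) (F : S) : A F -> ideal_gen A F.
Proof.
by move=> AF; exists 1%N, (fun=> 1), (fun=> F); split=> //; rewrite big_ord1 mul1r.
Qed.

Lemma ideal_gen1 (S : comNzRingType) (a F : S) :
  ideal_gen [set a]%classic F -> exists q, F = q * a.
Proof.
move=> [n [c [b [ba ->]]]]; exists (\sum_i c i).
by rewrite mulr_suml; apply: eq_bigr => i _; rewrite ba.
Qed.

Lemma ideal_pow_prod (S : comNzRingType) (I : set S) (n : nat) (s : seq S) :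
  (forall x, x \in s -> I x) -> (n <= size s)%N -> ideal_pow I n (\prod_(x <- s) x).
Proof.
move=> Is ns; rewrite -(cat_take_drop n s) big_cat /= mulrC.
apply/ideal_genM/ideal_gen_mem; exists (fun i => nth 0 s i); split.
  by move=> i; apply/Is/mem_nth/(leq_trans (ltn_ord i)).
by rewrite (big_nth 0) size_takel // big_mkord; apply: eq_bigr => i _; rewrite nth_take.
Qed.

Lemma realization_vertex v x : realization [fset v] x -> x = v.
Proof.
case=> n [w [a [_ w1 av ->]]].
have av' i : a i = v by apply/fset1P; exact: av.
by under eq_bigr => i _ do rewrite av'; rewrite -scaler_suml w1 scale1r.
Qed.

Lemma mem_realization (sigma : {fset 'rV[R]_2}) v : v \in sigma -> realization sigma v.
Proof.
move=> vs; exists 1%N, (fun=> 1), (fun=> v); split=> //.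
- by rewrite big_ord1.
- by rewrite big_ord1 scale1r.
Qed.

Lemma cone_embed (sigma : {fset 'rV[R]_2}) v : realization sigma v -> cone sigma (embed v).
Proof.
move=> vs; exists 1%N, (fun=> 1), (fun=> embed v); split=> //.
- by rewrite big_ord1.
- by move=> _; right; exists v.
- by rewrite big_ord1 scale1r.
Qed.

Lemma cone_vertex v u : cone [fset v] u -> exists t, u = t *: embed v.
Proof.
case=> n [w [a [_ _ av ->]]].
have /choice[t ta] : forall i, exists t, a i = t *: embed v.
  move=> i; case: (av i) => [->|[x /realization_vertex -> <-]].
    by exists 0; rewrite scale0r.
  by exists 1; rewrite scale1r.
exists (\sum_i w i * t i); rewrite scaler_suml.
by apply: eq_bigr => i _; rewrite ta scalerA.
Qed.

Lemma vertex_ideal_linear_form v (u : 'cV[R]_3) :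
  embed v *m u = 0 -> vertex_ideal v (linear_form u).
Proof.
move=> vu t _ /cone_vertex[t' ->].
by rewrite peval_linear_form scalerA -scalemxAl vu scaler0 mxE.
Qed.

(** Setting the outer variable to 0 gives the vertex itself, whatever the value of the inner
    variable. *)
Lemma polar_vertex_ideal M v F : row 2 M = embed v ->
  vertex_ideal v F -> (polar M F)`_0 = 0.
Proof.
move=> M2 hF; rewrite -horner_coef0; apply: (@poly_eq0_roots _ _ (fun n => n%:R)).
  by move=> m n /eqP; rewrite eqr_nat => /eqP.
move=> n; have := peval_polar M F n%:R 0; rewrite polyC0 => <-.
rewrite scale0r addr0 M2 -[embed v]scale1r; apply: hF.
by apply/cone_embed/mem_realization; rewrite fset11.
Qed.

(** Each factor is divisible by the outer variable, so a product of n factors is divisible by its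
    n-th power. *)
Lemma polar_ideal_pow M v n F k : row 2 M = embed v ->
  ideal_pow (vertex_ideal v) n F -> (k < n)%N -> (polar M F)`_k = 0.
Proof.
move=> M2 [m [c [a [ha ->]]]] kn; rewrite rmorph_sum coef_sum big1 // => i _.
have [b [hb ->]] := ha i; rewrite rmorphM rmorph_prod /=.
have -> : \prod_i polar M (b i) = 'X^n * \prod_i drop_poly 1 (polar M (b i)).
  rewrite -[in 'X^n](card_ord n) -prodr_const -big_split /=; apply: eq_bigr => l _.
  rewrite -[LHS](poly_take_drop 1) mulrC (_ : take_poly 1 _ = 0) ?add0r //.
  apply/polyP => x; rewrite coef_take_poly coef0; case: x => //=.
  by rewrite (polar_vertex_ideal M2 (hb l)).
by rewrite mulrCA coefXnM kn.
Qed.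

(** A frame monomial of order k contains k linear factors that vanish at the vertex, and only orders
    k >= n occur in [F]. *)
Lemma homog_ideal_pow M v d n F : M \in unitmx -> row 2 M = embed v ->
  F \is ishomog1 d mdeg -> (forall k, (k < n)%N -> (polar M F)`_k = 0) ->
  ideal_pow (vertex_ideal v) n F.
Proof.
move=> uM M2 hF F0; rewrite (homog_polarE uM hF) /frame_sum.
have e j : j != 2 -> vertex_ideal v (coord M j).
  move=> j2; apply: vertex_ideal_linear_form; rewrite -M2 -row_mul colE mulmxA.
  rewrite mulmxV // mul1mx; apply/matrixP => x y; rewrite !mxE.
  by rewrite eq_sym (negbTE j2).
rewrite (eq_bigr (fun k : 'I_d.+1 => 1 * \sum_(j < k.+1)
    (polar M F)`_k`_j *: frame_monomial M d k j)); last by move=> k _; rewrite mul1r.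
apply: ideal_gen_linear => k _.
rewrite (eq_bigr (fun j : 'I_k.+1 => 1 *
    ((polar M F)`_k`_j *: frame_monomial M d k j))); last by move=> j _; rewrite mul1r.
apply: ideal_gen_linear => j _.
case: (ltnP k n) => [/F0 ->|nk].
  by rewrite coef0 scale0r; apply: ideal_gen0.
rewrite -mul_mpolyC; apply: ideal_genM; rewrite /frame_monomial mulrC.
apply: ideal_genM.
have -> : coord M 0 ^+ j * coord M 1 ^+ (k - j) =
    \prod_(x <- nseq j (coord M 0) ++ nseq (k - j) (coord M 1)) x.
  by rewrite big_cat !big_nseq -!Monoid.iteropE.
apply: ideal_pow_prod; last by rewrite size_cat !size_nseq subnKC // -ltnS.
by move=> x; rewrite mem_cat => /orP[] /nseqP[-> _]; apply: e.
Qed.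

End JbarDimension.

(** * Dimension of the vertex ideal in a fixed degree *)

Section GroupRoots.
Context {R : realType} {T : choiceType}.

Lemma big_group (E : {fset T}) (a : T -> R) (s : seq R) (g : T -> {poly R}) :
  uniq s -> (forall t, t \in E -> a t \in s) ->
  \sum_(t <- E) g t = \sum_(x <- s) \sum_(t <- E | a t == x) g t.
Proof.
move=> us aE; rewrite (exchange_big_dep predT) //= big_seq [RHS]big_seq.
apply: eq_bigr => t /aE ats; rewrite -big_filter (_ : seq.filter _ s = [:: a t]) ?big_seq1 //.
by rewrite (eq_filter (a2 := pred1 (a t))) ?filter_pred1_uniq // => x /=; rewrite eq_sym.
Qed.

(** At a vertex, edges of equal slope have the same root and contribute the same multiples. This is
    why the number of slopes, not of edges, enters the dimension. *)
Lemma group_powers (E : {fset T}) (a : T -> R) (s : seq R) (n e : nat) :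
  uniq s -> (forall t, t \in E -> a t \in s) ->
  (forall x, x \in s -> exists2 t, t \in E & a t = x) ->
  [set f : {poly R} | exists2 q : R -> {poly R}, forall x, (size (q x) <= n)%N &
     f = \sum_(x <- s) ('X - x%:P) ^+ e * q x]%classic =
  [set f : {poly R} | exists2 q : T -> {poly R}, forall t, (size (q t) <= n)%N &
     f = \sum_(t <- E) ('X - (a t)%:P) ^+ e * q t]%classic.
Proof.
move=> us aE sE; apply/seteqP; split=> _ [q sq ->]; last first.
  exists (fun x => \sum_(t <- E | a t == x) q t).
    move=> x; apply: leq_trans (size_sum _ _ _) _.
    by apply/bigmax_leqP_seq => t _ _.
  rewrite (big_group _ us aE); apply: eq_bigr => x _; rewrite mulr_sumr.
  by apply: eq_bigr => t /eqP ->.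

(* The whole cofactor of a root goes to the first index that carries it; the other indices get 0. *)
exists (fun t => if index t E == find (fun t' => a t' == a t) E then q (a t) else 0).
  by move=> t; case: ifP; rewrite ?size_poly0.
rewrite (big_group _ us aE) big_seq [RHS]big_seq; apply: eq_bigr => x xs.
have [t0 t0E at0] := sE x xs.
have hasx : has (fun t' => a t' == x) E by apply/hasP; exists t0 => //; rewrite at0.
pose t1 := nth t0 E (find (fun t' => a t' == x) E).
have t1E : t1 \in (E : seq T) by rewrite mem_nth // -has_find.
have at1 : a t1 = x by apply/eqP; exact: (nth_find t0 hasx).
have it1 : index t1 E = find (fun t' => a t' == x) E.
  by rewrite index_uniq ?fset_uniq // -has_find.
rewrite big_mkcond (bigD1_seq t1) ?fset_uniq //= at1 eqxx it1 eqxx.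
rewrite big_seq_cond big1 ?addr0 // => t /andP[tE tt1]; case: eqP => // ->.
case: eqP => [e'|]; last by rewrite mulr0.
by case/eqP: tt1; rewrite -(nth_index t0 tE) e'.
Qed.

End GroupRoots.

Lemma rV2P (R : Type) (x y : 'rV[R]_2) : x 0 0 = y 0 0 -> x 0 1 = y 0 1 -> x = y.
Proof.
move=> e0 e1; apply/rowP => -[[|[|//]] i].
  by rewrite (_ : Ordinal i = 0 :> 'I_2) //; apply: val_inj.
by rewrite (_ : Ordinal i = 1 :> 'I_2) //; apply: val_inj.
Qed.

Section VertexFrame.
Context {R : realType}.
Implicit Types (v u : 'rV[R]_2) (mu : R) (F : {mpoly R[3]}).

Lemma embedE v :
  [/\ embed v 0 0 = v 0 0, embed v 0 1 = v 0 1 & embed v 0 2 = 1].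
Proof.
split; rewrite /embed mxE; case: splitP => j /= e.
- by congr (v 0 _); apply: ord_inj; rewrite -e.
- by move: e; rewrite add2n.
- by congr (v 0 _); apply: ord_inj; rewrite -e.
- by move: e; rewrite add2n.
- by have := ltn_ord j; rewrite -e.
- by rewrite mxE (_ : j = 0) //; apply: val_inj; case: j e => -[].
Qed.

(** The first direction (1, mu) will be chosen parallel to no edge at the vertex. Each edge form
    then has a nonzero first coefficient, so [polar] sends it to a nonzero constant times ['X - a]
    times the outer variable. *)
Definition vertex_frame v mu : 'M[R]_3 := \matrix_(i < 3, j < 3)
  nth 0 (nth [::] [:: [:: 1; mu; 0]; [:: 0; 1; 0]; [:: v 0 0; v 0 1; 1]] i) j.

Lemma vertex_frame_unit v mu : vertex_frame v mu \in unitmx.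
Proof.
pose N : 'M[R]_3 := \matrix_(i < 3, j < 3)
  nth 0 (nth [::] [:: [:: 1; - mu; 0]; [:: 0; 1; 0];
    [:: - v 0 0; mu * v 0 0 - v 0 1; 1]] i) j.
suff /mulmx1_unit[] : vertex_frame v mu *m N = 1%:M by [].
apply/matrixP => i j; rewrite !mxE !big_ord_recl big_ord0 !mxE.
by case: i => -[|[|[|//]]] ?; case: j => -[|[|[|//]]] ? /=; ring.
Qed.

Lemma vertex_frame2 v mu : row 2 (vertex_frame v mu) = embed v.
Proof.
have [e0 e1 e2] := embedE v; apply/rowP => j; rewrite ![LHS]mxE.
case: j => -[|[|[|//]]] ? /=; [rewrite -e0|rewrite -e1|rewrite -e2];
  by congr (embed v 0 _); apply: val_inj.
Qed.

(** The root of an edge form in [vertex_frame]. The form of a vertical edge vanishes on the second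
    direction (0, 1), which gives the root 0. *)
Definition slope_root mu (o : option R) : R :=
  if o is Some sigma then (sigma - mu)^-1 else 0.

Lemma slope_root_inj mu o o' : o != Some mu -> o' != Some mu ->
  slope_root mu o = slope_root mu o' -> o = o'.
Proof.
case: o o' => [x|] [y|] //= xm ym.
- by move=> /invr_inj /addIr ->.
- by move=> /eqP; rewrite invr_eq0 subr_eq0 => /eqP e; move: xm; rewrite e eqxx.
- by move=> /esym /eqP; rewrite invr_eq0 subr_eq0 => /eqP e; move: ym; rewrite e eqxx.
Qed.

Lemma polar_edge_form v u mu F : F \is ishomog1 1 mdeg -> F != 0 ->
  peval F (embed v) = 0 -> peval F (embed u) = 0 -> u != v ->
  slope v u != Some mu ->
  exists2 c, c != 0 & polar (vertex_frame v mu) F =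
    (c%:P * ('X - (slope_root mu (slope v u))%:P))%:P * 'X.
Proof.
move=> /homog1E ->; move: (\col_i _) => U F0; rewrite !peval_linear_form.
have mulE x : (embed x *m U) 0 0 = x 0 0 * U 0 0 + x 0 1 * U 1 0 + U 2 0.
  have [e0 e1 e2] := embedE x; rewrite mxE !big_ord_recl big_ord0 addr0.
  rewrite -e0 -e1 -[U 2 0]mul1r -e2 -addrA.
  by congr (embed x 0 _ * U _ 0 + (embed x 0 _ * U _ 0 + embed x 0 _ * U _ 0)); apply: val_inj.
rewrite !mulE => Fv Fu uv sl.
have U0 : ~ (U 0 0 = 0 /\ U 1 0 = 0).
  move=> [z0 z1]; move: Fv; rewrite z0 z1 !mulr0 !add0r => z2.
  case/eqP: F0; rewrite /linear_form !big_ord_recl big_ord0.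
  rewrite (_ : lift ord0 ord0 = 1); last exact: val_inj.
  rewrite (_ : lift ord0 (lift ord0 ord0) = 2); last exact: val_inj.
  by rewrite z0 z1 z2 !scale0r !addr0.
(* The difference of the two vanishing conditions: the form kills the direction of the edge. *)
have Fw : (u 0 0 - v 0 0) * U 0 0 + (u 0 1 - v 0 1) * U 1 0 = 0.
  by move: Fv Fu; lra.
have e i : (vertex_frame v mu *m U) i 0 =
    nth 0 [:: U 0 0 + mu * U 1 0; U 1 0; v 0 0 * U 0 0 + v 0 1 * U 1 0 + U 2 0] i.
  rewrite mxE !big_ord_recl big_ord0 !mxE /=.
  rewrite (_ : lift ord0 ord0 = 1); last exact: val_inj.
  rewrite (_ : lift ord0 (lift ord0 ord0) = 2); last exact: val_inj.
  by case: i => -[|[|[|//]]] ? /=; ring.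
suff [c0 cE] : U 0 0 + mu * U 1 0 != 0 /\
    U 1 0 = - (U 0 0 + mu * U 1 0) * slope_root mu (slope v u).
  exists (U 0 0 + mu * U 1 0) => //; rewrite polar_linear_form !e /= Fv.
  move: cE; move: (_ + mu * _) (slope_root _ _) => c x ->.
  by rewrite polyC0 addr0; congr (_%:P * 'X); rewrite polyCM polyCN; ring.
move: sl; rewrite /slope; case: (v 0 0 =P u 0 0) => [e0 _|/eqP ne0 sl] /=.
  have w1 : u 0 1 - v 0 1 != 0.
    apply: contraNneq uv => /eqP; rewrite subr_eq0 => /eqP e1.
    by apply/eqP/rV2P; rewrite ?e0 ?e1.
  have z1 : U 1 0 = 0.
    apply/eqP; move: Fw; rewrite e0 subrr mul0r add0r => /eqP.
    by rewrite mulf_eq0 (negbTE w1).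
  rewrite z1 !mulr0 addr0; split=> //.
  by apply/eqP => z0; apply: U0.
have w0 : u 0 0 - v 0 0 != 0 by rewrite subr_eq0 eq_sym.
set x := (u 0 1 - v 0 1) / (u 0 0 - v 0 0) in sl *.
have xm : x - mu != 0.
  by apply: contraNneq sl => /eqP; rewrite subr_eq0 => /eqP ->.
have z0 : U 0 0 = - x * U 1 0.
  apply: (mulfI w0).
  have -> : (u 0 0 - v 0 0) * (- x * U 1 0) = - (u 0 1 - v 0 1) * U 1 0.
    by rewrite /x; field.
  by move: Fw; lra.
have z1 : U 1 0 != 0.
  by apply/eqP => z1; apply: U0; rewrite z0 z1 mulr0.
rewrite z0; split; last by field.
rewrite -mulrDl mulf_eq0 negb_or z1 andbT.
by rewrite -oppr_eq0 opprD opprK.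
Qed.

End VertexFrame.

(** Functions supported on [s < k <= m] model the direct sum of the spaces [D k]; the induction adds
    the top degree through the functions [dl x] concentrated there. *)
Lemma has_dim_graded (R : realType) (V : lmodType R) (D : nat -> set V)
    (n : nat -> nat) s m : (s <= m)%N ->
  (forall k, (s < k <= m)%N -> has_dim (D k) (n k)) ->
  has_dim [set f : nat -> V | forall k, if (s < k <= m)%N then D k (f k) else f k = 0]%classic
    (\sum_(s.+1 <= k < m.+1) n k).
Proof.
move=> sm; rewrite -(subnKC sm); move: (m - s)%N => {m sm} i.
elim: i => [|i IH] hD.
  rewrite addn0 big_geq // (_ : [set _ | _]%classic = [set 0]%classic); first exact: has_dim0.
  apply/seteqP; split=> f /=; first by move=> f0; apply/funext => k; have := f0 k; case: ifP => //; lia.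
  by move=> -> k; case: ifP => //; lia.
rewrite addnS big_nat_recr /=; last by lia.
pose dl (x : V) : nat -> V := fun k => if k == (s + i).+1 then x else 0.
have h1 : has_dim (dl @` D (s + i).+1)%classic (n (s + i).+1).
  apply: has_dim_image_lin; last 2 first.
  - by apply: hD; lia.
  - by move=> x _ /(congr1 (fun f => f (s + i).+1)); rewrite /dl eqxx.
  move=> a x y; apply/funext => k.
  have -> : (a *: dl x + dl y) k = a *: dl x k + dl y k by [].
  by rewrite /dl; case: ifP => // _; rewrite scaler0 addr0.
have h2 := IH (fun k hk => hD k ltac:(lia)).
have := has_dim_add h2 h1; set A := (X in has_dim X _); set B := (X in _ -> has_dim X _).
suff -> : A = B.
  apply=> f hf [x _ xf]; apply/funext => k; have := hf k.
  case: ifP => // ik _; rewrite -xf /dl; case: eqP => // e; lia.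
apply/seteqP; split=> [_ [f hf [_ [x Dx <-] <-]] k|f hf].
  have -> : (f + dl x) k = f k + dl x k by [].
  have := hf k; rewrite /dl; case: eqP => [->|/eqP e].
    rewrite ifF; last by lia.
    by rewrite ifT; [move=> ->; rewrite add0r | lia].
  rewrite addr0 (_ : (s < k <= (s + i).+1)%N = (s < k <= s + i)%N) //; lia.
exists (fun k => if k == (s + i).+1 then 0 else f k).
  move=> k; have := hf k; case: eqP => [->|/eqP e].
    by move=> _; rewrite ifF //; lia.
  rewrite (_ : (s < k <= (s + i).+1)%N = (s < k <= s + i)%N) //; lia.
exists (dl (f (s + i).+1)).
  by exists (f (s + i).+1) => //; have := hf (s + i).+1; case: ifP => //; lia.
apply/funext => k.
have -> : forall g h : nat -> V, (g + h) k = g k + h k by [].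
by rewrite /dl; case: eqP => [->|_]; rewrite ?add0r ?addr0.
Qed.

Lemma exists_notin (R : realType) (s : seq R) : exists x, x \notin s.
Proof.
exists (\sum_(y <- s) `|y| + 1); apply/negP => xs.
set x := _ + 1 in xs.
have : x <= \sum_(y <- s) `|y|.
  by rewrite (big_rem x) //= (le_trans (ler_norm x)) // lerDl sumr_ge0.
by rewrite /x; lra.
Qed.

(** The map [polar] separates the orders k of vanishing at the vertex. The ideal power removes the
    orders k <= s; in an order k > s each edge contributes the multiples of degree at most k of the
    (r+1)-st power of a linear polynomial, and the components of different orders can be prescribed
    independently. *)
Lemma has_dim_Jbar_sum (R : realType) (T : choiceType) (E : {fset T})
    (ell : T -> {mpoly R[3]}) (sl : T -> option R) (v : 'rV[R]_2) (r s d : nat) :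
  (r <= s)%N -> (s <= d)%N ->
  (forall t, t \in E -> exists u, [/\ u != v, sl t = slope v u,
     ell t \is ishomog1 1 mdeg /\ ell t != 0, peval (ell t) (embed v) = 0
     & peval (ell t) (embed u) = 0]) ->
  has_dim (degree_part (ideal_sum E (fun t => ideal_gen [set ell t ^+ r.+1] `&`
      ideal_pow (vertex_ideal v) s.+1)%classic) d)
    (\sum_(s.+1 <= k < d.+1) minn k.+1 (#|` [fset sl t | t in E]| * (k - r))).
Proof.
move=> rs sd hE; set S := [fset sl t | t in E].
(* A slope different from all those present puts [vertex_frame] in general position. *)
have [mu hmu] := exists_notin (pmap id (S : seq (option R))).
have Smu o : o \in S -> o != Some mu.
  move=> oS; apply: contraNneq hmu => eo; by rewrite mem_pmap map_id -eo.
have slS t : t \in E -> sl t \in S by move=> tE; apply: in_imfset.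
pose M := vertex_frame v mu; pose a t := slope_root mu (sl t).
have uM : M \in unitmx := vertex_frame_unit v mu.
have M2 : row 2 M = embed v := vertex_frame2 v mu.
have /choice[c hc] : forall t, exists c, t \in E ->
    c != 0 /\ polar M (ell t) = (c%:P * ('X - (a t)%:P))%:P * 'X.
  move=> t; case: (boolP (t \in E)) => [tE|]; last by exists 0.
  have [u [uv slt [h1 h2] h3 h4]] := hE t tE.
  have := Smu _ (slS _ tE); rewrite slt => smu.
  have [c c0 e] := polar_edge_form h1 h2 h3 h4 uv smu.
  by exists c => _; rewrite /a slt.
pose as_ := [seq slope_root mu o | o <- (S : seq (option R))].
have uas : uniq as_.
  rewrite map_inj_in_uniq ?fset_uniq // => o o' oS o'S.
  by apply: slope_root_inj; apply: Smu.
have aas t : t \in E -> a t \in as_ by move=> /slS tS; apply/map_f.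
have asa x : x \in as_ -> exists2 t, t \in E & a t = x.
  by move=> /mapP[y /imfsetP[t /= tE ->] ->]; exists t.
(* The component of order k. A cofactor has degree at most k - r - 1 there, whence the size
   bound. *)
pose D k : set {poly R} := [set f : {poly R} | exists2 q : T -> {poly R},
   forall t, (size (q t) <= k - r)%N &
   f = \sum_(t <- E) ('X - (a t)%:P) ^+ r.+1 * q t]%classic.
have hD k : (s < k <= d)%N -> has_dim (D k) (minn k.+1 (#|` S| * (k - r))).
  move=> skd; rewrite /D -(group_powers _ _ uas aas asa).
  have -> : #|` S| = size as_ by rewrite size_map.
  have knr : (k - r <= k.+1)%N by lia.
  have := has_dim_powers_ideal uas knr.
  by rewrite (_ : (k.+1 - (k - r))%N = r.+1) //; lia.
have := has_dim_graded sd hD; set A := (X in has_dim X _).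
(* Homogenization in the frame, inverse to taking components. *)
pose Phi (f : nat -> {poly R}) := frame_sum M d (fun k j => (f k)`_j).
have linPhi : linear Phi.
  move=> x f g; rewrite /Phi /frame_sum scaler_sumr -big_split.
  apply: eq_bigr => k _ /=; rewrite scaler_sumr -big_split.
  apply: eq_bigr => j _ /=; rewrite scalerA -scalerDl; congr (_ *: _).
  have -> : (x *: f + g) k = x *: f k + g k by [].
  by rewrite coefD coefZ.
have polPhi f k : A f -> (polar M (Phi f))`_k = f k.
  move=> Af; apply/polyP => j; rewrite /Phi polar_frame_sum //.
  have := Af k; case: ifP => [skd|skd ->]; last by rewrite coef0 if_same.
  move=> [q sq ->]; case: (leqP j k) => jk /=; first by case/andP: skd => _ ->.
  rewrite coef_sum big1 // => t _; apply/(leq_sizeP _ j) => //.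
  apply: leq_trans (size_polyMleq _ _) _; rewrite size_exp_XsubC.
  by have := sq t; move: (size _) => z; lia.
move=> /(has_dim_image_lin linPhi) hA; apply: (eq_ind _ (fun X => has_dim X _) (hA _)).
  move=> f Af f0; apply/funext => k; rewrite -(polPhi f k Af) f0 rmorph0 coef0 //.
suff -> : (Phi @` A)%classic = degree_part (ideal_sum E (fun t => ideal_gen [set ell t ^+ r.+1] `&`
      ideal_pow (vertex_ideal v) s.+1)%classic) d by [].
have ellX t (Q : {mpoly R[3]}) k : t \in E -> (s < k)%N ->
    (polar M (Q * ell t ^+ r.+1))`_k =
    ('X - (a t)%:P) ^+ r.+1 * ((c t ^+ r.+1) *: (polar M Q)`_(k - r.+1)).
  move=> tE sk; have [_ e] := hc t tE.
  rewrite rmorphM rmorphXn /= e exprMn -rmorphXn /= mulrA coefMXn.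
  rewrite ltnNge (leq_trans _ sk) //= coefMC exprMn -polyC_exp -mul_polyC.
  by ring.
apply/seteqP; split=> [_ [f Af <-]|F [[G [hG FG]] hF]]; last first.
  exists (fun k => (polar M F)`_k); last by rewrite [RHS](homog_polarE uM hF).
  have F0 k : (k <= s)%N -> (polar M F)`_k = 0.
    move=> ks; rewrite FG rmorph_sum coef_sum big_seq big1 // => t tE.
    by have [_ /(polar_ideal_pow M2)->] := hG t tE.
  move=> k; case: ifP => [/andP[sk kd]|/negbT]; last first.
    rewrite negb_and -leqNgt -ltnNge => /orP[/F0//|dk].
    apply/polyP => j; rewrite coef0 (polar_homog_size uM hF) //.
    by rewrite negb_and -!ltnNge dk orbT.
  have /choice[Q hQ] : forall t, exists Q, t \in E -> G t = Q * ell t ^+ r.+1.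
    move=> t; case: (boolP (t \in E)) => [tE|]; last by exists 0.
    by have [/ideal_gen1[Q ->] _] := hG t tE; exists Q.
  exists (fun t => (c t ^+ r.+1) *: (polar M (Q t))`_(k - r.+1)).
    move=> t; apply: leq_trans (size_scale_leq _ _) _.
    by apply: leq_trans (size_polar_coef _ _ uM) _; lia.
  rewrite FG rmorph_sum coef_sum big_seq [RHS]big_seq; apply: eq_bigr => t tE.
  by rewrite (hQ t tE) ellX.
split; last exact: frame_sum_homog.
(* For [s = d] no order is left and the form is 0. This case is apart because [d - r.+1] is a
   truncated difference when [r = d]. *)
case: (ltnP s d) => [ltsd|leds]; last first.
  exists (fun=> 0); split.
    by move=> t _; split; exact: ideal_gen0.
  rewrite big1 // /Phi /frame_sum big1 // => k _; rewrite big1 // => j _.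
  have -> : f k = 0 by have := Af k; case: ifP => //; have := ltn_ord k; lia.
  by rewrite coef0 scale0r.
have /choice[q hq] : forall k, exists q : T -> {poly R}, (s < k <= d)%N ->
    (forall t, (size (q t) <= k - r)%N) /\
    f k = \sum_(t <- E) ('X - (a t)%:P) ^+ r.+1 * q t.
  move=> k; have := Af k; case: ifP => [_ [q h1 h2]|_ _]; first by exists q.
  by exists (fun=> 0).
(* The cofactor of the edge [t]: components are shifted down by r + 1 and divided by the leading
   constant c^(r+1) of the power of the edge form. Orders at most s are cut off so that the product
   lies in the ideal power. *)
pose Q t := frame_sum M (d - r.+1)
  (fun k j => if (s < k + r.+1)%N then (c t ^- r.+1) * (q (k + r.+1)%N t)`_j else 0).
have QE t k : t \in E -> (polar M (Q t * ell t ^+ r.+1))`_k =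
    if (s < k <= d)%N then ('X - (a t)%:P) ^+ r.+1 * q k t else 0.
  move=> tE; have [c0 e] := hc t tE.
  case: (ltnP s k) => sk /=; last first.
    rewrite rmorphM rmorphXn /= e exprMn -rmorphXn /= mulrA coefMXn.
    case: ltnP => // rk; rewrite coefMC.
    rewrite (_ : (polar M (Q t))`_(k - r.+1) = 0) ?mul0r //.
    apply/polyP => j; rewrite /Q polar_frame_sum // subnK // ltnNge sk /=.
    by rewrite if_same coef0.
  rewrite ellX //; case: (leqP k d) => kd; last first.
    rewrite (_ : (polar M (Q t))`_(k - r.+1) = 0) ?scaler0 ?mulr0 //.
    apply/polyP => j; rewrite /Q polar_frame_sum // coef0 ifN //.
    by rewrite negb_and -!ltnNge; apply/orP; right; lia.
  congr (_ * _); apply/polyP => j; rewrite coefZ /Q polar_frame_sum //.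
  have [/(_ t) sq _] := hq k ltac:(by rewrite sk kd).
  have rk : (r < k)%N by apply: leq_ltn_trans sk.
  rewrite subnK // sk leq_sub2r // andbT; case: leqP => jk.
    by rewrite mulrA mulfV ?mul1r // expf_neq0.
  rewrite mulr0 nth_default //; apply: leq_trans sq _; lia.
have homQ t : t \in E -> Q t * ell t ^+ r.+1 \is ishomog1 d mdeg.
  move=> tE; have [u [_ _ [hell _] _ _]] := hE t tE.
  have := dhomogM (frame_sum_homog M (d - r.+1) _) (dhomogMn r.+1 hell).
  by rewrite mul1n subnK //; [apply | lia].
exists (fun t => Q t * ell t ^+ r.+1); split=> [t tE|].
  split; first by apply/ideal_genM/ideal_gen_mem.
  apply: (homog_ideal_pow uM M2 (homQ t tE)) => k ks.
  by rewrite QE // ltnNge -ltnS ks.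
apply: (homog_polar_inj uM (frame_sum_homog M d _)).
  by rewrite big_seq; apply: rpred_sum => t tE; apply: homQ.
move=> k kd; rewrite -/(Phi f) polPhi // rmorph_sum coef_sum big_seq.
under eq_bigr => t tE do rewrite QE //.
have := Af k; case: ifP => skd; last by rewrite big1.
have [_ fk] := hq k skd; by rewrite fk big_seq.
Qed.

(** * Closed formulas for the counts *)

Lemma binz_sub (m n k : nat) : (0 < k)%N -> binz (m%:Z - n%:Z) k = 'C(m - n, k)%:R.
Proof.
move=> k0; case: (leqP n m) => nm; first by rewrite subzn.
rewrite (_ : (m - n)%N = 0%N); last by lia.
rewrite bin0n eqn0Ngt k0 /=.
have -> : m%:Z - n%:Z = Negz (n - m).-1 by rewrite NegzE; lia.
by [].
Qed.

(** The inequality k + 1 <= t (k - r) holds exactly from k = Omega on, so the minimum switches there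
    from t (k - r) to k + 1. The formula then follows by induction on d - s. *)
Lemma Jbar_dim_sum (t r s d : nat) : (1 < t)%N -> (r <= s)%N -> (s <= d)%N ->
  (\sum_(s.+1 <= k < d.+1) minn k.+1 (t * (k - r)))%:R = Jbar_dim t r s d :> rat.
Proof.
move=> t1 rs sd.
have OmE k : (Omega t r <= k)%N = (t * r < k * (t - 1))%N.
  by rewrite /Omega addn1 ltn_divLR //; lia.
have minE k : (r <= k)%N -> minn k.+1 (t * (k - r)) =
    if (Omega t r <= k)%N then k.+1 else (t * (k - r))%N.
  move=> rk; rewrite OmE; case: ltnP => h.
    apply/minn_idPl; move: h; rewrite mulnBr; nia.
  apply/minn_idPr; move: h; rewrite mulnBr; nia.
rewrite -(subnKC sd); move: (d - s)%N => {sd} i.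
rewrite /Jbar_dim; case: ltnP => hO.
  have binE a c : binz (a%:Z + 2 - c%:Z) 2 = 'C(a + 2 - c, 2)%:R.
    by rewrite -(binz_sub _ _ (k := 2)) // PoszD.
  have binE1 a c : binz (a%:Z + 1 - c%:Z) 2 = 'C(a + 1 - c, 2)%:R.
    by rewrite -(binz_sub _ _ (k := 2)) // PoszD.
  rewrite binE binE1.
  elim: i => [|i IH].
    rewrite addn0 big_geq // !bin_small ?mulr0 ?subr0; try lia.
    by rewrite subrr mulr0 mul0r.
  rewrite addnS big_nat_recr /=; last by lia.
  rewrite natrD IH minE; last by lia.
  have aE : (coef_a t r)%:~R = t%:R * (r%:R + 1) + (1 - t%:R) * (Omega t r)%:R :> rat.
    by rewrite /coef_a !(rmorphD, rmorphM, rmorphN) /=.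
  have bE : (coef_b t r)%:~R = t%:R - (coef_a t r)%:~R - 1 :> rat.
    by rewrite /coef_b !(rmorphD, rmorphM, rmorphN) /=.
  (* From [Omega] on, the growth of the two weighted binomials corrects the increment t (k - r) to k
     + 1; before [Omega] all the binomials vanish. *)
  case: leqP => hk.
    rewrite (_ : ((s + i).+1 + 2 - Omega t r = (s + i + 2 - Omega t r).+1)%N); last by lia.
    rewrite (_ : ((s + i).+1 + 1 - Omega t r = (s + i + 1 - Omega t r).+1)%N); last by lia.
    rewrite !binS !bin1 !natrD bE aE !natrB; try lia.
    rewrite !natrD -[in (s + i).+2]addn2 -[in (s + i).+1]addn1 !natrD; by field.
  have C0 x : (x <= 1)%N -> 'C(x, 2%N) = 0%N by move=> x1; rewrite bin_small.
  rewrite (C0 ((s + i).+1 + 2 - Omega t r)%N); last by lia.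
  rewrite (C0 ((s + i).+1 + 1 - Omega t r)%N); last by lia.
  rewrite (C0 (s + i + 2 - Omega t r)%N); last by lia.
  rewrite (C0 (s + i + 1 - Omega t r)%N); last by lia.
  rewrite natrM natrB; last by lia.
  rewrite -[in (s + i).+1]addn1 !natrD; by field.
elim: i => [|i IH]; first by rewrite addn0 big_geq // subrr.
rewrite addnS big_nat_recr /=; last by lia.
rewrite natrD IH minE; last by lia.
rewrite ifT; last by lia.
rewrite (_ : ((s + i).+1 + 2 = (s + i + 2).+1)%N); last by lia.
by rewrite binS bin1 natrD addn2; ring.
Qed.

(** The exponents of X and Y in an admissible jump. The parameters 0, 0 and d + 1 leave only the
    bound i + j <= d, so the same type also enumerates all ternary monomials of degree d. *)
Definition edge_index (r s d : nat) : finType :=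
  {ab : 'I_(d - s) * 'I_(d - s) | (ab.1 + ab.2 < d - r)%N}.

Lemma sum_truncated (n e : nat) : (\sum_(a < n) (a - e) = 'C(n - e, 2))%N.
Proof.
elim: n => [|n IH]; first by rewrite big_ord0.
rewrite big_ord_recr /= IH; case: (leqP e n) => en.
  by rewrite subSn // binS bin1.
by rewrite !bin_small; lia.
Qed.

(** For a first exponent [a] there are d - s choices of the second one, less the excess of [a] over
    s - r. These excesses add up to the binomial coefficient. *)
Lemma card_edge_index (r s d : nat) : (r <= s)%N -> (s <= d)%N ->
  #|edge_index r s d|%:R =
  (d%:R - s%:R) ^+ 2 - binz (d%:Z - 2 * s%:Z + r%:Z) 2 :> rat.
Proof.
move=> rs sd.
have -> : d%:Z - 2 * s%:Z + r%:Z = (d + r)%:Z - (2 * s)%:Z by lia.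
rewrite binz_sub // -natrB //.
suff /(congr1 (fun n => n%:R : rat)) : (#|edge_index r s d| + 'C(d + r - 2 * s, 2) = (d - s) ^ 2)%N.
  by rewrite natrD natrX => <-; rewrite addrK.
have -> : #|edge_index r s d| = (\sum_(a < d - s) minn (d - s) (d - r - a))%N.
  rewrite card_sig -sum1_card.
  rewrite (eq_bigl (fun ab : 'I_(d - s) * 'I_(d - s) => (ab.1 + ab.2 < d - r)%N)) //.
  rewrite -(pair_big_dep predT (fun a b : 'I_(d - s) => (a + b < d - r)%N) (fun _ _ => 1%N)) /=.
  apply: eq_bigr => a _; rewrite sum1_card.
  rewrite -[RHS]card_ord.
  pose f (i : 'I_(minn (d - s) (d - r - a))) : 'I_(d - s) :=
    widen_ord (geq_minl (d - s) (d - r - a)) i.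
  have inj_f : injective f by move=> i j /(congr1 val) /= /val_inj.
  rewrite -(fintype.card_image inj_f); apply: eq_card => b; apply/idP/fintype.imageP.
    rewrite unfold_in /= => ab; have bi : (b < minn (d - s) (d - r - a))%N.
      by rewrite leq_min ltn_ord /=; lia.
    by exists (Ordinal bi) => //; apply: val_inj.
  case=> i _ ->; rewrite unfold_in /=; have := ltn_ord i; rewrite leq_min => /andP[_].
  by rewrite ltn_subRL.
have -> : (d + r - 2 * s = (d - s) - (s - r))%N by lia.
rewrite -sum_truncated -big_split /= (eq_bigr (fun=> (d - s)%N)).
  by rewrite sum_nat_const card_ord; lia.
by move=> a _; have := ltn_ord a; lia.
Qed.

Lemma card_edge_index0 d : #|edge_index 0 0 d.+1|%:R = 'C(d + 2, 2)%:R :> rat.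
Proof.
rewrite card_edge_index // (_ : _ - _ + _ = d.+1%:Z - 0%:Z :> int); last by lia.
rewrite binz_sub // subn0 subr0 addn2; elim: d => // d IH.
rewrite (binS d.+2) (binS d.+1) !bin1 !natrD.
move: IH; rewrite (binS d.+1) bin1 !natrD -!natr1; lra.
Qed.

(** * Order of vanishing *)

Section VanishingOrder.
Context {R : realType} {n : nat}.
Implicit Types (p q : {mpoly R[n]}) (x : 'rV[R]_n).

(** The recursion on first derivatives lets the product rule be iterated without multi-indices. *)
Fixpoint vanishes (k : nat) p x : Prop :=
  if k is k'.+1 then peval p x = 0 /\ forall i, vanishes k' (mderiv i p) x else True.

Lemma vanishesW k p x : vanishes k.+1 p x -> vanishes k p x.
Proof.
elim: k p => //= k IH p [p0 dp]; split=> // i; apply: IH; exact: dp.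
Qed.

Lemma vanishes_leq j k p x : (j <= k)%N -> vanishes k p x -> vanishes j p x.
Proof.
move=> /subnKC <-; elim: (k - j)%N => [|i IH]; first by rewrite addn0.
by rewrite addnS => /vanishesW.
Qed.

Lemma pevalD p q x : peval (p + q) x = peval p x + peval q x.
Proof. exact: mevalD. Qed.

Lemma pevalM p q x : peval (p * q) x = peval p x * peval q x.
Proof. exact: mevalM. Qed.

Lemma pevalZ c p x : peval (c *: p) x = c * peval p x.
Proof. exact: mevalZ. Qed.

Lemma pevalB p q x : peval (p - q) x = peval p x - peval q x.
Proof. exact: mevalB. Qed.

Lemma vanishesD k p q x : vanishes k p x -> vanishes k q x -> vanishes k (p + q) x.
Proof.
elim: k p q => //= k IH p q [p0 dp] [q0 dq].
by split=> [|i]; rewrite ?pevalD ?p0 ?q0 ?addr0 // mderivD; apply: IH.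
Qed.

Lemma vanishesM k p q x : vanishes k p x -> vanishes k (q * p) x.
Proof.
elim: k p q => //= k IH p q [p0 dp]; split=> [|i]; first by rewrite pevalM p0 mulr0.
rewrite mderivM; apply: vanishesD; apply: IH => //.
by apply: vanishesW; split.
Qed.

(** In the product rule one term keeps the factor [p], the other keeps [q] and is covered by
    induction. *)
Lemma vanishesS k p q x : peval q x = 0 -> vanishes k p x -> vanishes k.+1 (q * p) x.
Proof.
move=> q0; elim: k p => [|k IH] p.
  by move=> _; split=> //; rewrite pevalM q0 mul0r.
move=> hp; split=> [|i]; first by rewrite pevalM q0 mul0r.
rewrite mderivM; apply: vanishesD; first exact: vanishesM.
exact: (IH _ (hp.2 i)).
Qed.

Lemma vanishes_exp k p q x j : peval q x = 0 -> vanishes k p x ->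
  vanishes (j + k) (q ^+ j * p) x.
Proof.
move=> q0 hp; elim: j => [|j IH]; first by rewrite expr0 mul1r.
by rewrite exprS -mulrA addSn; apply: vanishesS.
Qed.

Lemma vanishes_mderivm k p x m : vanishes k p x -> (mdeg m < k)%N ->
  peval (mderivm m p) x = 0.
Proof.
elim: k p m => // k IH p m [p0 dp] mk.
have [m0|m0] := posnP (mdeg m).
  by move/eqP: m0; rewrite mdeg_eq0 => /eqP ->; rewrite mderivm0m.
have [i mi] : exists i, (0 < m i)%N.
  apply/existsP; apply: contraTT m0 => /existsPn m0.
  by rewrite -leqNgt mdegE big1 // => i _; apply/eqP; rewrite -leqn0 leqNgt; exact: m0.
have Um : mpoly.lem (mnm1 i) m by rewrite lep1mP -lt0n.
have e := submK Um; rewrite -e addmC mderivmDm.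
rewrite mderivmU1m; apply: IH; first exact: dp.
by move: mk; rewrite -{1}e mdegD mdeg1 addn1.
Qed.

End VanishingOrder.

(** * Restriction of forms to the plane z = 1 *)

Section Dehomogenization.
Context {R : realType}.
Implicit Types (F : {mpoly R[3]}) (x : 'rV[R]_2).

Definition dehom_var (i : 'I_3) : {mpoly R[2]} :=
  nth 0 [:: mpolyX R (mnm1 0); mpolyX R (mnm1 1); 1] i.

Definition dehom : {mpoly R[3]} -> {mpoly R[2]} := mmap (@mpolyC 2 R) dehom_var.

HB.instance Definition _ := GRing.RMorphism.on dehom.

Lemma dehomZ c F : dehom (c *: F) = c *: dehom F.
Proof. by rewrite /dehom mmapZ mul_mpolyC. Qed.

Lemma peval_dehom F x : peval (dehom F) x = peval F (embed x).
Proof.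
rewrite /peval /dehom /mmap raddf_sum /= /meval /mmap; apply: eq_bigr => m _.
rewrite [LHS]mevalM mevalC; congr (_ * _); rewrite /mmap1 rmorph_prod.
apply: eq_bigr => i _; rewrite rmorphXn /=; congr (_ ^+ _).
have [e0 e1 e2] := embedE x.
case: i => -[|[|[|//]]] i3; rewrite /dehom_var /= ?mevalXU ?meval1.
- by rewrite -e0; congr (embed x 0 _); apply: val_inj.
- by rewrite -e1; congr (embed x 0 _); apply: val_inj.
- by rewrite -e2; congr (embed x 0 _); apply: val_inj.
Qed.

Lemma msize_dehom F d : F \is ishomog1 d mdeg -> (mmeasure mdeg (dehom F) <= d.+1)%N.
Proof.
move=> /dhomogP hF; rewrite /dehom /mmap.
apply: leq_trans (mmeasure_sum _ _ _ _) _; apply/bigmax_leqP_seq => m mF _.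
rewrite mul_mpolyC; apply: leq_trans (mmeasureZ_le _ _ _) _.
rewrite /mmap1 !big_ord_recl big_ord0 mulr1.
rewrite (_ : dehom_var ord0 = mpolyX R (mnm1 0)) //.
rewrite (_ : dehom_var (lift ord0 ord0) = mpolyX R (mnm1 1)) //.
rewrite (_ : dehom_var (lift ord0 (lift ord0 ord0)) = 1) //.
rewrite expr1n mulr1 !mpolyXn -mpolyXD mmeasureX ltnS /= mdegD !mdegMn !mdeg1.
rewrite -(hF _ mF) /= mdegE !big_ord_recl big_ord0; lia.
Qed.

End Dehomogenization.

(** * Frames adapted to an edge *)

Section EdgeMonomials.
Context {R : realType}.
Implicit Types (v w : 'rV[R]_2) (M : 'M[R]_3) (F : {mpoly R[3]}).

Lemma peval_coord M i j : M \in unitmx -> peval (coord M j) (row i M) = (i == j)%:R.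
Proof.
move=> uM; rewrite /coord peval_linear_form -row_mul colE mulmxA mulmxV // mul1mx.
by rewrite !mxE eqxx andbT.
Qed.

(** The two vertices are completed by the coefficient vector U of the form. It is orthogonal to
    both, so the third coordinate form is [F] divided by the squared norm of U. *)
Lemma edge_frame v w F : F \is ishomog1 1 mdeg -> F != 0 -> v != w ->
  peval F (embed v) = 0 -> peval F (embed w) = 0 ->
  exists M (c : R), [/\ M \in unitmx, row 0 M = embed v, row 1 M = embed w, c != 0
    & coord M 2 = c *: F].
Proof.
move=> /homog1E ->; move: (\col_i _) => U F0 vw; rewrite !peval_linear_form => Fv Fw.
pose M : 'M[R]_3 := \matrix_(i < 3) nth 0 [:: embed v; embed w; U^T] i.
have M0 : row 0 M = embed v by rewrite rowK.
have M1 : row 1 M = embed w by rewrite rowK.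
have M2 : row 2 M = U^T by rewrite rowK.
have U0 : U != 0.
  by apply: contraNneq F0 => ->; rewrite /linear_form big1 // => i _; rewrite mxE scale0r.
have nU : (U^T *m U) 0 0 != 0.
  rewrite mxE; apply: contraNneq U0 => e; apply/eqP/matrixP => i j; rewrite ord1 mxE.
  have : \sum_i U i 0 ^+ 2 = 0.
    by rewrite -[RHS]e; apply: eq_bigr => k _; rewrite mxE expr2.
  move/eqP; rewrite psumr_eq0 => [/allP/(_ i)|k _]; last exact: sqr_ge0.
  by rewrite mem_index_enum sqrf_eq0 => /(_ isT)/eqP.
have MU i : (M *m U) i 0 = (i == 2)%:R * (U^T *m U) 0 0.
  have -> : (M *m U) i 0 = (row i M *m U) 0 0 by rewrite -row_mul [RHS]mxE.
  by case: i => -[|[|[|//]]] i3; rewrite rowK /= ?Fv ?Fw ?mul0r ?mul1r.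
have uM : M \in unitmx.
  rewrite -row_free_unit -kermx_eq0; apply/eqP/row_matrixP => i; rewrite row0.
  have : row i (kermx M) *m M = 0 by apply/sub_kermxP/row_sub.
  move: (row i _) => y yM.
  have y2 : y 0 2 = 0.
    have : (y *m M *m U) 0 0 = 0 by rewrite yM mul0mx mxE.
    rewrite -mulmxA mxE (bigD1 2) //= big1 ?addr0 => [|k k2]; last first.
      by rewrite MU (negbTE k2) mul0r mulr0.
    by rewrite MU eqxx mul1r => /eqP; rewrite mulf_eq0 (negbTE nU) orbF => /eqP.
  have yE : y 0 0 *: embed v + y 0 1 *: embed w = 0.
    move: yM; rewrite mulmx_sum_row !big_ord_recl big_ord0.
    rewrite (_ : lift ord0 ord0 = 1); last exact: val_inj.
    rewrite (_ : lift ord0 (lift ord0 ord0) = 2); last exact: val_inj.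
    by rewrite M0 M1 y2 scale0r !addr0.
  have [v0 v1 v2] := embedE v; have [w0 w1 w2] := embedE w.
  have E j : y 0 0 * embed v 0 j + y 0 1 * embed w 0 j = 0.
    by have /rowP/(_ j) := yE; rewrite !mxE.
  have := E 0; have := E 1; have := E 2; rewrite v0 v1 v2 w0 w1 w2 !mulr1 => e2 e1 e0.
  have y1 : y 0 1 = 0.
    apply: contraNeq vw => y1; apply/eqP.
    have y0 : y 0 0 = - y 0 1 by move: e2; lra.
    by apply: rV2P; apply: (mulfI y1); [move: e0|move: e1]; rewrite y0; lra.
  have y0 : y 0 0 = 0 by move: e2; rewrite y1; lra.
  apply/rowP => -[[|[|[|//]]] k]; rewrite mxE.
  - by rewrite -y0; congr (y 0 _); apply: val_inj.
  - by rewrite -y1; congr (y 0 _); apply: val_inj.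
  - by rewrite -y2; congr (y 0 _); apply: val_inj.
exists M, ((U^T *m U) 0 0)^-1; split=> //; first by rewrite invr_eq0.
rewrite /coord /linear_form scaler_sumr; apply: eq_bigr => i _.
rewrite scalerA; congr (_ *: _); rewrite colE.
have -> : delta_mx 2 0 = ((U^T *m U) 0 0)^-1 *: (M *m U) :> 'cV[R]_3.
  apply/colP => k; rewrite [LHS]mxE [RHS]mxE MU eqxx andbT.
  by case: eqP => _; rewrite ?mul1r ?mulVf // mul0r mulr0.
by rewrite -scalemxAr mulKmx // mxE.
Qed.

Lemma frame_monomial_free M d (I : finType) (k j : I -> nat) (c : I -> R) :
  M \in unitmx -> (forall i, (j i <= k i <= d)%N) ->
  (forall i i', k i = k i' -> j i = j i' -> i = i') ->
  \sum_i c i *: frame_monomial M d (k i) (j i) = 0 -> forall i, c i = 0.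
Proof.
move=> uM jkd inj c0 i.
have /(congr1 (fun F => (polar M F)`_(k i)`_(j i))) := c0.
rewrite rmorph0 !coef0 rmorph_sum !coef_sum (bigD1 i) //=.
have e i' : (polar M (c i' *: frame_monomial M d (k i') (j i')))`_(k i)`_(j i) =
    c i' * ((k i == k i') && (j i == j i'))%:R.
  have /andP[jk _] := jkd i'.
  rewrite polarZ polar_frame_monomial // coefCM coefCM coefCM coefXn.
  by case: (k i == k i') => /=; rewrite ?coefXn ?mulr1 ?coef1 ?mulr0 ?coef0 ?mulr0 // coefXn.
rewrite e !eqxx mulr1 big1 ?addr0 // => i' ii'.
rewrite e; case: eqP => [ek|]; rewrite ?mulr0 //.
case: eqP => [ej|]; rewrite ?mulr0 //=.
by case/eqP: ii'; apply: inj.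
Qed.

End EdgeMonomials.

(** * Simplices in the plane *)

Section PlaneGeometry.
Context {R : realType}.
Implicit Types (u v w x y z : 'rV[R]_2) (sigma tau : {fset 'rV[R]_2}).

(** The signed area of a parallelogram; its sign decides sides of edges and orientations
    throughout. *)
Definition cross (p q : 'rV[R]_2) : R := p 0 0 * q 0 1 - p 0 1 * q 0 0.

Lemma crossC p q : cross q p = - cross p q.
Proof. by rewrite /cross; ring. Qed.

Lemma cross_combination (p q : 'rV[R]_2) (x : 'rV[R]_2) : cross p q != 0 ->
  x = (cross x q / cross p q) *: p + (cross p x / cross p q) *: q.
Proof.
by move=> pq; apply: rV2P; rewrite !mxE; move: pq; rewrite /cross => pq; field.
Qed.

Lemma big_fset2 (T : choiceType) (V : nmodType) (a b : T) (F : T -> V) :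
  a != b -> \sum_(u <- [fset a; b]) F u = F a + F b.
Proof.
move=> ab; rewrite (perm_big [:: a; b]) /=; first by rewrite !big_cons big_nil addr0.
apply: uniq_perm; rewrite ?fset_uniq //= ?inE ?ab //.
by move=> u; rewrite !inE.
Qed.

Lemma big_fset3 (T : choiceType) (V : nmodType) (a b c : T) (F : T -> V) :
  a != b -> a != c -> b != c -> \sum_(u <- [fset a; b; c]) F u = F a + F b + F c.
Proof.
move=> ab ac bc; rewrite (perm_big [:: a; b; c]) /=.
  by rewrite !big_cons big_nil addr0 addrA.
apply: uniq_perm; rewrite ?fset_uniq //= ?inE ?negb_or ?ab ?ac ?bc //.
by move=> u; rewrite !inE orbA.
Qed.

Lemma cardfs3P (T : choiceType) (s : {fset T}) (a b : T) :
  #|` s| = 3%N -> a \in s -> b \in s -> a != b ->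
  exists c, [/\ c != a, c != b & s = [fset a; b; c]].
Proof.
move=> s3 sa sb ab.
have : #|` s `\ a `\ b| = 1%N.
  have := cardfsD1 a s; have := cardfsD1 b (s `\ a).
  by rewrite s3 sa !inE sb eq_sym ab /= => -> [].
move=> /eqP/cardfs1P[c sc]; exists c.
have : c \in s `\ a `\ b by rewrite sc inE.
rewrite !inE => /and3P[cb ca cs]; split=> //.
apply/fsetP => u; rewrite !inE.
have := congr1 (fun X : {fset T} => u \in X) sc; rewrite !inE.
by case: eqP => [->|_]; case: eqP => [->|_] /=; rewrite ?sa ?sb.
Qed.

(** Grouping equal points of a convex combination leaves one barycentric coordinate per vertex. *)
Lemma realizationP sigma x : realization sigma x <->
  exists w : 'rV[R]_2 -> R, [/\ forall v, v \in sigma -> 0 <= w v,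
    \sum_(v <- sigma) w v = 1 & x = \sum_(v <- sigma) w v *: v].
Proof.
split=> [[n [w [a [w0 w1 sa ->]]]]|[w [w0 w1 ->]]].
  have group (V : nmodType) (F : 'I_n -> V) :
      \sum_i F i = \sum_(v <- sigma) \sum_(i | a i == v) F i.
    rewrite (exchange_big_dep predT) //=; apply: eq_bigr => i _.
    have ai : a i \in (sigma : seq _) by exact: (sa i).
    rewrite -big_filter (_ : seq.filter _ _ = [:: a i]) ?big_seq1 //.
    by rewrite (eq_filter (a2 := pred1 (a i))) ?filter_pred1_uniq ?fset_uniq // => v /=; rewrite eq_sym.
  exists (fun v => \sum_(i | a i == v) w i); split.
  - by move=> v _; apply: sumr_ge0.
  - by rewrite -group.
  - rewrite group; apply: eq_bigr => v _; rewrite scaler_suml.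
    by apply: eq_bigr => i /eqP ->.
exists (size sigma), (fun i => w (nth 0 sigma i)), (fun i => nth 0 sigma i).
have mem (i : 'I_(size sigma)) : nth 0 sigma i \in sigma by rewrite mem_nth.
split.
- by move=> i; apply/w0/mem.
- by rewrite -w1 (big_nth 0) big_mkord.
- by move=> i; exact: mem.
- by rewrite (big_nth 0) big_mkord.
Qed.

Lemma affine_coord_inj sigma (a b : 'rV[R]_2 -> R) : affinely_independent sigma ->
  \sum_(v <- sigma) a v = \sum_(v <- sigma) b v ->
  \sum_(v <- sigma) a v *: v = \sum_(v <- sigma) b v *: v ->
  forall v, v \in sigma -> a v = b v.
Proof.
move=> ind e1 e2 v vs; apply/eqP; rewrite -subr_eq0; apply/eqP.
apply: (ind (fun v => a v - b v)) => //; first by rewrite sumrB e1 subrr.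
under eq_bigr => u _ do rewrite scalerBl.
by rewrite sumrB e2 subrr.
Qed.

Lemma realization2P v w x : v != w -> realization [fset v; w] x <->
  exists t, [/\ 0 <= t, t <= 1 & x = v + t *: (w - v)].
Proof.
move=> vw; split=> [/realizationP[a [a0]]|[t [t0 t1 ->]]].
  rewrite !big_fset2 // => a1 ->; exists (a w).
  have aw : 0 <= a w by apply: a0; rewrite !inE eqxx orbT.
  have av : 0 <= a v by apply: a0; rewrite !inE eqxx.
  split=> //; first by lra.
  have -> : a v = 1 - a w by lra.
  by rewrite scalerBl scale1r scalerBr -!addrA; congr (_ + _); rewrite addrC.
apply/realizationP; exists (fun u => if u == v then 1 - t else t).
rewrite !big_fset2 // eqxx eq_sym (negbTE vw); split=> [u _|| ].
- by case: ifP; lra.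
- by lra.
- by rewrite scalerBl scale1r scalerBr -!addrA; congr (_ + _); rewrite addrC.
Qed.

Lemma realization3P v w z x : v != w -> v != z -> w != z ->
  realization [fset v; w; z] x <->
  exists a b, [/\ 0 <= a, 0 <= b, a + b <= 1 & x = v + a *: (w - v) + b *: (z - v)].
Proof.
move=> vw vz wz.
have eqx (c : R) a b : c = 1 - a - b ->
    c *: v + a *: w + b *: z = v + a *: (w - v) + b *: (z - v).
  by move=> ->; apply: rV2P; rewrite !mxE; ring.
split=> [/realizationP[a [a0]]|[a [b [a0 b0 ab ->]]]].
  rewrite !big_fset3 // => a1 ->; exists (a w), (a z).
  have aw : 0 <= a w by apply: a0; rewrite !inE eqxx ?orbT.
  have av : 0 <= a v by apply: a0; rewrite !inE eqxx ?orbT.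
  have az : 0 <= a z by apply: a0; rewrite !inE eqxx ?orbT.
  by split=> //; [lra | apply: eqx; lra].
apply/realizationP; exists (fun u => if u == v then 1 - a - b else if u == w then a else b).
rewrite !big_fset3 // !eqxx [w == v]eq_sym [z == v]eq_sym [z == w]eq_sym.
rewrite (negbTE vw) (negbTE vz) (negbTE wz); split=> [u _|| ].
- by case: ifP => _; last case: ifP => _ //; lra.
- by lra.
- by rewrite -(eqx (1 - a - b)) //.
Qed.

Lemma affine_cross v w z : v != w -> v != z -> w != z ->
  affinely_independent [fset v; w; z] -> cross (w - v) (z - v) != 0.
Proof.
move=> vw vz wz ind; apply/eqP => D0.
suff [c [d [c0 cd]]] : exists c d : R, ~ (c = 0 /\ d = 0) /\ c *: (w - v) + d *: (z - v) = 0.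
  apply: c0; pose f u := if u == v then - c - d else if u == w then c else d.
  have fw : f w = c by rewrite /f eq_sym (negbTE vw) eqxx.
  have fz : f z = d by rewrite /f eq_sym (negbTE vz) eq_sym (negbTE wz).
  have fv : f v = - c - d by rewrite /f eqxx.
  have f0 := ind f; rewrite !big_fset3 // fw fz fv in f0.
  have {}f0 : forall u, u \in [fset v; w; z] -> f u = 0.
    apply: f0; first by lra.
    rewrite -[RHS]cd; apply: rV2P; rewrite !mxE; ring.
  by split; [rewrite -fw|rewrite -fz]; apply: f0; rewrite !inE eqxx ?orbT.
have [e0|ne0] := eqVneq ((z - v) 0 0) 0; last first.
  exists ((z - v) 0 0), (- (w - v) 0 0); split; first by case=> /eqP; rewrite (negbTE ne0).
  move: D0; rewrite /cross !mxE => D0.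
  by apply: rV2P; rewrite !mxE; move: D0; lra.
have [e1|ne1] := eqVneq ((z - v) 0 1) 0; last first.
  exists ((z - v) 0 1), (- (w - v) 0 1); split; first by case=> /eqP; rewrite (negbTE ne1).
  move: D0; rewrite /cross !mxE => D0.
  by apply: rV2P; rewrite !mxE; move: D0; lra.
exfalso; move/eqP: vz; apply.
by apply: rV2P; [move: e0|move: e1]; rewrite !mxE; lra.
Qed.

Lemma affinely_independent_subset sigma tau : tau `<=` sigma ->
  affinely_independent sigma -> affinely_independent tau.
Proof.
move=> ts ind c c0 c1 v vt.
have ext (V : nmodType) (F : 'rV[R]_2 -> V) : (forall u, u \notin tau -> F u = 0) ->
    \sum_(u <- sigma) F u = \sum_(u <- tau) F u.
  move=> F0; apply: esym; apply: big_fset_incl => // u _; exact: F0.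
have := ind (fun u => if u \in tau then c u else 0).
rewrite !ext; last 2 first.
- by move=> u /negbTE ->; rewrite scale0r.
- by move=> u /negbTE ->.
have e (V : nmodType) (F G : 'rV[R]_2 -> V) : (forall u, u \in tau -> F u = G u) ->
    \sum_(u <- tau) F u = \sum_(u <- tau) G u.
  by move=> FG; rewrite big_seq [RHS]big_seq; apply: eq_bigr.
rewrite (e _ _ c) => [|u ->] //.
rewrite (e _ _ (fun u => c u *: u)) => [|u ->] // /(_ c0 c1) h.
by have := h v (fsubsetP ts _ vt); rewrite vt.
Qed.

(** Three affinely independent points already determine the plane, so a fourth one satisfies a
    relation with them. Triangles are thus the largest faces. *)
Lemma affine_card sigma : affinely_independent sigma -> (#|` sigma| <= 3)%N.
Proof.
move=> ind; rewrite leqNgt; apply/negP => c4.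
have [s4 [s4s s4c]] : exists s4 : {fset 'rV[R]_2}, s4 `<=` sigma /\ #|` s4| = 4%N.
  exists [fset x in take 4 sigma]; split.
    by apply/fsubsetP => x; rewrite inE => /mem_take.
  by rewrite card_fseq undup_id ?take_uniq ?fset_uniq // size_takel.
have {s4s}ind := affinely_independent_subset s4s ind.
have [v vs] : exists v, v \in s4 by apply/fset0Pn; rewrite -cardfs_gt0 s4c.
have c3 : #|` s4 `\ v| = 3%N by have := cardfsD1 v s4; rewrite vs s4c => -[].
have [a as3] : exists a, a \in s4 `\ v by apply/fset0Pn; rewrite -cardfs_gt0 c3.
have c2 : #|` s4 `\ v `\ a| = 2%N by have := cardfsD1 a (s4 `\ v); rewrite as3 c3 => -[].
have [b bs2] : exists b, b \in s4 `\ v `\ a by apply/fset0Pn; rewrite -cardfs_gt0 c2.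
have [bs3 ba] : b \in s4 `\ v /\ b != a by move: bs2; rewrite !inE => /and3P[-> -> ->].
have ab : a != b by rewrite eq_sym.
have [c [ca cb s3E]] := cardfs3P c3 as3 bs3 ab.
have cs3 : c \in s4 `\ v by rewrite s3E !inE eqxx !orbT.
have ac : a != c by rewrite eq_sym.
have bc : b != c by rewrite eq_sym.
have ind3 : affinely_independent [fset a; b; c].
  by rewrite -s3E; apply: affinely_independent_subset ind; apply: fsubD1set.
have D0 := affine_cross ab ac bc ind3.
have vE := cross_combination (v - a) D0.
move: (_ / _) (cross (b - a) (v - a) / _) vE => al be vE.
have s4E (V : nmodType) (F : 'rV[R]_2 -> V) :
    \sum_(u <- s4) F u = F v + (F a + F b + F c).
  by rewrite (big_fsetD1 v) //= s3E big_fset3.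
(* The coefficients of v + (al + be - 1) a - al b - be c = 0, whose sum is 0. *)
pose f u := if u == v then 1 else if u == a then al + be - 1 else if u == b then - al else - be.
have nv u : u \in s4 `\ v -> (u == v) = false by rewrite !inE => /andP[/negbTE].
have := ind f; rewrite !s4E /f !eqxx !nv // (negbTE ba) (negbTE ca) (negbTE cb).
move=> h; have : 1 = 0 :> R.
  have := h _ _ v vs; rewrite eqxx; apply; first by lra.
  have -> : v = a + (al *: (b - a) + be *: (c - a)) by rewrite -vE addrCA subrr addr0.
  by apply: rV2P; rewrite !mxE; ring.
by apply/eqP; rewrite oner_eq0.
Qed.

End PlaneGeometry.

Section Neighborhoods.
Context {R : realType}.
Implicit Types (u v w x y z : 'rV[R]_2) (a b c : R).

Lemma affine_continuous a b c : continuous (fun y : 'rV[R]_2 => a * y 0 0 + b * y 0 1 + c).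
Proof.
move=> x.
have h i : (fun y : 'rV[R]_2 => y 0 i) @ x --> x 0 i by exact: coord_continuous.
exact: (cvgD (cvgD (cvgM (cvg_cst _) (h 0)) (cvgM (cvg_cst _) (h 1))) (cvg_cst _)).
Qed.

Lemma near_affine_gt0 (f : 'rV[R]_2 -> R) a b c x :
  (forall y, f y = a * y 0 0 + b * y 0 1 + c) -> 0 < f x ->
  nbhs x (fun y => 0 < f y).
Proof.
move=> /funext ->; exact: (cvgr_gt _ (@affine_continuous a b c x)).
Qed.

Lemma near_cross_gt0 p v x : 0 < cross p (x - v) ->
  nbhs x (fun y => 0 < cross p (y - v)).
Proof.
apply: (@near_affine_gt0 (fun y => cross p (y - v)) (- p 0 1) (p 0 0)
  (p 0 1 * v 0 0 - p 0 0 * v 0 1)) => y.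
by rewrite /cross !mxE; ring.
Qed.

Lemma near_all_seq (T : Type) (I : eqType) (s : seq I) (F : set_system T) {FF : Filter F}
    (P : I -> T -> Prop) : (forall i, i \in s -> F (P i)) ->
  F (fun t : T => forall i, i \in s -> P i t).
Proof.
elim: s => [|i s IH] h; first by apply: filterE => t i.
have h1 := h i (mem_head _ _).
have h2 := IH (fun j js => h j (mem_behead (s := i :: s) js)).
apply: filterS2 h1 h2 => t h1 h2 j; rewrite inE => /predU1P[->//|]; exact: h2.
Qed.

Lemma near_shift v (P : 'rV[R]_2 -> Prop) : nbhs v P ->
  forall p, \forall h \near 0^'+, P (v + h *: p).
Proof.
move=> hP p; have h : (fun h : R => v + h *: p) @ 0^'+ --> v + (0 : R) *: p.
  apply: cvg_at_right_filter.
  have h0 : (fun h : R => h *: p) @ (0 : R) --> (0 : R) *: p.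
    by apply: cvgZr_tmp; exact: cvg_id.
  exact: (cvgD (cvg_cst _) h0).
by rewrite scale0r addr0 in h; exact: (h _ hP).
Qed.

Lemma near0_right_lt (c : R) : 0 < c -> \forall h \near 0^'+, 0 < h < c.
Proof.
move=> c0; near=> h; apply/andP; split; near: h.
  exact: nbhs_right_gt.
exact: nbhs_right_lt.
Unshelve. all: by end_near.
Qed.

End Neighborhoods.

Lemma cardfs2_mem (T : choiceType) (s : {fset T}) (a : T) :
  #|` s| = 2%N -> a \in s -> exists b, a != b /\ s = [fset a; b].
Proof.
move=> s2 sa; have /eqP/cardfs1P[b sb] : #|` s `\ a| = 1%N.
  by have := cardfsD1 a s; rewrite s2 sa add1n => -[<-].
exists b; have : b \in s `\ a by rewrite sb inE.
rewrite !inE => /andP[ba bs]; rewrite eq_sym; split=> //.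
apply/fsetP => u; have := congr1 (fun X : {fset T} => u \in X) sb; rewrite !inE.
by case: eqP => [->|_] /=; rewrite ?sa.
Qed.

(** * Points and faces of a planar complex *)

Section Complex.
Context {R : realType}.
Variable Delta : {fset {fset 'rV[R]_2}}.
Hypothesis cx : simplicial_complex Delta.
Implicit Types (u v w x y z : 'rV[R]_2) (sigma tau : {fset 'rV[R]_2}).

Lemma face_neq0 sigma : sigma \in Delta -> sigma != fset0.
Proof. by case: cx => h _ _ /h[]. Qed.

Lemma face_affine sigma : sigma \in Delta -> affinely_independent sigma.
Proof. by case: cx => h _ _ /h[]. Qed.

Lemma face_subset sigma tau : sigma \in Delta -> tau != fset0 -> tau `<=` sigma ->
  tau \in Delta.
Proof. by case: cx => _ h _; exact: h. Qed.

Lemma realizationI sigma tau x : sigma \in Delta -> tau \in Delta ->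
  realization sigma x -> realization tau x -> realization (sigma `&` tau) x.
Proof. by case: cx => _ _ h s t sx tx; rewrite -h. Qed.

Lemma face_vertex sigma v : sigma \in Delta -> v \in sigma -> [fset v] \in Delta.
Proof.
move=> sD vs; apply: (face_subset sD); last by rewrite fsub1set.
by apply/fset0Pn; exists v; rewrite inE.
Qed.

Lemma face_edge sigma v w : sigma \in Delta -> v \in sigma -> w \in sigma ->
  [fset v; w] \in Delta.
Proof.
move=> sD vs ws; apply: (face_subset sD).
  by apply/fset0Pn; exists v; rewrite !inE eqxx.
by apply/fsubsetP => u; rewrite !inE => /orP[] /eqP ->.
Qed.

Lemma mem_faces sigma i : (sigma \in faces Delta i) = (sigma \in Delta) && (#|` sigma| == i.+1).
Proof. by rewrite /faces !inE. Qed.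

Lemma mem_vertices v : (v \in vertices Delta) = ([fset v] \in Delta).
Proof.
rewrite /vertices !inE /= cardfs1 eqxx andbT.
apply/andP/idP => [[]//|vD]; split=> //.
by apply/bigfcupP; exists [fset v]; rewrite ?vD ?inE.
Qed.

(** The point also lies in the common face of [tau] and [sigma]. Its barycentric coordinates in
    [tau] are unique and all positive, so no vertex of [tau] can be missing from that face. *)
Lemma support_subset tau sigma (a : 'rV[R]_2 -> R) x : tau \in Delta -> sigma \in Delta ->
  (forall v, v \in tau -> 0 < a v) -> \sum_(v <- tau) a v = 1 ->
  x = \sum_(v <- tau) a v *: v -> realization sigma x -> tau `<=` sigma.
Proof.
move=> tD sD a0 a1 xE sx.
have tx : realization tau x.
  by apply/realizationP; exists a; split=> // v /a0/ltW.
have /realizationP[b [b0 b1 xb]] := realizationI tD sD tx sx.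
pose f u := if u \in sigma then b u else 0.
have ext (V : nmodType) (F G : 'rV[R]_2 -> V) : (forall u, u \in sigma -> F u = G u) ->
    (forall u, u \notin sigma -> F u = 0) ->
    \sum_(u <- tau) F u = \sum_(u <- tau `&` sigma) G u.
  move=> FG F0; transitivity (\sum_(u <- tau `&` sigma) F u).
    apply: esym; apply: big_fset_incl; first exact: fsubsetIl.
    by move=> u ut; rewrite inE ut /=; apply: F0.
  by rewrite big_seq [RHS]big_seq; apply: eq_bigr => u; rewrite inE => /andP[_ /FG].
apply/fsubsetP => v vt; apply: contraT => vs.
have : a v = f v.
  apply: (affine_coord_inj (face_affine tD)) vt.
    by rewrite a1 -b1; apply: esym; apply: ext => u; rewrite /f; [move=> -> | move=> /negbTE ->].
  rewrite -xE xb; apply: esym.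
  by apply: ext => u; rewrite /f; [move=> -> | move=> /negbTE ->; rewrite scale0r].
by rewrite /f (negbTE vs) => av; have := a0 v vt; rewrite av ltxx.
Qed.

(** The vertices with positive coordinate in one face around x span the smallest face containing x,
    and this one is part of every other. *)
Lemma common_vertex x : carrier Delta x -> exists2 v, v \in vertices Delta &
  forall sigma, sigma \in Delta -> realization sigma x -> v \in sigma.
Proof.
move=> [sigma /= sD sx]; have /realizationP[a [a0 a1 xE]] := sx.
pose tau := [fset v in sigma | 0 < a v].
have ts : tau `<=` sigma by apply/fsubsetP => u; rewrite !inE => /andP[].
have ext (V : nmodType) (F : 'rV[R]_2 -> V) :
    (forall u, u \in sigma -> a u = 0 -> F u = 0) ->
    \sum_(u <- sigma) F u = \sum_(u <- tau) F u.
  move=> F0; apply: esym; apply: big_fset_incl => // u us; rewrite !inE us /= -leNgt => au.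
  by apply: F0 => //; apply/eqP; rewrite eq_le au a0.
have t1 : \sum_(u <- tau) a u = 1 by rewrite -ext.
have t0 : tau != fset0.
  by apply/eqP => t0; move: t1; rewrite t0 big_seq_fset0 => /eqP; rewrite eq_sym oner_eq0.
have tD := face_subset sD t0 ts.
have tx : x = \sum_(v <- tau) a v *: v.
  by rewrite xE; apply: ext => u _ ->; rewrite scale0r.
have /fset0Pn[v vt] := t0; exists v.
  by rewrite mem_vertices; apply: face_vertex tD vt.
move=> sigma' s'D s'x; apply: (fsubsetP _ v vt).
apply: (support_subset tD s'D _ t1 tx s'x) => u.
by rewrite !inE => /andP[].
Qed.

Lemma vertex_point v sigma : [fset v] \in Delta -> sigma \in Delta ->
  realization sigma v -> v \in sigma.
Proof.
move=> vD sD sv; rewrite -fsub1set.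
apply: (support_subset (a := fun=> 1) vD sD _ _ _ sv) => //.
  by rewrite big_seq_fset1.
by rewrite big_seq_fset1 scale1r.
Qed.

Lemma edge_point v w t sigma : v != w -> [fset v; w] \in Delta -> sigma \in Delta ->
  0 < t < 1 -> realization sigma (v + t *: (w - v)) -> v \in sigma /\ w \in sigma.
Proof.
move=> vw eD sD /andP[t0 t1] sx.
suff /fsubsetP sub : [fset v; w] `<=` sigma by split; apply: sub; rewrite !inE eqxx ?orbT.
apply: (support_subset (a := fun u => if u == v then 1 - t else t) eD sD _ _ _ sx).
- by move=> u _; case: ifP; lra.
- by rewrite big_fset2 // eqxx eq_sym (negbTE vw); lra.
- rewrite big_fset2 // eqxx eq_sym (negbTE vw).
  by rewrite scalerBl scale1r scalerBr -!addrA; congr (_ + _); rewrite addrC.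
Qed.

Lemma triangleP sigma v w : sigma \in faces Delta 2 -> v \in sigma -> w \in sigma ->
  v != w -> exists z, [/\ v != z, w != z, sigma = [fset v; w; z] & cross (w - v) (z - v) != 0].
Proof.
rewrite mem_faces => /andP[sD /eqP s3] vs ws vw.
have [z [zv zw sE]] := cardfs3P s3 vs ws vw; exists z.
have vz : v != z by rewrite eq_sym.
have wz : w != z by rewrite eq_sym.
by split=> //; apply: affine_cross => //; rewrite -sE; apply: face_affine.
Qed.

Lemma triangle_neq v w z : [fset v; w; z] \in faces Delta 2 ->
  [/\ v != w, v != z & w != z].
Proof.
rewrite mem_faces => /andP[_ /eqP c3].
have card2 (a b : 'rV[R]_2) : (#|` [fset a; b]| <= 2)%N by rewrite cardfs2; case: (_ == _).
split; apply/eqP => e; have := c3; rewrite -?e => c3'.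
- have := card2 v z; rewrite (_ : [fset v; z] = [fset v; v; z]) ?c3' //.
  by apply/fsetP => u; rewrite !inE orbb.
- have := card2 v w; rewrite (_ : [fset v; w] = [fset v; w; v]) ?c3' //.
  by apply/fsetP => u; rewrite !inE; case: (u == v); case: (u == w).
- have := card2 v w; rewrite (_ : [fset v; w] = [fset v; w; w]) ?c3' //.
  by apply/fsetP => u; rewrite !inE -orbA orbb.
Qed.

Lemma triangle_at sigma v : sigma \in faces Delta 2 -> v \in sigma ->
  exists w z, sigma = [fset v; w; z] /\ 0 < cross (w - v) (z - v).
Proof.
move=> s2 vs; have := s2; rewrite mem_faces => /andP[sD /eqP c3].
have [w wv] : exists w, w \in sigma `\ v.
  apply/fset0Pn; rewrite -cardfs_gt0.
  by have := cardfsD1 v sigma; rewrite vs c3 add1n => -[<-].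
move: wv; rewrite !inE => /andP[wv ws].
have vw : v != w by rewrite eq_sym.
have [z [vz wz sE D0]] := triangleP s2 vs ws vw.
have [D1|D1] := ltrP 0 (cross (w - v) (z - v)); first by exists w, z.
exists z, w; split; last by rewrite crossC oppr_gt0 lt_neqAle D0.
by rewrite sE; apply/fsetP => u; rewrite !inE -!orbA; congr (_ || _); rewrite orbC.
Qed.

Lemma realization_triangle v w z x : [fset v; w; z] \in faces Delta 2 ->
  realization [fset v; w; z] x <->
  exists a b, [/\ 0 <= a, 0 <= b, a + b <= 1 & x = v + a *: (w - v) + b *: (z - v)].
Proof. by move=> /triangle_neq[? ? ?]; apply: realization3P. Qed.

Lemma triangle_cross v w z : [fset v; w; z] \in faces Delta 2 ->
  cross (w - v) (z - v) != 0.
Proof.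
move=> s2; have [vw vz wz] := triangle_neq s2; apply: affine_cross => //.
by move: s2; rewrite mem_faces => /andP[/face_affine].
Qed.

(** A point outside a triangle or an edge strictly violates one of the affine conditions that
    describe it, and strict inequalities are open. A vertex is a closed point. *)
Lemma near_face sigma x : sigma \in Delta -> ~ realization sigma x ->
  nbhs x (fun y => ~ realization sigma y).
Proof.
move=> sD nx; have := affine_card (face_affine sD).
have /fset0Pn[v vs] := face_neq0 sD.
rewrite leq_eqVlt => /orP[/eqP s3|].
  have s2 : sigma \in faces Delta 2 by rewrite mem_faces sD s3.
  have [w [z [sE D0]]] := triangle_at s2 vs; rewrite sE in s2 nx *.
  have rP y : realization [fset v; w; z] y <->
      [/\ 0 <= cross (y - v) (z - v), 0 <= cross (w - v) (y - v) &
          cross (y - v) (z - v) + cross (w - v) (y - v) <= cross (w - v) (z - v)].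
    rewrite realization_triangle //; split=> [[a [b [a0 b0 ab ->]]]|[h1 h2 h3]].
      have -> : v + a *: (w - v) + b *: (z - v) - v = a *: (w - v) + b *: (z - v).
        by rewrite -[v + _ + _]addrA [v + _]addrC addrK.
      have -> : cross (a *: (w - v) + b *: (z - v)) (z - v) = a * cross (w - v) (z - v).
        by rewrite /cross !mxE; ring.
      have -> : cross (w - v) (a *: (w - v) + b *: (z - v)) = b * cross (w - v) (z - v).
        by rewrite /cross !mxE; ring.
      by split; nra.
    exists (cross (y - v) (z - v) / cross (w - v) (z - v)), (cross (w - v) (y - v) / cross (w - v) (z - v)).
    split; rewrite ?divr_ge0 ?(ltW D0) //.
      by rewrite -mulrDl ler_pdivrMr // mul1r.
    by rewrite -addrA -cross_combination ?gt_eqF // addrC subrK.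
  have : [\/ 0 < cross (z - v) (x - v), 0 < - cross (w - v) (x - v) |
      0 < cross (x - v) (z - v) + cross (w - v) (x - v) - cross (w - v) (z - v)].
    have [h1|h1] := ltrP 0 (cross (z - v) (x - v)); first by constructor 1.
    have [h2|h2] := ltrP 0 (- cross (w - v) (x - v)); first by constructor 2.
    constructor 3; rewrite ltNge; apply/negP => h3; apply: nx; apply/rP.
    have cC := crossC (z - v) (x - v).
    by move: h1 h2 h3; rewrite cC => h1 h2 h3; split; lra.
  case=> h.
  - apply: filterS (near_cross_gt0 h) => y hy /rP[]; rewrite (crossC (z - v) (y - v)); lra.
  - have : 0 < cross (v - w) (x - v) by move: h; rewrite /cross !mxE; lra.
    move=> /near_cross_gt0; apply: filterS => y hy /rP[_ hy' _].
    by move: hy hy'; rewrite /cross !mxE; lra.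
  - have : 0 < cross (w - z) (x - w) by move: h; rewrite /cross !mxE; lra.
    move=> /near_cross_gt0; apply: filterS => y hy /rP[_ _ hy'].
    by move: hy hy'; rewrite /cross !mxE; lra.
rewrite ltnS leq_eqVlt => /orP[s2|]; last first.
  rewrite ltnS => s1.
  have sE : sigma = [fset v].
    apply/eqP; rewrite eq_sym eqEfcard fsub1set vs cardfs1 //.
  have xv : x != v by apply: contra_notN nx => /eqP ->; apply: mem_realization.
  rewrite sE; have : nbhs x (~` [set v]).
    apply: open_nbhs_nbhs; split; last by apply/eqP.
    by apply: closed_openC; apply: accessible_closed_set1; apply: hausdorff_accessible; exact: norm_hausdorff.
  by apply: filterS => y yv /realization_vertex.
have [b [vb]] := cardfs2_mem (eqP s2) vs; move: v vs vb => a _ ab sE.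
rewrite sE in nx *; pose p := b - a.
have p2 : 0 < p 0 0 ^+ 2 + p 0 1 ^+ 2.
  rewrite lt_neqAle addr_ge0 ?sqr_ge0 // andbT eq_sym paddr_eq0 ?sqr_ge0 //.
  rewrite !sqrf_eq0; apply: contraNN ab => /andP[/eqP p0 /eqP p1].
  by apply/eqP; apply: rV2P; [move: p0|move: p1]; rewrite /p !mxE; lra.
(* A normal of the edge: [cross q] is minus the scalar product with [p], so its signs bound the
   projection onto the line of the edge. *)
pose q : 'rV[R]_2 := \row_j (if j == 0 then - p 0 1 else p 0 0).
have qE y : cross q y = - (p 0 1 * y 0 1 + p 0 0 * y 0 0).
  by rewrite /cross !mxE /=; ring.
have rP y : realization [fset a; b] y <-> [/\ cross p (y - a) = 0,
    cross q (y - a) <= 0 & 0 <= cross q (y - b)].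
  rewrite realization2P //; split=> [[t [t0 t1 ->]]|[h1 h2 h3]].
    have -> : a + t *: (b - a) - a = t *: p by rewrite addrC addKr.
    have -> : a + t *: (b - a) - b = (t - 1) *: p.
      by apply: rV2P; rewrite /p !mxE; ring.
    rewrite !qE /cross !mxE -/p; split; first by ring.
      by have := mulr_ge0 t0 (ltW p2); rewrite /p !mxE; lra.
    have t1' : 0 <= 1 - t by lra.
    by have := mulr_ge0 t1' (ltW p2); rewrite /p !mxE; lra.
  (* The parameter of the orthogonal projection onto the line of the edge. *)
  exists (- cross q (y - a) / (p 0 0 ^+ 2 + p 0 1 ^+ 2)).
  have bE : cross q (y - b) = cross q (y - a) + (p 0 0 ^+ 2 + p 0 1 ^+ 2).
    by rewrite !qE /p !mxE; ring.
  split.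
  - by rewrite divr_ge0 ?(ltW p2) // oppr_ge0.
  - by rewrite ler_pdivrMr // mul1r; move: h3; rewrite bE; lra.
  set s := p 0 0 ^+ 2 + p 0 1 ^+ 2; have s0 : s != 0 by rewrite gt_eqF.
  rewrite qE opprK -/p; move: h1; rewrite /cross; set e := y - a => h1.
  have {1}-> : y = a + e by rewrite addrC subrK.
  congr (_ + _); clearbody e; apply: rV2P; rewrite [RHS]mxE; apply: (mulfI s0).
    rewrite [RHS]mulrA [s * (_ / s)]mulrC divfK //.
    have -> : s * e 0 0 = (p 0 1 * e 0 1 + p 0 0 * e 0 0) * p 0 0
      - p 0 1 * (p 0 0 * e 0 1 - p 0 1 * e 0 0) by rewrite /s; ring.
    by rewrite h1 mulr0 subr0.
  rewrite [RHS]mulrA [s * (_ / s)]mulrC divfK //.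
  have -> : s * e 0 1 = (p 0 1 * e 0 1 + p 0 0 * e 0 0) * p 0 1
    + p 0 0 * (p 0 0 * e 0 1 - p 0 1 * e 0 0) by rewrite /s; ring.
  by rewrite h1 mulr0 addr0.
have : [\/ 0 < cross p (x - a), 0 < cross (- p) (x - a),
    0 < cross q (x - a) | 0 < cross (- q) (x - b)].
  have [h1|h1] := ltrP 0 (cross p (x - a)); first by constructor 1.
  have [h2|h2] := ltrP 0 (cross (- p) (x - a)); first by constructor 2.
  have [h3|h3] := ltrP 0 (cross q (x - a)); first by constructor 3.
  have [h4|h4] := ltrP 0 (cross (- q) (x - b)); first by constructor 4.
  have negE (g h : 'rV[R]_2) : cross (- g) h = - cross g h by rewrite /cross !mxE; ring.
  rewrite !negE in h2 h4.
  by case: nx; apply/rP; split; lra.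
have negE (g h : 'rV[R]_2) : cross (- g) h = - cross g h by rewrite /cross !mxE; ring.
by case=> /near_cross_gt0; apply: filterS => y hy /rP[h1 h2 h3];
  rewrite ?negE in hy; move: hy h1 h2 h3; clear; lra.
Qed.

(** There are finitely many faces to keep away from. Near x the complex is therefore the star of
    x. *)
Lemma near_faces x : nbhs x (fun y => forall sigma, sigma \in Delta ->
  realization sigma y -> realization sigma x).
Proof.
apply: near_all_seq => sigma sD.
have [sx|nx] := pselect (realization sigma x); first by apply: filterE.
by apply: filterS (near_face sD nx).
Qed.

End Complex.

(** * Local structure of the complex *)

Section LocalPotential.
Context {R : realType}.
Variable Delta : {fset {fset 'rV[R]_2}}.
Hypothesis cx : simplicial_complex Delta.
Implicit Types (p q u v w x y z r rho : 'rV[R]_2) (sigma tau : {fset 'rV[R]_2}).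
Local Notation K := (carrier Delta).

Lemma mem_carrier sigma x : sigma \in Delta -> realization sigma x -> K x.
Proof. by move=> sD sx; exists sigma. Qed.

Lemma shiftK v p q : v + p + q - v = p + q.
Proof. by rewrite -[v + p + q]addrA [v + _]addrC addrK. Qed.

Lemma crossZ p q (a : R) : cross p (a *: q) = a * cross p q.
Proof. by rewrite /cross !mxE; ring. Qed.

Lemma crossD p q q' : cross p (q + q') = cross p q + cross p q'.
Proof. by rewrite /cross !mxE; ring. Qed.

Lemma cross_self p : cross p p = 0.
Proof. by rewrite /cross; ring. Qed.

Lemma mem_face_edge v w sigma : sigma \in Delta -> v \in sigma -> w \in sigma -> v != w ->
  sigma = [fset v; w] \/ sigma \in faces Delta 2.
Proof.
move=> sD vs ws vw; have := affine_card (face_affine cx sD).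
rewrite leq_eqVlt => /orP[s3|s2]; first by right; rewrite mem_faces sD.
left; apply/eqP; rewrite eq_sym eqEfcard cardfs2 vw -ltnS s2 andbT.
by apply/fsubsetP => u; rewrite !inE => /orP[] /eqP ->.
Qed.

(** Push an interior point of the edge slightly to the left. A face around the pushed point also
    contains the original one, hence the whole edge, and it is not the edge itself. *)
Lemma interior_edge_left v w x0 : v != w -> [fset v; w] \in Delta ->
  realization [fset v; w] x0 -> interior K x0 ->
  exists z, [fset v; w; z] \in faces Delta 2 /\ 0 < cross (w - v) (z - v).
Proof.
move=> vw eD /(realization2P _ vw)[t0 [t00 t01 x0E]] Kx0.
(* The given point may be an end of the edge; a small move towards the midpoint makes it relatively
   interior. *)
have [x [t [t1 xE Kx]]] : exists x t, [/\ 0 < t < 1, x = v + t *: (w - v) & interior K x].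
  have h1 : nbhs x0 (interior K) by apply: open_nbhs_nbhs; split=> //; exact: open_interior.
  have h2 := near_shift h1 ((1 / 2 - t0) *: (w - v)).
  have [h [Kh /andP[h0 h3]]] := filter_ex (filterI h2 (near0_right_lt (@ltr01 R))).
  exists (x0 + h *: ((1 / 2 - t0) *: (w - v))), (t0 + h * (1 / 2 - t0)); split=> //.
    by apply/andP; split; nra.
  by rewrite x0E scalerA -addrA -scalerDl.
(* The edge vector turned left by a quarter turn. *)
pose n : 'rV[R]_2 := \row_j (if j == 0 then - (w - v) 0 1 else (w - v) 0 0).
have pn : 0 < cross (w - v) n.
  rewrite /cross !mxE /= mulrN opprK -!expr2 lt_neqAle addr_ge0 ?sqr_ge0 // andbT.
  rewrite eq_sym paddr_eq0 ?sqr_ge0 // !sqrf_eq0; apply: contraNN vw => /andP[/eqP p0 /eqP p1].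
  by apply/eqP; apply: rV2P; lra.
have [h [[Kh hf] h0]] := filter_ex (filterI
  (near_shift (filterI Kx (near_faces cx x)) n) (nbhs_right_gt (0 : R))).
have [sigma /= sD sy] := Kh.
have := hf _ sD sy; rewrite xE => /(edge_point cx vw eD sD t1)[vs ws].
have cy : cross (w - v) (x + h *: n - v) = h * cross (w - v) n.
  rewrite xE shiftK.
  by rewrite crossD !crossZ cross_self mulr0 add0r.
have cy0 : 0 < cross (w - v) (x + h *: n - v) by rewrite cy mulr_gt0.
have [sE|s2] := mem_face_edge sD vs ws vw.
  move: sy; rewrite sE => /(realization2P _ vw)[t' [_ _ yE]].
  by move: cy0; rewrite yE [v + _]addrC addrK crossZ cross_self mulr0 ltxx.
have [z [vz wz sE D0]] := triangleP cx s2 vs ws vw; exists z; rewrite -sE; split=> //.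
move: sy; rewrite sE => /(realization3P _ vw vz wz)[a [b [a0 b0 ab yE]]].
move: cy0; rewrite yE shiftK.
rewrite crossD !crossZ cross_self mulr0 add0r => bc.
by have := D0; rewrite neq_lt => /orP[|//] Dn; nra.
Qed.

(** Two triangles on the same side of a common edge overlap near its midpoint, in points off the
    edge, although they intersect in that edge only. *)
Lemma opposite_sides v w z z' : [fset v; w; z] \in faces Delta 2 ->
  [fset v; w; z'] \in faces Delta 2 -> [fset v; w; z] != [fset v; w; z'] ->
  cross (w - v) (z - v) * cross (w - v) (z' - v) < 0.
Proof.
move=> s2 s2' ss'; have [vw vz wz] := triangle_neq s2.
have [_ vz' wz'] := triangle_neq s2'.
have D0 := triangle_cross cx s2; have D0' := triangle_cross cx s2'.
rewrite ltNge; apply/negP => DD.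
have zE := cross_combination (z' - v) D0.
set al := cross (z' - v) (z - v) / _ in zE; set be := cross (w - v) (z' - v) / _ in zE.
have be0 : 0 < be.
  have {}DD : 0 < cross (w - v) (z - v) * cross (w - v) (z' - v).
    by rewrite lt_neqAle DD eq_sym mulf_neq0.
  have -> : be = (cross (w - v) (z - v) * cross (w - v) (z' - v)) / (cross (w - v) (z - v)) ^+ 2.
    by rewrite /be; field.
  by rewrite divr_gt0 // exprn_even_gt0.
(* Small enough for the coordinates 1/2 + h al and h be to be nonnegative with sum at most 1. *)
pose h := (2 * (1 + `|al| + be))^-1.
have m0 : 0 <= `|al| by [].
have h1 : h * (2 * (1 + `|al| + be)) = 1 by rewrite /h mulVf // gt_eqF //; lra.
have h0 : 0 < h by rewrite /h invr_gt0; lra.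
have al1 := ler_norm al; have al2 : - al <= `|al| by rewrite -normrN ler_norm.
pose y := v + 2^-1 *: (w - v) + h *: (z' - v).
have sD : [fset v; w; z] \in Delta by move: s2; rewrite mem_faces => /andP[].
have sD' : [fset v; w; z'] \in Delta by move: s2'; rewrite mem_faces => /andP[].
have y' : realization [fset v; w; z'] y.
  by apply/realization3P => //; exists 2^-1, h; split=> //; nra.
have yy : realization [fset v; w; z] y.
  apply/realization3P => //; exists (2^-1 + h * al), (h * be); split; [nra|nra|nra|].
  by rewrite /y [in LHS]zE; apply: rV2P; rewrite !mxE; ring.
have := realizationI cx sD sD' yy y'.
have -> : [fset v; w; z] `&` [fset v; w; z'] = [fset v; w].
  apply/fsetP => u; rewrite !inE; case: (u =P v) => //= _; case: (u =P w) => //= _.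
  apply/negbTE/negP => /andP[/eqP -> /eqP zz]; by rewrite zz eqxx in ss'.
move=> /(realization2P _ vw)[t [_ _ yE]].
have : cross (w - v) (y - v) = h * cross (w - v) (z' - v).
  rewrite /y shiftK.
  by rewrite crossD !crossZ cross_self mulr0 add0r.
rewrite yE [v + _]addrC addrK crossZ cross_self mulr0 => /esym/eqP.
by rewrite mulf_eq0 gt_eqF //= (negbTE D0').
Qed.

(** A point of the edge close to v lies in the triangle, so [u] is one of its vertices. The sector
    is half-open: the side [w] is allowed, the side [r] is not. *)
Lemma edge_in_triangle v r w u : [fset v; r; w] \in faces Delta 2 ->
  0 < cross (r - v) (w - v) -> [fset v; u] \in Delta -> v != u ->
  0 < cross (r - v) (u - v) -> 0 <= cross (u - v) (w - v) -> u = w.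
Proof.
move=> s2 D0 eD vu c1 c2; have [vr vw rw] := triangle_neq s2.
have sD : [fset v; r; w] \in Delta by move: s2; rewrite mem_faces => /andP[].
have uE := cross_combination (u - v) (negbT (gt_eqF D0)).
set al := cross (u - v) _ / _ in uE; set be := _ / _ in uE.
have al0 : 0 <= al by rewrite divr_ge0 // ltW.
have be0 : 0 < be by rewrite divr_gt0.
pose h := (1 + al + be)^-1 / 2.
have h1 : h * (2 * (1 + al + be)) = 1 by rewrite /h; field; rewrite gt_eqF //; lra.
have h0 : 0 < h by rewrite /h divr_gt0 // invr_gt0; lra.
have hh : 0 < h < 1 by apply/andP; split=> //; nra.
have : realization [fset v; r; w] (v + h *: (u - v)).
  apply/realization3P => //; exists (h * al), (h * be); split; [nra|nra|nra|].
  by rewrite [in LHS]uE scalerDr !scalerA addrA.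
move=> /(edge_point cx vu eD sD hh)[_].
rewrite !inE -orbA => /or3P[/eqP uv|/eqP ur|/eqP //].
  by rewrite uv eqxx in vu.
by move: c1; rewrite ur cross_self ltxx.
Qed.

(** Take the direction of a point outside the carrier that is so close to v that a triangle at v can
    miss it only by its angle. *)
Lemma frontier_direction v : K v -> ~ interior K v ->
  exists2 rho, rho != 0 & forall r w, [fset v; r; w] \in faces Delta 2 ->
    0 < cross (r - v) (w - v) -> ~ (0 <= cross (r - v) rho /\ 0 <= cross rho (w - v)).
Proof.
move=> Kv nKv.
(* Close to v, no side opposite to v has been crossed. *)
have n1 : nbhs v (fun y => forall r, r \in vertices Delta -> forall w, w \in vertices Delta ->
    0 < cross (r - v) (w - v) ->
    cross (y - v) (w - v) + cross (r - v) (y - v) < cross (r - v) (w - v)).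
  apply: near_all_seq => r _; apply: near_all_seq => w _.
  have [D0|] := pselect (0 < cross (r - v) (w - v)); last by move=> h; apply: filterE.
  have : nbhs v (fun y => 0 < cross (w - r) (y - r)).
    apply: near_cross_gt0; suff -> : cross (w - r) (v - r) = cross (r - v) (w - v) by [].
    by rewrite /cross !mxE; ring.
  apply: filterS => y hy _; move: hy; rewrite /cross !mxE; lra.
have [y [hy nKy]] : exists y, (forall r, r \in vertices Delta -> forall w, w \in vertices Delta ->
    0 < cross (r - v) (w - v) ->
    cross (y - v) (w - v) + cross (r - v) (y - v) < cross (r - v) (w - v)) /\ ~ K y.
  apply: contrapT => /forallNP h; apply: nKv; apply: filterS n1 => y hy.
  by apply: contrapT => nKy; apply: (h y).
exists (y - v).
  by rewrite subr_eq0; apply: contra_notN nKy => /eqP ->.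
move=> r w s2 D0 [c1 c2]; apply: nKy.
have sD : [fset v; r; w] \in Delta by move: s2; rewrite mem_faces => /andP[].
apply: (mem_carrier sD); apply/(realization_triangle _ s2).
exists (cross (y - v) (w - v) / cross (r - v) (w - v)), (cross (r - v) (y - v) / cross (r - v) (w - v)).
split; rewrite ?divr_ge0 ?(ltW D0) //.
  rewrite -mulrDl ler_pdivrMr // mul1r ltW //; apply: hy => //; rewrite mem_vertices.
    by apply: (face_vertex cx sD); rewrite !inE eqxx orbT.
  by apply: (face_vertex cx sD); rewrite !inE eqxx !orbT.
by rewrite -addrA -cross_combination ?gt_eqF // addrC subrK.
Qed.

End LocalPotential.

(** * Angular order of plane vectors *)

Section AngularOrder.
Context {R : realType}.
Implicit Types (rho u r w : 'rV[R]_2).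

Definition dot (p q : 'rV[R]_2) : R := p 0 0 * q 0 0 + p 0 1 * q 0 1.

(** Angles in [0, pi) from [rho]: the half-open half-plane puts [rho] first and its opposite into
    the second half. *)
Definition upper_half rho u : bool :=
  (0 < cross rho u) || ((cross rho u == 0) && (0 < dot rho u)).

(* [u] comes no later than [r] when turning counterclockwise from [rho]. *)
Definition angle_le rho u r : bool :=
  (upper_half rho u && ~~ upper_half rho r) ||
  ((upper_half rho u == upper_half rho r) && (0 <= cross u r)).

(** Angles are compared in the coordinates [dot rho] and [cross rho]; N is the squared norm of
    [rho]. *)
Lemma angle_coords rho u r : rho != 0 -> exists2 N : R, 0 < N &
  N * cross u r = dot rho u * cross rho r - cross rho u * dot rho r.
Proof.
move=> rho0; exists (dot rho rho); last by rewrite /cross /dot; ring.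
rewrite /dot -!expr2 lt_neqAle addr_ge0 ?sqr_ge0 // andbT eq_sym paddr_eq0 ?sqr_ge0 //.
rewrite !sqrf_eq0; apply: contraNN rho0 => /andP[/eqP p0 /eqP p1].
by apply/eqP; apply: rV2P; rewrite mxE.
Qed.

Lemma dot_cross_eq0 rho u : rho != 0 -> u != 0 -> cross rho u = 0 -> dot rho u != 0.
Proof.
move=> rho0 u0 c0; apply: contraNneq u0 => d0.
have [N N0 _] := angle_coords u u rho0; apply/eqP.
have h : 0 < dot rho rho.
  rewrite /dot -!expr2 lt_neqAle addr_ge0 ?sqr_ge0 // andbT eq_sym paddr_eq0 ?sqr_ge0 //.
  rewrite !sqrf_eq0; apply: contraNN rho0 => /andP[/eqP p0 /eqP p1].
  by apply/eqP; apply: rV2P; rewrite mxE.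
have e0 : dot rho rho * u 0 0 = rho 0 0 * dot rho u - rho 0 1 * cross rho u.
  by rewrite /dot /cross; ring.
have e1 : dot rho rho * u 0 1 = rho 0 1 * dot rho u + rho 0 0 * cross rho u.
  by rewrite /dot /cross; ring.
move: e0 e1; rewrite d0 c0 !mulr0 addr0 subr0 => /eqP e0 /eqP e1.
move: e0 e1; rewrite !mulf_eq0 gt_eqF //= => /eqP e0 /eqP e1.
by apply: rV2P; rewrite mxE.
Qed.

Lemma upper_halfP rho u : rho != 0 -> u != 0 ->
  (upper_half rho u /\ (0 < cross rho u \/ (cross rho u = 0 /\ 0 < dot rho u))) \/
  (upper_half rho u = false /\ (cross rho u < 0 \/ (cross rho u = 0 /\ dot rho u < 0))).
Proof.
move=> rho0 u0; rewrite /upper_half; case: (ltrgtP 0 (cross rho u)) => /= c.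
- by left; split=> //; left.
- by right; split=> //; left.
have := dot_cross_eq0 rho0 u0 (esym c); rewrite neq_lt => /orP[] d; rewrite d.
  by right; split; [rewrite ltNge ltW | right].
by left; split=> //; right.
Qed.

Lemma angle_le_refl rho u : angle_le rho u u.
Proof. by rewrite /angle_le eqxx /cross /= mulrC subrr lexx orbT. Qed.

Section HalfPlane.
Variables pu qu pr qr pw qw : R.
Hypothesis rw_gt0 : 0 < pr * qw - qr * pw.

(* The Pluecker relation between three plane vectors. *)
Let plueckerq : qr * (pu * qw - qu * pw) =
  qw * (pu * qr - qu * pr) + qu * (pr * qw - qr * pw).
Proof. by ring. Qed.

(** Here p and q are the coordinates along and across the start direction; the disjunctions place a
    vector in the upper or in the lower half. *)
Lemma same_half_trans : 0 < qr \/ (qr = 0 /\ 0 < pr) -> 0 < qu \/ (qu = 0 /\ 0 < pu) ->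
  0 < qw \/ (qw = 0 /\ 0 < pw) -> 0 <= pu * qr - qu * pr -> 0 <= pu * qw - qu * pw.
Proof.
move=> hr hu hw ur; have qu0 : 0 <= qu by lra.
have qw0 : 0 <= qw by lra.
case: hr => [qr0|[qr0 pr0]].
  by rewrite -(pmulr_rge0 _ qr0) plueckerq addr_ge0 // mulr_ge0 // ltW.
have qu_eq0 : qu = 0 by move: ur; rewrite qr0; nra.
have pu0 : 0 < pu by lra.
by rewrite qu_eq0 mul0r subr0 mulr_ge0 // ltW.
Qed.

Lemma cross_half_le : 0 < qr \/ (qr = 0 /\ 0 < pr) -> 0 < qu \/ (qu = 0 /\ 0 < pu) ->
  qw < 0 \/ (qw = 0 /\ pw < 0) -> pu * qr - qu * pr < 0 -> 0 <= pu * qw - qu * pw.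
Proof.
move=> hr hu hw ur; have qu0 : 0 <= qu by lra.
have qw0 : qw <= 0 by lra.
case: hr => [qr0|[qr0 pr0]].
  rewrite -(pmulr_rge0 _ qr0) plueckerq addr_ge0 ?(mulr_ge0 qu0) ?(ltW rw_gt0) //.
  by rewrite mulr_le0 // ltW.
by exfalso; move: rw_gt0; rewrite qr0 mul0r subr0 pmulr_rgt0 //; lra.
Qed.

Lemma cross_half_lt : 0 < qr \/ (qr = 0 /\ 0 < pr) -> qu < 0 \/ (qu = 0 /\ pu < 0) ->
  qw < 0 \/ (qw = 0 /\ pw < 0) -> 0 <= pu * qw - qu * pw -> pu * qr - qu * pr < 0.
Proof.
move=> hr hu hw uw; have qw0 : qw <= 0 by lra.
have qr0 : 0 <= qr by lra.
case: hu => [qu0|[qu0 pu0]].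
  rewrite ltNge; apply/negP => ur.
  have h1 : 0 <= qr * (pu * qw - qu * pw) by rewrite mulr_ge0.
  have h2 : qw * (pu * qr - qu * pr) <= 0 by rewrite mulr_le0_ge0.
  have h3 : qu * (pr * qw - qr * pw) < 0 by rewrite nmulr_rlt0.
  by move: h1; rewrite plueckerq; lra.
rewrite qu0 mul0r subr0 nmulr_rlt0 //.
case: hr => [//|[qr_eq0 pr0]]; exfalso; move: rw_gt0.
by rewrite qr_eq0 mul0r subr0 pmulr_rgt0 //; lra.
Qed.

Lemma wrap_le : qr < 0 -> 0 <= qw -> qu < 0 \/ (qu = 0 /\ pu < 0) ->
  pu * qr - qu * pr < 0 -> 0 <= pu * qw - qu * pw.
Proof.
move=> qr0 qw0 hu ur; have qu0 : qu <= 0 by lra.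
rewrite -(nmulr_rle0 _ qr0) plueckerq.
have h2 : qw * (pu * qr - qu * pr) <= 0 by rewrite mulr_ge0_le0 // ltW.
have h3 : qu * (pr * qw - qr * pw) <= 0 by rewrite mulr_le0_ge0 // ltW.
lra.
Qed.

Lemma wrap_lt : qr < 0 -> 0 <= qw -> 0 < qu \/ (qu = 0 /\ 0 < pu) ->
  0 <= pu * qw - qu * pw -> pu * qr - qu * pr < 0.
Proof.
move=> qr0 qw0 hu uw; case: hu => [qu0|[-> pu0]]; last first.
  by rewrite mul0r subr0 pmulr_rlt0.
rewrite ltNge; apply/negP => ur.
have h1 : qr * (pu * qw - qu * pw) <= 0 by rewrite mulr_le0_ge0 // ltW.
have h2 : 0 <= qw * (pu * qr - qu * pr) by rewrite mulr_ge0.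
have h3 : 0 < qu * (pr * qw - qr * pw) by rewrite mulr_gt0.
by move: h1; rewrite plueckerq; lra.
Qed.

End HalfPlane.

(** If the turn from r to w does not pass the start direction, the vectors up to w are those up to r
    together with those in the half-open sector after r. *)
Lemma angle_step rho u r w : rho != 0 -> u != 0 -> r != 0 -> w != 0 -> 0 < cross r w ->
  ~ (0 < cross r rho /\ 0 <= cross rho w) ->
  [/\ angle_le rho u r -> angle_le rho u w,
      angle_le rho u w -> ~~ angle_le rho u r -> 0 < cross r u /\ 0 <= cross u w
    & ~~ angle_le rho w r].
Proof.
move=> rho0 u0 r0 w0 D0; rewrite (crossC rho r) oppr_gt0 => nwrap.
have [N1 N10 ur] := angle_coords u r rho0.
have [N2 N20 uw] := angle_coords u w rho0.
have [N3 N30 rw] := angle_coords r w rho0.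
rewrite /angle_le (crossC u r) (crossC r w).
have := upper_halfP rho0 u0; have := upper_halfP rho0 r0; have := upper_halfP rho0 w0.
have h1 : 0 < dot rho r * cross rho w - cross rho r * dot rho w by rewrite -rw mulr_gt0.
have sur : (0 <= cross u r) = (0 <= dot rho u * cross rho r - cross rho u * dot rho r).
  by rewrite -ur pmulr_rge0.
have suw : (0 <= cross u w) = (0 <= dot rho u * cross rho w - cross rho u * dot rho w).
  by rewrite -uw pmulr_rge0.
have sur' : (cross u r < 0) = (dot rho u * cross rho r - cross rho u * dot rho r < 0).
  by rewrite !ltNge sur.
rewrite oppr_gt0 sur' sur suw.
rewrite (_ : (0 <= - cross r w) = false); last by apply/negbTE; rewrite -ltNge oppr_lt0.
move: (cross rho u) (cross rho r) (cross rho w) (dot rho u) (dot rho r) (dot rho w) h1 nwrap.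
move=> qu qr qw pu pr pw h1 nwrap {sur sur' suw ur uw rw D0} hw hr hu.
(* A half-turn negates all coordinates and carries the lower half to the upper one. *)
have h1' : 0 < - pr * - qw - - qr * - pw by rewrite !mulrNN.
have neg (p q : R) : q < 0 \/ (q = 0 /\ p < 0) -> 0 < - q \/ (- q = 0 /\ 0 < - p) by lra.
(* A turn from the lower half to the upper one would pass the start direction. *)
have contra : qr < 0 \/ (qr = 0 /\ pr < 0) -> 0 < qw \/ (qw = 0 /\ 0 < pw) -> False.
  move=> hr' hw'; apply: nwrap; case: hr' => [qr0|[qr0 pr0]]; first by split=> //; lra.
  by move: h1; rewrite qr0 mul0r subr0 nmulr_rgt0 //; lra.
case: hr => -[-> hr]; case: hw => -[-> hw]; case: hu => -[-> hu] /=; split=> //.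
- exact: (same_half_trans h1).
- by move=> uw; rewrite -ltNge.
- by move=> _; rewrite -ltNge => ur; split=> //; exact: (cross_half_le h1).
- by move=> uw _; split=> //; exact: (cross_half_lt h1).
- by case: (contra hr hw).
- by case: (contra hr hw).
- by case: (contra hr hw).
- by case: (contra hr hw).
- have := same_half_trans h1' (neg _ _ hr) (neg _ _ hu) (neg _ _ hw).
  by rewrite !mulrNN.
- by move=> uw; rewrite -ltNge.
Qed.

(** When the sector from r to w contains the start direction, whatever comes after r or up to w lies
    inside that sector. *)
Lemma angle_wrap rho u r w : rho != 0 -> u != 0 -> r != 0 -> w != 0 -> 0 < cross r w ->
  0 < cross r rho -> 0 <= cross rho w ->
  [/\ angle_le rho u w -> 0 < cross r u /\ 0 <= cross u w,
      ~~ angle_le rho u r -> 0 < cross r u /\ 0 <= cross u w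
    & angle_le rho w r].
Proof.
move=> rho0 u0 r0 w0 D0; rewrite (crossC rho r) oppr_gt0 => wr ww.
have [N1 N10 ur] := angle_coords u r rho0.
have [N2 N20 uw] := angle_coords u w rho0.
have [N3 N30 rw] := angle_coords r w rho0.
rewrite /angle_le (crossC u r) (crossC r w).
have := upper_halfP rho0 u0; have := upper_halfP rho0 r0; have := upper_halfP rho0 w0.
have h1 : 0 < dot rho r * cross rho w - cross rho r * dot rho w by rewrite -rw mulr_gt0.
have sur : (0 <= cross u r) = (0 <= dot rho u * cross rho r - cross rho u * dot rho r).
  by rewrite -ur pmulr_rge0.
have suw : (0 <= cross u w) = (0 <= dot rho u * cross rho w - cross rho u * dot rho w).
  by rewrite -uw pmulr_rge0.
have sur' : (cross u r < 0) = (dot rho u * cross rho r - cross rho u * dot rho r < 0).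
  by rewrite !ltNge sur.
rewrite oppr_gt0 sur' sur suw.
move: (cross rho u) (cross rho r) (cross rho w) (dot rho u) (dot rho r) (dot rho w) h1 wr ww.
move=> qu qr qw pu pr pw h1 wr ww {sur sur' suw ur uw rw D0} hw hr hu.
have {}hr : upper_half rho r = false by case: hr => -[-> //] [|[]]; lra.
have {}hw : upper_half rho w.
  case: hw => -[-> //] hw; exfalso; have qw0 : qw = 0 by case: hw => [|[]]; lra.
  have pw0 : pw < 0 by lra.
  by move: h1; rewrite qw0 mulr0 sub0r -mulNr pmulr_rgt0; lra.
rewrite hr hw; case: hu => -[-> hu] /=; split=> //.
- by move=> uw; split=> //; exact: (wrap_lt h1).
- by rewrite -ltNge => ur; split=> //; exact: (wrap_le h1).
Qed.

End AngularOrder.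

(** * Potentials around one vertex *)

Section VertexPotential.
Context {R : realType} {V : zmodType}.
Variable Delta : {fset {fset 'rV[R]_2}}.
Hypothesis cx : simplicial_complex Delta.
Implicit Types (p q u v w x y z r rho : 'rV[R]_2) (sigma tau : {fset 'rV[R]_2}).
Local Notation K := (carrier Delta).

Lemma mem_neighbors v u : (u \in neighbors Delta v) = ([fset v; u] \in Delta) && (v != u).
Proof.
apply/idP/andP => [|[e vu]].
  rewrite /neighbors !inE /= cardfs2 => /andP[_ /andP[-> ]].
  by case: (v != u).
have : u \in vertices Delta.
  by rewrite mem_vertices; apply: (face_vertex cx e); rewrite !inE eqxx orbT.
by rewrite /neighbors !inE /= cardfs2 e vu andbT => ->.
Qed.

Lemma triangle_neighbors v w z : [fset v; w; z] \in faces Delta 2 ->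
  w \in neighbors Delta v /\ z \in neighbors Delta v.
Proof.
move=> s2; have [vw vz wz] := triangle_neq s2.
have sD : [fset v; w; z] \in Delta by move: s2; rewrite mem_faces => /andP[].
by rewrite !mem_neighbors vw vz !(face_edge cx sD) // !inE eqxx ?orbT.
Qed.

Lemma triangleC v w z : [fset v; w; z] = [fset v; z; w].
Proof. by apply/fsetP => u; rewrite !inE -!orbA; congr (_ || _); rewrite orbC. Qed.

(** A triangle is compared through its clockwise end, the vertex from which another one is reached
    by a left turn around v. Phrased with [has], this depends on the vertex set alone and not on a
    labelling. *)
Definition face_angle_le rho v u sigma : bool :=
  has (fun r => angle_le rho (u - v) (r - v) &&
    has (fun z => 0 < cross (r - v) (z - v)) sigma) sigma.

Lemma face_angle_leE rho v u w z : 0 < cross (w - v) (z - v) ->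
  face_angle_le rho v u [fset v; w; z] = angle_le rho (u - v) (w - v).
Proof.
move=> D0; apply/hasP/idP => [[r rs /andP[h /hasP[y ys ry]]]|h].
  suff <- : r = w by [].
  have D1 : cross (z - v) (w - v) < 0 by rewrite crossC oppr_lt0.
  have c0 q : cross (v - v) q = 0 by rewrite /cross !mxE; ring.
  have c0' q : cross q (v - v) = 0 by rewrite /cross !mxE; ring.
  move: rs ys; rewrite !inE -!orbA => /or3P[/eqP er|/eqP//|/eqP er].
    by move: ry; rewrite er c0 ltxx.
  move=> /or3P[/eqP ey|/eqP ey|/eqP ey]; move: ry; rewrite er ey ?c0' ?cross_self ?ltxx //.
  by move=> /lt_trans/(_ D1); rewrite ltxx.
exists w; first by rewrite !inE eqxx orbT.
by rewrite h; apply/hasP; exists z => //; rewrite !inE eqxx !orbT.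
Qed.

Variable J : 'rV[R]_2 -> 'rV[R]_2 -> V.

(** The potential of a triangle is the sum of the jumps over the edges met up to its clockwise side,
    counted from [rho]. Crossing the edge to [w] adds exactly its own jump. *)
Lemma vertex_potential v : [fset v] \in Delta ->
  (interior K v -> \sum_(u <- neighbors Delta v) J v u = 0) ->
  exists P : {fset 'rV[R]_2} -> V, forall w z z',
    [fset v; w; z] \in faces Delta 2 -> [fset v; w; z'] \in faces Delta 2 ->
    0 < cross (w - v) (z - v) -> cross (w - v) (z' - v) < 0 ->
    P [fset v; w; z] - P [fset v; w; z'] = J v w.
Proof.
move=> vD sumJ.
have Kv : K v by apply: mem_carrier vD _; apply: mem_realization; rewrite inE.
(* At an interior vertex any direction will do; at a frontier vertex [rho] is taken in no triangle,
   so that the sums never wrap around. *)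
have [rho rho0 hrho] : exists2 rho : 'rV[R]_2, rho != 0 & forall r w,
    [fset v; r; w] \in faces Delta 2 -> 0 < cross (r - v) (w - v) ->
    0 <= cross (r - v) rho /\ 0 <= cross rho (w - v) -> interior K v.
  have [iv|niv] := pselect (interior K v).
    exists (const_mx 1) => //; apply/eqP => /rowP/(_ 0)/eqP.
    by rewrite !mxE oner_eq0.
  have [rho rho0 h] := frontier_direction cx Kv niv.
  by exists rho => // r w s2 D0 c; case: (h r w s2 D0 c).
pose S r := \sum_(u <- neighbors Delta v | angle_le rho (u - v) (r - v)) J v u.
exists (fun sigma => \sum_(u <- neighbors Delta v | face_angle_le rho v u sigma) J v u).
move=> w z z' s2 s2' D0 D0'.
have D1 : 0 < cross (z' - v) (w - v) by rewrite crossC oppr_gt0.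
rewrite (triangleC v w z').
under eq_bigl => u do rewrite face_angle_leE //.
under [X in _ - X]eq_bigl => u do rewrite face_angle_leE //.
rewrite -/(S w) -/(S z').
have [wN _] := triangle_neighbors s2; have [_ zN] := triangle_neighbors s2'.
have [vw vz wz] := triangle_neq s2'.
have nz u : u \in neighbors Delta v -> u - v != 0.
  by rewrite mem_neighbors subr_eq0 eq_sym => /andP[].
have inw u : u \in neighbors Delta v ->
    0 < cross (z' - v) (u - v) /\ 0 <= cross (u - v) (w - v) -> u = w.
  rewrite mem_neighbors => /andP[eD vu] [c1 c2].
  by rewrite triangleC in s2'; apply: (edge_in_triangle cx s2').
(* If the triangle before [w] contains the start direction, its sum runs over all edges and
   vanishes, while the sum at [w] has a single term. *)
have [[wr ww]|nwrap] := pselect (0 < cross (z' - v) rho /\ 0 <= cross rho (w - v)).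
  have iv : interior K v.
    by rewrite triangleC in s2'; apply: (hrho _ _ s2' D1); split=> //; exact: ltW.
  have -> : S z' = 0.
    rewrite -(sumJ iv) /S big_seq_cond [RHS]big_seq; apply: eq_bigl => u.
    case: (boolP (u \in _)) => //= uN; apply: contraT => nu.
    have [_ h2 h3] := angle_wrap rho0 (nz _ uN) (nz _ zN) (nz _ wN) D1 wr ww.
    have uw := inw u uN (h2 nu); by rewrite uw h3 in nu.
  rewrite subr0 /S big_seq_cond (eq_bigl (pred1 w)).
    by rewrite -big_filter filter_pred1_uniq ?fset_uniq // big_seq1.
  move=> u /=; apply/andP/eqP => [[uN uw]|->]; last by rewrite wN angle_le_refl.
  have [h1 _ _] := angle_wrap rho0 (nz _ uN) (nz _ zN) (nz _ wN) D1 wr ww.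
  exact: inw (h1 uw).
have st u uN := angle_step rho0 (nz u uN) (nz _ zN) (nz _ wN) D1 nwrap.
rewrite /S big_mkcond (bigD1_seq w) ?fset_uniq //= angle_le_refl.
rewrite [X in _ - X]big_mkcond [X in _ - X](bigD1_seq w) ?fset_uniq //=.
have [_ _ /negbTE ->] := st w wN.
rewrite add0r -addrA -[RHS]addr0; congr (_ + _); apply/eqP; rewrite subr_eq0; apply/eqP.
rewrite big_seq_cond [RHS]big_seq_cond; apply: eq_bigr => u /andP[uN uw].
have [h1 h2 _] := st u uN.
case: (boolP (angle_le rho (u - v) (z' - v))) => [/h1 -> //|n1].
case: ifP => // /h2/(_ n1)/(inw u uN) e.
by rewrite e eqxx in uw.
Qed.

End VertexPotential.

(** * The topology of the disk *)

Section Topology.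
Context {R : realType}.
Implicit Types (p q u v w x y z : 'rV[R]_2).

(** The truth set is open and closed in the connected interval [0, 1]. *)
Lemma segment_locally_constant (Q : R -> Prop) :
  (forall t : R, 0 <= t <= 1 -> nbhs t (fun s : R => 0 <= s <= 1 -> (Q s <-> Q t))) ->
  Q 0 -> Q 1.
Proof.
move=> locQ Q0.
pose I : set R := [set t | 0 <= t <= 1]%classic.
pose B : set R := [set t | 0 <= t <= 1 /\ Q t]%classic.
have IE : I = `[0, 1]%classic by apply/seteqP; split=> t; rewrite /I /= in_itv.
have h : B = I.
  rewrite IE; apply: (@segment_connected R 0 1 B); rewrite -?IE.
  - by exists 0; split=> //; rewrite lexx ler01.
  - exists (interior (fun s : R => 0 <= s <= 1 -> Q s)); first exact: open_interior.
    apply/seteqP; split=> t /=.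
      by move=> [tI Qt]; split=> //; apply: filterS (locQ t tI) => s h /h ->.
    by move=> [tI /interior_subset h]; split=> //; exact: h.
  - exists (~` interior (fun s : R => 0 <= s <= 1 -> ~ Q s)).
      by apply: open_closedC; exact: open_interior.
    apply/seteqP; split=> t /=.
      by move=> [tI Qt]; split=> // /interior_subset/(_ tI).
    move=> [tI h]; split=> //; apply: contrapT => nQ; apply: h.
    by apply: filterS (locQ t tI) => s h' /h' ->.
have : I 1 by rewrite /I /= lexx ler01.
by rewrite -h => -[].
Qed.

Lemma within_cvg (A : set 'rV[R]_2) (f : 'rV[R]_2 -> 'rV[R]_2) x (N : set 'rV[R]_2) :
  {within A, continuous f} -> A x -> nbhs (f x) N -> nbhs x (fun y => A y -> N (f y)).
Proof. by move=> /subspace_continuousP/(_ x) h /h/(_ N). Qed.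

Lemma ball_convex (q a b : 'rV[R]_2) (e t : R) : 0 <= t <= 1 ->
  `|a - q| < e -> `|b - q| < e -> `|a + t *: (b - a) - q| < e.
Proof.
move=> /andP[t0 t1] ae be.
have -> : a + t *: (b - a) - q = (1 - t) *: (a - q) + t *: (b - q).
  by apply: rV2P; rewrite !mxE; ring.
apply: le_lt_trans (ler_normD _ _) _; rewrite !normrZ.
rewrite (ger0_norm t0) ger0_norm; last by lra.
have [->|tn0] := eqVneq t 0; first by rewrite subr0 mul1r mul0r addr0.
have tp : 0 < t by rewrite lt_neqAle eq_sym tn0.
have : 0 <= (1 - t) * (e - `|a - q|) by rewrite mulr_ge0; lra.
have : 0 < t * (e - `|b - q|) by rewrite mulr_gt0; lra.
lra.
Qed.

Lemma disk_convex a b (t : R) : 0 <= t <= 1 -> closed_disk a -> closed_disk b ->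
  closed_disk (a + t *: (b - a)).
Proof.
rewrite /closed_disk /= !mxE => /andP[t0 t1].
move: (a 0 0) (a 0 1) (b 0 0) (b 0 1) => x1 x2 y1 y2 h1 h2.
have e : (x1 + t * (y1 - x1)) ^+ 2 + (x2 + t * (y2 - x2)) ^+ 2 =
   (1 - t) * (x1 ^+ 2 + x2 ^+ 2) + t * (y1 ^+ 2 + y2 ^+ 2)
   - t * (1 - t) * ((x1 - y1) ^+ 2 + (x2 - y2) ^+ 2) by ring.
rewrite e; have t1' : 0 <= 1 - t by lra.
have := mulr_ge0 (mulr_ge0 t0 t1') (addr_ge0 (sqr_ge0 (x1 - y1)) (sqr_ge0 (x2 - y2))).
have h1' : 0 <= 1 - (x1 ^+ 2 + x2 ^+ 2) by lra.
have h2' : 0 <= 1 - (y1 ^+ 2 + y2 ^+ 2) by lra.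
have := mulr_ge0 t1' h1'; have := mulr_ge0 t0 h2'; lra.
Qed.

(** The points 0, (1, 0) and (0, 1) of the disk are not collinear. *)
Lemma disk_direction q (d : 'rV[R]_2) : d != 0 ->
  exists2 p, closed_disk p & cross (p - q) d != 0.
Proof.
move=> d0; apply: contrapT => h.
have c0 p : closed_disk p -> cross (p - q) d = 0.
  by move=> Dp; apply: contrapT => /eqP c; apply: h; exists p.
have h0 : cross (0 - q) d = 0 by apply: c0; rewrite /closed_disk /= !mxE expr0n /= addr0 ler01.
have h1 : cross (delta_mx 0 0 - q) d = 0.
  by apply: c0; rewrite /closed_disk /= !mxE /= expr1n expr0n /= addr0.
have h2 : cross (delta_mx 0 1 - q) d = 0.
  by apply: c0; rewrite /closed_disk /= !mxE /= expr1n expr0n /= add0r.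
move: h0 h1 h2; rewrite /cross !mxE /= => h0 h1 h2.
by move/eqP: d0; apply; apply: rV2P; rewrite mxE; lra.
Qed.

Lemma disk_ball_direction q (d : 'rV[R]_2) (e : R) : closed_disk q -> d != 0 -> 0 < e ->
  exists p, [/\ closed_disk p, `|p - q| < e & cross (p - q) d != 0].
Proof.
move=> Dq d0 e0; have [p Dp c] := disk_direction q d0.
have n0 : 0 <= `|p - q| by [].
pose t := e / (1 + `|p - q| + e).
have tE : t * (1 + `|p - q| + e) = e by rewrite /t divfK // gt_eqF //; lra.
have t0 : 0 < t by rewrite /t divr_gt0 //; lra.
have t1 : t <= 1 by rewrite /t ler_pdivrMr; lra.
exists (q + t *: (p - q)); rewrite [q + _]addrC addrK; split.
- by rewrite [_ + q]addrC; apply: disk_convex => //; rewrite (ltW t0).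
- by rewrite normrZ gtr0_norm //; nra.
- suff -> : cross (t *: (p - q)) d = t * cross (p - q) d by rewrite mulf_neq0 // gt_eqF.
  by rewrite /cross !mxE; ring.
Qed.

Section DiskLike.
Variable K : set 'rV[R]_2.
Variables f g : 'rV[R]_2 -> 'rV[R]_2.
Hypotheses (cf : {within K, continuous f}) (cg : {within (@closed_disk R), continuous g}).
Hypotheses (fK : forall x, K x -> closed_disk (f x) /\ g (f x) = x).
Hypotheses (gD : forall y, closed_disk y -> K (g y) /\ f (g y) = y).

Lemma disk_not_isolated x (N : set 'rV[R]_2) : K x -> nbhs x N ->
  exists y, [/\ K y, N y & y != x].
Proof.
move=> Kx; have [Dq gq] := fK Kx; rewrite -{1}gq => Nx.
have /nbhs_ballP[e /= e0 he] := within_cvg cg Dq Nx.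
have d0 : const_mx 1 != 0 :> 'rV[R]_2.
  by apply/eqP => /rowP/(_ 0)/eqP; rewrite !mxE oner_eq0.
have [p [Dp pe c]] := disk_ball_direction Dq d0 e0.
have [Kgp fgp] := gD Dp; exists (g p); split=> //.
  by apply: he Dp; rewrite -ball_normE /= distrC.
apply: contraNneq c => e1; have -> : p = f x by rewrite -fgp e1.
by rewrite subrr /cross !mxE !mul0r subr0.
Qed.

(** In disk coordinates a small ball around the point, intersected with the disk, is convex and not
    contained in a line, so it remains connected without its centre. Two closed sets that cover it
    and meet at most at the centre cannot share it. *)
Lemma disk_nonseparation x (A B : set 'rV[R]_2) : K x -> open (~` A) -> open (~` B) ->
  nbhs x (fun y => K y -> A y \/ B y) ->
  nbhs x (fun y => K y -> A y -> B y -> y = x) ->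
  nbhs x (fun y => K y -> y != x -> A y) \/ nbhs x (fun y => K y -> y != x -> B y).
Proof.
move=> Kx oA oB AB AIB; have [Dq gq] := fK Kx; set q := f x in Dq gq.
have N1 : nbhs x (fun y => (K y -> A y \/ B y) /\ (K y -> A y -> B y -> y = x)) by exact: filterI.
rewrite -[X in nbhs X _]gq in N1.
have /nbhs_ballP[e /= e0 he] := within_cvg cg Dq N1.
pose C a := [/\ closed_disk a, `|a - q| < e & a != q].
have hC a : C a -> (A (g a) \/ B (g a)) /\ ~ (A (g a) /\ B (g a)).
  move=> [Da ae aq]; have [Kga fga] := gD Da.
  have [|h1 h2] := he a _ Da; first by rewrite -ball_normE /= distrC.
  split; first exact: h1.
  move=> [Aa Ba]; have e1 := h2 Kga Aa Ba; move/eqP: aq; apply.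
  by rewrite -fga e1.
have hA a : C a -> (~ A (g a)) = B (g a).
  move=> /hC[AoB n]; apply/propext; split=> [nA|Ba Aa]; last exact: n.
  by case: AoB.
(* Along a segment that avoids q exactly one of the closed sets contains each point, so membership
   is locally constant. *)
have seg a b : C a -> C b -> (forall t, 0 <= t <= 1 -> a + t *: (b - a) != q) ->
    A (g a) -> A (g b).
  move=> Ca Cb nq Aa.
  have Ct t : 0 <= t <= 1 -> C (a + t *: (b - a)).
    move=> t01; case: Ca => Da ae _; case: Cb => Db be _; split; last exact: nq.
      exact: disk_convex.
    exact: ball_convex.
  have := @segment_locally_constant (fun t => A (g (a + t *: (b - a)))).
  rewrite scale0r addr0 scale1r [a + (b - a)]addrC subrK; apply=> // t t01.
  have cont (N : set 'rV[R]_2) : nbhs (g (a + t *: (b - a))) N ->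
      nbhs t (fun s : R => 0 <= s <= 1 -> N (g (a + s *: (b - a)))).
    move=> hN; have [Dt _ _] := Ct t t01.
    have h1 := within_cvg cg Dt hN.
    have h2 : (fun s : R => a + s *: (b - a)) @ t --> a + t *: (b - a).
      have h0 : (fun s : R => s *: (b - a)) @ t --> t *: (b - a).
        by apply: cvgZr_tmp; exact: cvg_id.
      exact: (cvgD (cvg_cst _) h0).
    have h3 : nbhs t (fun s : R => closed_disk (a + s *: (b - a)) -> N (g (a + s *: (b - a)))).
      exact: h2 _ h1.
    apply: filterS h3 => s hs s01; apply: hs.
    by have [] := Ct s s01.
  have [At|nAt] := pselect (A (g (a + t *: (b - a)))).
    have nB : (~` B) (g (a + t *: (b - a))).
      by move=> Bt; case: (hC _ (Ct t t01)) => _; apply.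
    have := cont _ (open_nbhs_nbhs (conj oB nB)).
    apply: filterS => s hs s01; split=> // _.
    by apply: contrapT; rewrite (hA _ (Ct s s01)); apply: hs.
  have := cont _ (open_nbhs_nbhs (conj oA nAt)).
  by apply: filterS => s hs s01; split=> // /(hs s01).
have conn a b : C a -> C b -> A (g a) -> A (g b).
  move=> Ca Cb; have [ab|ab] := eqVneq a b; first by rewrite ab.
  have [h|] := pselect (forall t, 0 <= t <= 1 -> a + t *: (b - a) != q); first exact: seg.
  move=> /existsNP[t /not_implyP[t01 /negP/negPn/eqP qE]].
  have d0 : b - a != 0 by rewrite subr_eq0 eq_sym.
  (* A segment through q is replaced by a detour over a point off its line. *)
  have [p [Dp pe c]] := disk_ball_direction Dq d0 e0.
  have pq : p != q.
    by apply: contraNneq c => ->; rewrite subrr /cross !mxE !mul0r subr0.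
  have Cp : C p by [].
  have avoid a' t' s : 0 <= t' <= 1 -> a' = a \/ a' = b -> a' != q ->
      (s = a' + t' *: (p - a') \/ s = p + t' *: (a' - p)) -> s != q.
    move=> t01' ha a'q hs; apply/eqP => sq.
    have [k [k0 kE]] : exists k : R, k != 0 /\ q - a' = k *: (p - a').
      case: hs => hs.
        exists t'; split; last by rewrite -sq hs addrC addKr.
        by apply: contraNneq a'q => t0; rewrite -sq hs t0 scale0r addr0.
      exists (1 - t'); split.
        rewrite subr_eq0; apply: contraNneq a'q => t1.
        by rewrite -sq hs -t1 scale1r addrC subrK.
      by rewrite -sq hs; apply: rV2P; rewrite !mxE; ring.
    have c1 : cross (q - a') (b - a) = 0.
      by case: ha => ->; rewrite -qE /cross !mxE; ring.
    have c2 : cross (q - a') (b - a) = k * (cross (p - q) (b - a) + cross (q - a') (b - a)).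
      by rewrite {1}kE /cross !mxE; ring.
    move: c2; rewrite c1 addr0 => /esym/eqP.
    by rewrite mulf_eq0 (negbTE k0) (negbTE c).
  have [_ _ aq] := Ca; have [_ _ bq] := Cb.
  move=> Aa; have Ap : A (g p).
    apply: (seg a) => // t' t01'; apply: (avoid a t') => //; by left.
  by apply: (seg p) => // t' t01'; apply: (avoid b t') => //; right.
have [p0 Cp0] : exists p0, C p0.
  have d0 : const_mx 1 != 0 :> 'rV[R]_2.
    by apply/eqP => /rowP/(_ 0)/eqP; rewrite !mxE oner_eq0.
  have [p [Dp pe c]] := disk_ball_direction Dq d0 e0; exists p; split=> //.
  by apply: contraNneq c => ->; rewrite subrr /cross !mxE !mul0r subr0.
have near_C : nbhs x (fun y => K y -> y != x -> C (f y)).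
  have hb : nbhs (f x) (ball (f x) e) by apply: nbhsx_ballx.
  apply: filterS (within_cvg cf Kx hb) => y hy Ky yx; have [Dy gy] := fK Ky.
  split=> //; first by have := hy Ky; rewrite -ball_normE /= distrC.
  by apply: contraNneq yx => e1; rewrite -gy e1 gq.
have [Ap|nAp] := pselect (A (g p0)); [left|right];
  apply: filterS near_C => y hy Ky yx; have Cy := hy Ky yx; have [_ gy] := fK Ky.
  by have := conn _ _ Cp0 Cy Ap; rewrite gy.
rewrite -gy -hA // => Ay; apply: nAp; exact: conn Cy Cp0 Ay.
Qed.

End DiskLike.
End Topology.

(** * Cocycles on the disk *)

Section DiskCocycle.
Context {R : realType} {V : zmodType}.
Implicit Types a b e : 'rV[R]_2.

Lemma disk_norm a : closed_disk a -> `|a| <= 1.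
Proof.
rewrite /closed_disk /= => Da; rewrite /Num.norm /= mx_normrE.
apply: bigmax_le => // -[i j] _ /=; rewrite ord1.
have h : a 0 j ^+ 2 <= 1.
  apply: le_trans Da; case: j => -[|[|//]] ij.
    rewrite (_ : Ordinal ij = 0); last exact: val_inj.
    by rewrite lerDl sqr_ge0.
  rewrite (_ : Ordinal ij = 1); last exact: val_inj.
  by rewrite lerDr sqr_ge0.
by rewrite -sqrtr_sqr -[X in _ <= X]sqrtr1 ler_wsqrtr.
Qed.

Lemma disk_compact : compact (@closed_disk R).
Proof.
apply: bounded_closed_compact.
  exists 1; split; first exact: num_real.
  by move=> M M1 a /disk_norm h; apply: le_trans h (ltW M1).
pose n (a : 'rV[R]_2) := a 0 0 * a 0 0 + a 0 1 * a 0 1.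
have cn : continuous n.
  move=> x; have h i : (fun y : 'rV[R]_2 => y 0 i) @ x --> x 0 i by exact: coord_continuous.
  exact: (cvgD (cvgM (h 0) (h 0)) (cvgM (h 1) (h 1))).
have -> : @closed_disk R = n @^-1` [set t : R | t <= 1]%classic.
  by apply/seteqP; split=> x; rewrite /closed_disk /n /= !expr2.
by apply: closed_comp; [move=> x _; exact: cn | exact: closed_le].
Qed.

(* The additive potential is obtained by summing [c] along the radii; sliding
   the radius of [a] to that of [b] shows that it does not depend on the path. *)
Lemma disk_cocycle (c : 'rV[R]_2 -> 'rV[R]_2 -> V) (eps : R) : 0 < eps ->
  (forall a0 a b e, closed_disk a0 -> closed_disk a -> closed_disk b -> closed_disk e ->
     `|a - a0| < eps -> `|b - a0| < eps -> `|e - a0| < eps -> c a b + c b e = c a e) ->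
  exists F : 'rV[R]_2 -> V, forall a b, closed_disk a -> closed_disk b ->
    `|b - a| < eps / 2 -> F b - F a = c a b.
Proof.
move=> eps0 hc.
(* Points of the disk have norm at most 1, so each of the N + 1 radial steps is shorter than eps /
   2. *)
have [N /= hN] : exists N : nat, 2 / eps < N.+1%:R.
  exists (Num.truncn (2 / eps)); exact: truncnS_gt.
have N0 : 0 < N.+1%:R :> R by rewrite ltr0n.
have hN' : N.+1%:R^-1 < eps / 2.
  by rewrite -[eps / 2]invrK ltf_pV2 ?posrE ?invr_gt0 ?divr_gt0 // invf_div.
pose r (i : nat) : R := i%:R / N.+1%:R.
have r01 i : (i <= N.+1)%N -> 0 <= r i <= 1.
  move=> iN; rewrite /r divr_ge0 ?ler0n //=.
  by rewrite ler_pdivrMr // mul1r ler_nat.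
have D0 : closed_disk (0 : 'rV[R]_2).
  by rewrite /closed_disk /= !mxE expr0n /= addr0 ler01.
have rD i a : (i <= N.+1)%N -> closed_disk a -> closed_disk (r i *: a).
  move=> /r01 iN Da; have := disk_convex iN D0 Da.
  by rewrite subr0 add0r.
have rS i a : closed_disk a -> `|r i.+1 *: a - r i *: a| < eps / 2.
  move=> /disk_norm na; rewrite -scalerBl normrZ.
  have -> : r i.+1 - r i = N.+1%:R^-1 by rewrite /r -mulrBl -natrB // subSnn mul1r.
  rewrite ger0_norm ?invr_ge0 ?ltW //; apply: le_lt_trans hN'.
  by rewrite -[X in _ <= X]mulr1 ler_wpM2l // invr_ge0 ltW.
exists (fun a => \sum_(i < N.+1) c (r i *: a) (r i.+1 *: a)) => a b Da Db ab.
have rab i : (i <= N.+1)%N -> `|r i *: b - r i *: a| < eps / 2.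
  move=> /r01/andP[h0 h1]; rewrite -scalerBr normrZ ger0_norm //.
  by apply: le_lt_trans ab; rewrite -[X in _ <= X]mul1r ler_wpM2r.
(* The two ways across the small quadrilateral between neighbouring radii give the same sum. *)
have step i : (i < N.+1)%N -> c (r i *: b) (r i.+1 *: b) - c (r i *: a) (r i.+1 *: a) =
    c (r i.+1 *: a) (r i.+1 *: b) - c (r i *: a) (r i *: b).
  move=> iN; have iN' := ltnW iN.
  have h0 : `|r i *: a - r i *: a| < eps by rewrite subrr normr0.
  have h1 : `|r i *: b - r i *: a| < eps by have := rab i iN'; lra.
  have h2 : `|r i.+1 *: a - r i *: a| < eps by have := rS i a Da; lra.
  have h3 : `|r i.+1 *: b - r i *: a| < eps.
    have -> : r i.+1 *: b - r i *: a = (r i.+1 *: b - r i.+1 *: a) + (r i.+1 *: a - r i *: a).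
      by rewrite addrA subrK.
    apply: le_lt_trans (ler_normD _ _) _.
    by have := rab i.+1 iN; have := rS i a Da; lra.
  have e1 := hc _ _ _ _ (rD i a iN' Da) (rD i a iN' Da) (rD i b iN' Db) (rD _ b iN Db) h0 h1 h3.
  have e2 := hc _ _ _ _ (rD i a iN' Da) (rD i a iN' Da) (rD _ a iN Da) (rD _ b iN Db) h0 h2 h3.
  have : c (r i *: a) (r i *: b) + c (r i *: b) (r i.+1 *: b) =
         c (r i *: a) (r i.+1 *: a) + c (r i.+1 *: a) (r i.+1 *: b) by rewrite e1 e2.
  move=> e12; apply/eqP; rewrite subr_eq addrAC eq_sym subr_eq addrC.
  by rewrite -e12 addrC.
rewrite -sumrB; under eq_bigr => i _ do rewrite step //.
rewrite -(big_mkord predT (fun i => c (r i.+1 *: a) (r i.+1 *: b) - c (r i *: a) (r i *: b))).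
rewrite telescope_sumr //.
have -> : r N.+1 = 1 by rewrite /r divff // gt_eqF.
have -> : r 0%N = 0 by rewrite /r mul0r.
rewrite !scale1r !scale0r.
(* The inner end of the telescope is [c 0 0], which additivity forces to be 0. *)
have h0 : `|0 - 0 : 'rV[R]_2| < eps by rewrite subrr normr0.
have /eqP := hc _ _ _ _ D0 D0 D0 D0 h0 h0 h0.
by rewrite -subr_eq0 addrK => /eqP ->; rewrite subr0.
Qed.

End DiskCocycle.

(** * Triangulated disks *)

Section DiskComplex.
Context {R : realType}.
Variable Delta : {fset {fset 'rV[R]_2}}.
Hypothesis cx : simplicial_complex Delta.
Implicit Types (p q u v w x y z r : 'rV[R]_2) (sigma tau : {fset 'rV[R]_2}).
Local Notation K := (carrier Delta).
Variables f g : 'rV[R]_2 -> 'rV[R]_2.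
Hypotheses (cf : {within K, continuous f}) (cg : {within (@closed_disk R), continuous g}).
Hypotheses (fK : forall x, K x -> closed_disk (f x) /\ g (f x) = x).
Hypotheses (gD : forall y, closed_disk y -> K (g y) /\ f (g y) = y).

Lemma realization_subset sigma tau x : sigma `<=` tau -> realization sigma x ->
  realization tau x.
Proof.
move=> /fsubsetP st [n [w [a [w0 w1 sa xE]]]]; exists n, w, a; split=> // i.
exact/st/sa.
Qed.

Lemma realization_convex sigma x y (t : R) : 0 <= t <= 1 -> realization sigma x ->
  realization sigma y -> realization sigma (x + t *: (y - x)).
Proof.
move=> /andP[t0 t1] /realizationP[a [a0 a1 ->]] /realizationP[b [b0 b1 ->]].
apply/realizationP; exists (fun v => (1 - t) * a v + t * b v); split.
- by move=> v vs; rewrite addr_ge0 // mulr_ge0 ?a0 ?b0 //; lra.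
- by rewrite big_split /= -!mulr_sumr a1 b1; lra.
- under [RHS]eq_bigr => v _ do rewrite scalerDl -!scalerA.
  rewrite big_split /= -!scaler_sumr scalerBl scale1r scalerBr.
  by rewrite -!addrA; congr (_ + _); rewrite addrC.
Qed.

(** Otherwise the carrier is a segment near the midpoint of the edge, and the midpoint separates it
    locally. *)
Lemma edge_in_some_triangle v w : v != w -> [fset v; w] \in Delta ->
  exists2 sigma, sigma \in faces Delta 2 & [fset v; w] `<=` sigma.
Proof.
move=> vw eD; apply: contrapT => h.
have nt sigma : sigma \in Delta -> v \in sigma -> w \in sigma -> sigma = [fset v; w].
  move=> sD vs ws; have [//|s2] := mem_face_edge cx sD vs ws vw.
  case: h; exists sigma => //.
  by apply/fsubsetP => u; rewrite !inE => /orP[] /eqP ->.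
pose x := v + 2^-1 *: (w - v).
have h01 : 0 < (2^-1 : R) < 1 by apply/andP; split; lra.
have ex : realization [fset v; w] x.
  by apply/(realization2P _ vw); exists 2^-1; split=> //; lra.
have near_e : nbhs x (fun y => K y -> realization [fset v; w] y).
  apply: filterS (near_faces cx x) => y hy [sigma /= sD sy].
  have [vs ws] := edge_point cx vw eD sD h01 (hy _ sD sy).
  by rewrite -(nt _ sD vs ws).
(* A signed position along the edge; its two sign conditions are the closed sets for the separation
   argument. *)
pose phi y := dot (w - v) (y - x).
have phi_half (s : R) : phi (x + s *: (w - v)) = s * dot (w - v) (w - v).
  by rewrite /phi /dot !mxE; ring.
have dd : 0 < dot (w - v) (w - v).
  rewrite /dot -!expr2 lt_neqAle addr_ge0 ?sqr_ge0 // andbT eq_sym paddr_eq0 ?sqr_ge0 //.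
  rewrite !sqrf_eq0; apply: contraNN vw => /andP[/eqP p0 /eqP p1].
  by apply/eqP; apply: rV2P; move: p0 p1; rewrite !mxE; lra.
have onE y : realization [fset v; w] y -> exists s : R, y = x + s *: (w - v).
  move=> /(realization2P _ vw)[t [_ _ ->]]; exists (t - 2^-1).
  by rewrite /x -addrA -scalerDl addrC [2^-1 + _]addrC subrK addrC.
pose q : 'rV[R]_2 := \row_j (if j == 0 then (w - v) 0 1 else - (w - v) 0 0).
have phiE y : phi y = cross q (y - x).
  by rewrite /phi /dot /cross !mxE /=; ring.
have phiN y : - phi y = cross (- q) (y - x).
  by rewrite /phi /dot /cross !mxE /=; ring.
have oA : open (~` [set y | 0 <= phi y]%classic).
  rewrite openE => y /= /negP; rewrite -ltNge => py.
  have : 0 < cross (- q) (y - x) by rewrite -phiN; lra.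
  by move=> /near_cross_gt0; apply: filterS => y' /=; rewrite -phiN => h' h''; lra.
have oB : open (~` [set y | phi y <= 0]%classic).
  rewrite openE => y /= /negP; rewrite -ltNge phiE => /near_cross_gt0.
  by apply: filterS => y' /=; rewrite -phiE => h' h''; lra.
have Kx : K x by exact: mem_carrier ex.
have AB : nbhs x (fun y => K y -> 0 <= phi y \/ phi y <= 0).
  by apply: filterE => y _; apply/orP; exact: le_total.
have AIB : nbhs x (fun y => K y -> 0 <= phi y -> phi y <= 0 -> y = x).
  apply: filterS near_e => y hy Ky h1 h2; have [s yE] := onE y (hy Ky).
  have : phi y = 0 by apply/eqP; rewrite eq_le h1 h2.
  rewrite yE phi_half => /eqP; rewrite mulf_eq0 (gt_eqF dd) orbF => /eqP ->.
  by rewrite scale0r addr0.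
have pt (s : R) : s != 0 -> - 2^-1 <= s <= 2^-1 -> K (x + s *: (w - v)) /\ x + s *: (w - v) != x.
  move=> s0 /andP[s1 s2]; split.
    apply: (mem_carrier eD); apply/(realization2P _ vw); exists (2^-1 + s).
    by split; [lra|lra|rewrite /x -addrA -scalerDl].
  rewrite -subr_eq0 [x + _]addrC addrK scaler_eq0 (negbTE s0) subr_eq0 /=.
  by rewrite eq_sym.
have half0 : 0 < (2^-1 : R) by lra.
case: (disk_nonseparation cf cg fK gD Kx oA oB AB AIB) => /near_shift h1.
  have [s [hs /andP[s0 s1]]] := filter_ex (filterI (h1 (- (w - v))) (near0_right_lt half0)).
  have [||Ks xs] := pt (- s); [lra|by apply/andP; split; lra|].
  rewrite scalerN -scaleNr in hs.
  by have := hs Ks xs; rewrite /= phi_half; nra.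
have [s [hs /andP[s0 s1]]] := filter_ex (filterI (h1 (w - v)) (near0_right_lt half0)).
have [||Ks xs] := pt s; [lra|by apply/andP; split; lra|].
by have := hs Ks xs; rewrite /= phi_half; nra.
Qed.

(** For a vertex: it is not isolated in the disk, and a nearby point lies on a larger face through
    it. *)
Lemma face_in_triangle sigma : sigma \in Delta ->
  exists2 sigma', sigma' \in faces Delta 2 & sigma `<=` sigma'.
Proof.
move=> sD; have /fset0Pn[v vs] := face_neq0 cx sD.
have two w : w \in sigma -> v != w ->
    exists2 sigma', sigma' \in faces Delta 2 & sigma `<=` sigma'.
  move=> ws vw; have [sE|s2] := mem_face_edge cx sD vs ws vw; last by exists sigma.
  by rewrite sE; apply: edge_in_some_triangle => //; rewrite -sE.
have [[w ws vw]|nw] := pselect (exists2 w, w \in sigma & v != w); first exact: two ws vw.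
have sE : sigma = [fset v].
  apply/fsetP => u; rewrite inE; apply/idP/eqP => [us|-> //].
  by apply: contrapT => uv; apply: nw; exists u => //; rewrite eq_sym; apply/eqP.
have Kv : K v by apply: (mem_carrier sD); apply: mem_realization.
have [y [Ky hy yv]] := disk_not_isolated cg fK gD Kv (near_faces cx v).
have [tau /= tD ty] := Ky; have vt := vertex_point cx _ tD (hy _ tD ty).
have {}vt : v \in tau by apply: vt; rewrite -sE.
have [[w wt vw]|nw'] := pselect (exists2 w, w \in tau & v != w); last first.
  case/eqP: yv; apply: realization_vertex; apply: realization_subset ty.
  apply/fsubsetP => u ut; rewrite inE; apply: contrapT => /negP uv.
  by apply: nw'; exists u => //; rewrite eq_sym.
have [sigma' s2 /fsubsetP sub] := edge_in_some_triangle vw (face_edge cx tD vt wt).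
by exists sigma' => //; rewrite sE fsub1set; apply: sub; rewrite !inE eqxx.
Qed.

Lemma carrier_triangle x : K x -> exists2 sigma, sigma \in faces Delta 2 & realization sigma x.
Proof.
move=> [tau /= tD tx]; have [sigma s2 ts] := face_in_triangle tD.
by exists sigma => //; apply: realization_subset tx.
Qed.

Lemma faces_sub sigma i : sigma \in faces Delta i -> sigma \in Delta.
Proof. by rewrite mem_faces => /andP[]. Qed.

(** The triangles at v that satisfy [C] and those that do not form two closed sets covering a
    neighbourhood of v. If they met only at v, then v would separate the disk locally. *)
Lemma fan_connected v (C : {fset 'rV[R]_2} -> Prop) sigma0 :
  sigma0 \in faces Delta 2 -> v \in sigma0 -> C sigma0 ->
  (forall sigma sigma' w, sigma \in faces Delta 2 -> sigma' \in faces Delta 2 ->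
     v \in sigma -> v \in sigma' -> w \in sigma -> w \in sigma' -> v != w ->
     C sigma -> C sigma') ->
  forall sigma, sigma \in faces Delta 2 -> v \in sigma -> C sigma.
Proof.
move=> s02 vs0 C0 adj sigma s2 vs; apply: contrapT => nC.
have vD : [fset v] \in Delta := face_vertex cx (faces_sub s02) vs0.
have Kv : K v by apply: (mem_carrier vD); apply: mem_realization; rewrite inE.
pose U (X : {fset 'rV[R]_2} -> Prop) : set 'rV[R]_2 := [set y | exists tau,
  [/\ tau \in faces Delta 2, v \in tau, X tau & realization tau y]]%classic.
have oU X : open (~` U X).
  rewrite openE => y ny; apply: filterS (near_faces cx y) => y' hy' [tau [t2 vt Xt ty]].
  by apply: ny; exists tau; split=> //; apply: hy' ty; exact: faces_sub t2.
have AB : nbhs v (fun y => K y -> U C y \/ U (fun tau => ~ C tau) y).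
  apply: filterS (near_faces cx v) => y hy [tau /= tD ty].
  have vt := vertex_point cx vD tD (hy _ tD ty).
  have [tau' t2 sub] := face_in_triangle tD.
  have vt' := fsubsetP sub _ vt; have ty' := realization_subset sub ty.
  by have [Ct|nCt] := pselect (C tau'); [left|right]; exists tau'.
have AIB : forall y, U C y -> U (fun tau => ~ C tau) y -> y = v.
  move=> y [tau [t2 vt Ct ty]] [tau' [t2' vt' nCt ty']].
  have := realizationI cx (faces_sub t2) (faces_sub t2') ty ty'.
  (* A second common vertex would be an edge through v, along which [C] propagates. *)
  have -> : tau `&` tau' = [fset v].
    apply/fsetP => u; rewrite !inE; apply/andP/eqP => [[ut ut']|->]; last by split.
    apply: contrapT => /eqP uv; apply: nCt; apply: (adj tau tau' u) => //.
    by rewrite eq_sym.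
  exact: realization_vertex.
have pt tau (N : set 'rV[R]_2) : tau \in faces Delta 2 -> v \in tau -> nbhs v N ->
    exists y, [/\ realization tau y, N y & y != v].
  move=> t2 vt hN; have [w [z [tE D0]]] := triangle_at cx t2 vt.
  have [h [hN' /andP[h0 h1]]] := filter_ex (filterI (near_shift hN (w - v)) (near0_right_lt (@ltr01 R))).
  rewrite tE in t2 *; exists (v + h *: (w - v)); split=> //.
    apply/(realization_triangle _ t2).
    by exists h, 0; split; [exact: ltW|by []|rewrite addr0 ltW|rewrite scale0r addr0].
  rewrite -subr_eq0 [v + _]addrC addrK scaler_eq0 gt_eqF //= subr_eq0.
  by have [] := triangle_neq t2; rewrite eq_sym.
have AIB' : nbhs v (fun y => K y -> U C y -> U (fun tau => ~ C tau) y -> y = v).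
  by apply: filterE => y _; exact: AIB.
case: (disk_nonseparation cf cg fK gD Kv (oU _) (oU _) AB AIB') => h.
  have [y [sy hy yv]] := pt _ _ s2 vs h.
  have Uy := hy (mem_carrier (faces_sub s2) sy) yv.
  by case/eqP: yv; apply: AIB Uy _; exists sigma.
have [y [sy hy yv]] := pt _ _ s02 vs0 h.
have Uy := hy (mem_carrier (faces_sub s02) sy) yv.
by case/eqP: yv; apply: AIB _ Uy; exists sigma0.
Qed.

(** * Gluing the vertex potentials *)

Section Potential.
Context {V : zmodType}.
Variable J : 'rV[R]_2 -> 'rV[R]_2 -> V.
Hypothesis JC : forall v w, J w v = - J v w.
Hypothesis sumJ : forall v, v \in interior_vertices Delta ->
  \sum_(u <- neighbors Delta v) J v u = 0.

Lemma interior_vertexE v : (v \in interior_vertices Delta) <->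
  [fset v] \in Delta /\ interior K v.
Proof.
have rv x : realization [fset v] x <-> x = v.
  by split=> [/realization_vertex|->] //; apply: mem_realization; rewrite inE.
rewrite /interior_vertices /interior_faces; split.
  rewrite inE => /andP[]; rewrite mem_vertices => vD.
  rewrite inE => /andP[_ /asboolP h]; split=> //.
  apply: contrapT => nv; apply: h => x /rv ->; split=> //.
  by apply: (mem_carrier vD); apply/rv.
move=> [vD iv]; have := mem_vertices Delta v; rewrite vD !inE /= vD cardfs1 eqxx /= andbT.
by move=> -> /=; apply/asboolP => /(_ v)[|//]; apply/rv.
Qed.

(** Choose a triangle [T x] at each point. Differences of vertex potentials between [T x] and [T y]
    are additive for nearby points, hence come from a function [H] on the disk, which plays the role
    of the potential of [T x]. *)
Lemma triangle_potential : exists F : {fset 'rV[R]_2} -> V, forall v w z z',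
  [fset v; w; z] \in faces Delta 2 -> [fset v; w; z'] \in faces Delta 2 ->
  0 < cross (w - v) (z - v) -> cross (w - v) (z' - v) < 0 ->
  F [fset v; w; z] - F [fset v; w; z'] = J v w.
Proof.
have /choice[P hP] : forall v, exists P : {fset 'rV[R]_2} -> V, [fset v] \in Delta ->
    forall w z z', [fset v; w; z] \in faces Delta 2 -> [fset v; w; z'] \in faces Delta 2 ->
    0 < cross (w - v) (z - v) -> cross (w - v) (z' - v) < 0 ->
    P [fset v; w; z] - P [fset v; w; z'] = J v w.
  move=> v; have [vD|nv] := pselect ([fset v] \in Delta); last by exists (fun=> 0).
  have [|P hP] := @vertex_potential R V Delta cx J v vD; last by exists P.
  by move=> iv; apply: sumJ; apply/interior_vertexE.
(* Seen from [w] the sides of the edge are exchanged, and [J w v] has the opposite sign: both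
   potentials have the same difference. *)
have cons v w sigma sigma' : sigma \in faces Delta 2 -> sigma' \in faces Delta 2 ->
    v \in sigma -> v \in sigma' -> w \in sigma -> w \in sigma' ->
    P v sigma - P v sigma' = P w sigma - P w sigma'.
  move=> s2 s2' vs vs' ws ws'.
  have [->|vw] := eqVneq v w; first by [].
  have [->|ss'] := eqVneq sigma sigma'; first by rewrite !subrr.
  have vD := face_vertex cx (faces_sub s2) vs; have wD := face_vertex cx (faces_sub s2) ws.
  have [z [vz wz sE _]] := triangleP cx s2 vs ws vw.
  have [z' [vz' wz' sE' _]] := triangleP cx s2' vs' ws' vw.
  have swap u : [fset v; w; u] = [fset w; v; u].
    by apply/fsetP => x; rewrite !inE; congr (_ || _); rewrite orbC.
  have cs u : cross (v - w) (u - w) = - cross (w - v) (u - v).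
    by rewrite /cross !mxE; ring.
  rewrite sE sE' in s2 s2' ss' *; have DD := opposite_sides cx s2 s2' ss'.
  have s2w := s2; have s2w' := s2'; rewrite !swap in s2w s2w'.
  have main y y' : [fset v; w; y] \in faces Delta 2 -> [fset v; w; y'] \in faces Delta 2 ->
      0 < cross (w - v) (y - v) -> cross (w - v) (y' - v) < 0 ->
      P v [fset v; w; y] - P v [fset v; w; y'] = P w [fset v; w; y] - P w [fset v; w; y'].
    move=> h h' D0 D0'; rewrite (hP v vD w y y' h h' D0 D0') !swap.
    rewrite !swap in h h'.
    have := hP w wD v y' y h' h; rewrite !cs oppr_gt0 oppr_lt0 => /(_ D0' D0).
    by rewrite JC => /eqP; rewrite eq_sym eqr_oppLR opprB => /eqP ->.
  have [D0|D0] := ltrP 0 (cross (w - v) (z - v)).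
    by apply: main => //; nra.
  have B0 : 0 < cross (w - v) (z' - v).
    rewrite ltNge; apply/negP => B0; have := mulr_le0 D0 B0; lra.
  have A0 : cross (w - v) (z - v) < 0.
    by rewrite lt_neqAle D0 andbT; apply: contraTN DD => /eqP ->; rewrite mul0r ltxx.
  have /eqP := main z' z s2' s2 B0 A0.
  by rewrite -eqr_opp !opprB => /eqP.
have /choice[T hT] : forall x, exists sigma, K x ->
    sigma \in faces Delta 2 /\ realization sigma x.
  move=> x; have [Kx|nK] := pselect (K x); last by exists fset0.
  by have [sigma s2 sx] := carrier_triangle Kx; exists sigma.
have /choice[cv hcv] : forall x, exists v, K x ->
    forall sigma, sigma \in Delta -> realization sigma x -> v \in sigma.
  move=> x; have [Kx|nK] := pselect (K x); last by exists 0.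
  by have [v _ hv] := common_vertex cx Kx; exists v.
(* By [cons] the value does not depend on the common vertex; points whose triangles share no vertex
   get an arbitrary value. *)
have /choice[c hc] : forall xy : 'rV[R]_2 * 'rV[R]_2, exists e : V, K xy.1 -> K xy.2 ->
    forall v, v \in T xy.1 -> v \in T xy.2 -> e = P v (T xy.2) - P v (T xy.1).
  move=> [x y] /=; have [[v [Kx Ky vx vy]]|h] := pselect (exists v,
      [/\ K x, K y, v \in T x & v \in T y]).
    exists (P v (T y) - P v (T x)) => _ _ w wx wy.
    by apply: cons => //; [have [] := hT y Ky | have [] := hT x Kx].
  by exists 0 => Kx Ky v vx vy; case: h; exists v.
(* A Lebesgue number: by compactness one radius eps works at every point of the disk, and all
   triangles chosen within it share a vertex. *)
have [eps eps0 heps] : exists2 eps : R, 0 < eps & forall a, closed_disk a ->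
    exists v, forall b, closed_disk b -> `|b - a| < eps -> v \in T (g b).
  have hcov : near_covering (@closed_disk R).
    by apply/compact_near_coveringP; exact: disk_compact.
  pose Q (e : R) a := exists v, forall b, closed_disk b -> `|b - a| < e -> v \in T (g b).
  suff hQ : forall a, closed_disk a ->
      filter_prod (nbhs a) (0^'+) (fun ae : 'rV[R]_2 * R => Q ae.2 ae.1).
    have h : \forall e \near (0 : R)^'+, forall a, closed_disk a -> Q e a.
      by apply: (hcov R (0^'+) Q _ hQ).
    have [e [he e0]] : exists e : R, (forall a, closed_disk a -> Q e a) /\ 0 < e.
      by apply: (filter_ex (F := (0 : R)^'+)); apply: filterI => //; exact: nbhs_right_gt.
    by exists e.
    move=> a Da; have [Kga _] := gD Da.
    have n1 : nbhs a (fun b => closed_disk b -> cv (g a) \in T (g b)).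
      apply: filterS (within_cvg cg Da (near_faces cx (g a))) => b hb Db.
      have [Kgb _] := gD Db; have [t2 tb] := hT _ Kgb.
      by apply: hcv => //; [exact: faces_sub t2 | apply: hb => //; exact: faces_sub t2].
    have /nbhs_ballP[d /= d0 hd] := n1.
    exists (ball a (d / 2), [set e | e < d / 2]%classic) => /=.
      split; first by apply: nbhsx_ballx; rewrite divr_gt0.
      by apply: nbhs_right_lt; rewrite divr_gt0.
    move=> [a' e] [/= ha' he]; exists (cv (g a)) => b Db ba'.
    apply: hd => //; rewrite -ball_normE /=; move: ha'; rewrite -ball_normE /= => ha'.
    have -> : a - b = (a - a') - (b - a') by rewrite opprB addrA subrK.
    by apply: le_lt_trans (ler_normB _ _) _; lra.
have [H hH] : exists F : 'rV[R]_2 -> V, forall a b, closed_disk a -> closed_disk b ->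
    `|b - a| < eps / 2 -> F b - F a = c (g a, g b).
  apply: (disk_cocycle eps0) => a0 a b e D0 Da Db De ha hb he.
  have [v hv] := heps a0 D0.
  have [Ka _] := gD Da; have [Kb _] := gD Db; have [Ke _] := gD De.
  rewrite (hc (g a, g b) Ka Kb v) ?hv // (hc (g b, g e) Kb Ke v) ?hv //.
  rewrite (hc (g a, g e) Ka Ke v) ?hv //=.
  by rewrite addrC addrA subrK.
(* The value on [sigma] as computed from a point x of it: [H] at x, corrected by the difference
   between [sigma] and [T x]. It is locally constant on [sigma], hence constant. *)
pose Psi x sigma := H (f x) + P (cv x) sigma - P (cv x) (T x).
have PsiE x sigma v : K x -> sigma \in faces Delta 2 -> realization sigma x ->
    v \in sigma -> v \in T x -> Psi x sigma = H (f x) + P v sigma - P v (T x).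
  move=> Kx s2 sx vs vT; rewrite /Psi -!addrA; congr (_ + _).
  have [t2 tx] := hT x Kx.
  by apply: cons => //; apply: hcv => //; [exact: faces_sub s2 | exact: faces_sub t2].
have Psi_loc x sigma : sigma \in faces Delta 2 -> realization sigma x ->
    nbhs x (fun y => realization sigma y -> Psi y sigma = Psi x sigma).
  move=> s2 sx; have sD := faces_sub s2; have Kx := mem_carrier sD sx.
  have [Df gf] := fK Kx; have [t2 tx] := hT x Kx.
  have e2 : 0 < eps / 2 by rewrite divr_gt0.
  have hb : nbhs (f x) (ball (f x) (eps / 2)) by apply: nbhsx_ballx.
  apply: filterS (filterI (within_cvg cf Kx hb) (near_faces cx x)) => y [hy1 hy2] sy.
  have Ky := mem_carrier sD sy; have [Df' gf'] := fK Ky; have [t2' ty'] := hT y Ky.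
  have vs : cv x \in sigma by apply: hcv.
  have vT : cv x \in T x by apply: hcv => //; exact: faces_sub t2.
  have vT' : cv x \in T y.
    by apply: hcv => //; [exact: faces_sub t2' | apply: hy2 => //; exact: faces_sub t2'].
  rewrite (PsiE y sigma (cv x)) // /Psi.
  have := hH (f x) (f y) Df Df'; rewrite gf gf' (hc (x, y) Kx Ky (cv x)) //=.
  have := hy1 Ky; rewrite -ball_normE /= distrC => h /(_ h)/eqP.
  rewrite subr_eq => /eqP ->.
  by rewrite addrC !addrA addNr add0r -addrA addrC.
have Psi_const x y sigma : sigma \in faces Delta 2 -> realization sigma x ->
    realization sigma y -> Psi y sigma = Psi x sigma.
  move=> s2 sx sy.
  have := @segment_locally_constant R (fun t => Psi (x + t *: (y - x)) sigma = Psi x sigma).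
  rewrite scale0r addr0 scale1r [x + (y - x)]addrC subrK; apply=> // t t01.
  have h2 : (fun s : R => x + s *: (y - x)) @ t --> x + t *: (y - x).
    have h0 : (fun s : R => s *: (y - x)) @ t --> t *: (y - x).
      by apply: cvgZr_tmp; exact: cvg_id.
    exact: (cvgD (cvg_cst _) h0).
  have h3 : nbhs t (fun s : R => realization sigma (x + s *: (y - x)) ->
      Psi (x + s *: (y - x)) sigma = Psi (x + t *: (y - x)) sigma).
    exact: h2 _ (Psi_loc _ _ s2 (realization_convex t01 sx sy)).
  by apply: filterS h3 => s hs s01; rewrite hs //; exact: realization_convex.
have /choice[pt hpt] : forall sigma, exists x, sigma \in faces Delta 2 -> realization sigma x.
  move=> sigma; have [s2|] := pselect (sigma \in faces Delta 2); last by exists 0.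
  have /fset0Pn[v vs] := face_neq0 cx (faces_sub s2).
  by exists v => _; apply: mem_realization.
exists (fun sigma => Psi (pt sigma) sigma) => v w z z' s2 s2' D0 D0'.
have sv : realization [fset v; w; z] v by apply: mem_realization; rewrite !inE eqxx.
have sv' : realization [fset v; w; z'] v by apply: mem_realization; rewrite !inE eqxx.
rewrite (Psi_const _ _ _ s2 sv (hpt _ s2)) (Psi_const _ _ _ s2' sv' (hpt _ s2')).
have vD : [fset v] \in Delta.
  by apply: (face_vertex cx (faces_sub s2)); rewrite !inE eqxx.
have Kv := mem_carrier (faces_sub s2) sv.
(* Both triangles contain v, and at x = v the only possible common vertex is v itself; the
   contributions of [H] cancel. *)
have cvv : cv v = v.
  apply/eqP; rewrite -in_fset1; apply: hcv => //.
  by apply: mem_realization; rewrite inE.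
rewrite /Psi cvv -(hP v vD w z z' s2 s2' D0 D0').
by rewrite opprB addrA subrK [H _ + _]addrC opprD addrA addrK.
Qed.

End Potential.
End DiskComplex.

(** * Splines from polynomials *)

Section PolynomialCalculus.
Context {R : realType} {n : nat}.
Implicit Types (q : {mpoly R[n]}) (a v : 'rV[R]_n).

Lemma is_derive_cvg (f : 'rV[R]_n -> R) a v (df : R) :
  (fun h : R => h^-1 *: (f (h *: v + a) - f a)) @ 0^' --> df -> is_derive a v f df.
Proof.
move=> h; apply: DeriveDef; first by apply: cvgP h.
exact: cvg_lim.
Qed.

Lemma is_derive_coord a i j :
  is_derive a (delta_mx 0 i : 'rV[R]_n) (fun x : 'rV[R]_n => x 0 j) ((i == j)%:R : R).
Proof.
apply: is_derive_cvg; apply: cvg_near_cst.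
near=> h; have h0 : h != 0 by near: h; exact: nbhs_dnbhs_neq.
by rewrite !mxE eqxx /= addrK eq_sym /GRing.scale /= mulrA mulVf // mul1r.
Unshelve. all: by end_near.
Qed.

Lemma mpoly_closure (P : {mpoly R[n]} -> Prop) :
  (forall c, P (mpolyC n c)) -> (forall i, P (mpolyX R (mnm1 i))) ->
  (forall p q, P p -> P q -> P (p + q)) -> (forall p q, P p -> P q -> P (p * q)) ->
  forall q, P q.
Proof.
move=> PC PX PD PM q; rewrite (mpolyE q).
elim: (msupp q : seq _) => [|m ms IH]; first by rewrite big_nil -mpolyC0.
rewrite big_cons; apply: (PD) => //; rewrite -mul_mpolyC; apply: (PM) => //.
rewrite mpolyXE_id; elim: (index_enum _) => [|i s IHs].
  by rewrite big_nil -mpolyC1.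
rewrite big_cons; apply: (PM) => //; elim: (m i) => [|k IHk]; first by rewrite expr0 -mpolyC1.
by rewrite exprS; apply: (PM).
Qed.

Lemma peval_continuous q : continuous (peval q).
Proof.
move: q; apply: mpoly_closure => [c|i|p q hp hq|p q hp hq] x.
- have -> : peval (mpolyC n c) = cst c by apply/funext => y; exact: mevalC.
  exact: cst_continuous.
- have -> : peval (mpolyX R (mnm1 i)) = (fun y : 'rV[R]_n => y 0 i).
    by apply/funext => y; exact: mevalXU.
  exact: coord_continuous.
- have -> : peval (p + q) = (fun y => peval p y + peval q y).
    by apply/funext => y; exact: pevalD.
  exact: (cvgD (hp x) (hq x)).
- have -> : peval (p * q) = (fun y => peval p y * peval q y).
    by apply/funext => y; exact: pevalM.
  exact: (cvgM (hp x) (hq x)).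
Qed.

Lemma peval_is_derive q a i :
  is_derive a (delta_mx 0 i : 'rV[R]_n) (peval q) (peval (mderiv i q) a).
Proof.
move: q a; apply: mpoly_closure => [c|j|p q hp hq|p q hp hq] a.
- have -> : peval (mpolyC n c) = cst c by apply/funext => y; exact: mevalC.
  by rewrite mderivC /peval meval0; exact: is_derive_cst.
- have -> : peval (mpolyX R (mnm1 j)) = (fun y : 'rV[R]_n => y 0 j).
    by apply/funext => y; exact: mevalXU.
  have -> : peval (mderiv i (mpolyX R (mnm1 j))) a = (i == j)%:R.
    rewrite mderivX /peval mevalZ mnm1E eq_sym; case: eqP => [->|_].
      rewrite (_ : mnm_sub _ _ = @mnm0 n) ?mpolyX0 ?meval1 ?mulr1 //.
      by apply/mnmP => k; rewrite mnmBE mnm0E subnn.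
    by rewrite mul0r.
  exact: is_derive_coord.
- have -> : peval (p + q) = (peval p + peval q).
    by apply/funext => y; exact: pevalD.
  by rewrite mderivD pevalD; apply: is_deriveD.
- have -> : peval (p * q) = (peval p * peval q).
    by apply/funext => y; exact: pevalM.
  have := is_deriveM (hp a) (hq a); congr (is_derive _ _ _ _).
  by rewrite mderivM pevalD !pevalM addrC /GRing.scale /= [peval q a * _]mulrC.
Qed.

End PolynomialCalculus.

Section SplineSpace.
Context {R : realType}.
Variable Delta : {fset {fset 'rV[R]_2}}.
Hypothesis cx : simplicial_complex Delta.
Implicit Types (u v w x y z : 'rV[R]_2) (sigma tau : {fset 'rV[R]_2}).
Local Notation K := (carrier Delta).

Lemma Cr_on_linear r (a : R) (f1 f2 : K -> R^o) : Cr_on r f1 -> Cr_on r f2 ->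
  Cr_on r (a *: f1 + f2 : K -> R^o).
Proof.
move=> [g1 [e1 c1 d1]] [g2 [e2 c2 d2]].
exists (fun i j => a \*: g1 i j + g2 i j); split.
- by move=> x; rewrite -[LHS]/(a * g1 0%N 0%N (val x) + g2 0%N 0%N (val x)) e1 e2.
- move=> i j ij x.
  exact: (cvgD (cvgM (cvg_cst a) (c1 i j ij x)) (c2 i j ij x)).
- move=> i j p ij ip; have [d10 d11] := d1 i j p ij ip; have [d20 d21] := d2 i j p ij ip.
  by split; apply: is_deriveD.
Qed.

Lemma Cr_on0 r : Cr_on r (0 : K -> R^o).
Proof.
exists (fun _ _ => cst 0); split=> //.
- by move=> i j _ x; exact: cvg_cst.
- by move=> i j p _ _; split; exact: is_derive_cst.
Qed.

Lemma linear_subspace_splines r s d : linear_subspace (splines Delta r s d).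
Proof.
split.
  split; first exact: Cr_on0.
  exists (fun=> 0); split=> [sigma _|v _ sigma sigma' _ _ _ _ m _].
    by rewrite mmeasure0; split=> // x _; rewrite /peval meval0.
  by rewrite linear0 /peval meval0.
move=> a f1 f2 [C1 [p1 [h1 v1]]] [C2 [p2 [h2 v2]]]; split; first exact: Cr_on_linear.
exists (fun sigma => a *: p1 sigma + p2 sigma); split.
  move=> sigma s2; have [m1 e1] := h1 sigma s2; have [m2 e2] := h2 sigma s2; split.
    apply: leq_trans (mmeasureD_le _ _ _) _; rewrite geq_max m2 andbT.
    exact: leq_trans (mmeasureZ_le _ _ _) m1.
  by move=> x sx; rewrite pevalD pevalZ -e1 // -e2.
move=> v vV sigma sigma' s2 s2' vs vs' m ms.
rewrite !linearP /= !pevalD !pevalZ.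
by rewrite (v1 v vV sigma sigma' s2 s2' vs vs' m ms) (v2 v vV sigma sigma' s2 s2' vs vs' m ms).
Qed.

Lemma spanned_fin (V : lmodType R) (I : finType) (e : I -> V) (c : I -> R) :
  spanned (fun k : 'I_#|I| => e (enum_val k)) (\sum_i c i *: e i).
Proof.
by exists (fun k => c (enum_val k)); rewrite (reindex _ (onW_bij _ (@enum_val_bij I))).
Qed.

Hypothesis triangles : forall x, K x ->
  exists2 sigma, sigma \in faces Delta 2 & realization sigma x.

(** A spline is determined by finitely many coefficients. The spanning functions are monomials cut
    off by a choice [T] of one triangle through each point, so that common edges are not counted
    twice. *)
Lemma has_dim_splines r s d : exists m, has_dim (splines Delta r s d) m.
Proof.
have /choice[T hT] : forall x, exists sigma, K x ->
    sigma \in faces Delta 2 /\ realization sigma x.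
  move=> x; have [Kx|nK] := pselect (K x); last by exists fset0.
  by have [sigma s2 sx] := triangles Kx; exists sigma.
pose I : finType := (faces Delta 2 * bmultinom 2 d.+1)%type.
pose e (i : I) : K -> R^o := fun x : K =>
  (T (val x) == val i.1)%:R * mmap1 (fun j => val x 0 j) (val i.2).
apply: (has_dim_subspace (e := fun k : 'I_#|I| => e (enum_val k))).
  exact: linear_subspace_splines.
move=> f [_ [p [hp _]]].
suff -> : f = \sum_i mcoeff (val i.2) (p (val i.1)) *: e i by exact: spanned_fin.
apply/funext => x; have Kx : K (val x) by exact: set_valP.
have [t2 tx] := hT _ Kx; have [mp fE] := hp _ t2.
rewrite fE // (big_morph (fun h : K -> R^o => h x) (id1 := 0) (op1 := +%R)) //.
rewrite -(pair_bigA _ (fun (sigma : faces Delta 2) (m : bmultinom 2 d.+1) =>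
  (mcoeff (val m) (p (val sigma)) *: e (sigma, m)) x)) /=.
rewrite (bigD1 [` t2]%fset) //= [X in _ + X]big1 ?addr0.
  rewrite /peval /meval (mmapE d.+1 mp); apply: eq_bigr => m _.
  by rewrite -[RHS]/(mcoeff (val m) (p (T (val x))) * e ([` t2]%fset, m) x) /e /= eqxx mul1r.
move=> sigma; rewrite -val_eqE /= => ne; rewrite big1 // => m _.
rewrite -[LHS]/(mcoeff (val m) (p (val sigma)) * e (sigma, m) x) /e /=.
by rewrite eq_sym (negbTE ne) mul0r mulr0.
Qed.

Section SplineOfPolynomials.
Variables (r s d : nat) (p : {fset 'rV[R]_2} -> {mpoly R[2]}).
Hypothesis rs : (r <= s)%N.
Hypothesis p_size : forall sigma, sigma \in faces Delta 2 ->
  (mmeasure mdeg (p sigma) <= d.+1)%N.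
Hypothesis p_edge : forall sigma sigma' v w, sigma \in faces Delta 2 ->
  sigma' \in faces Delta 2 -> v \in sigma -> v \in sigma' -> w \in sigma -> w \in sigma' ->
  v != w -> forall x, realization [fset v; w] x -> vanishes r.+1 (p sigma - p sigma') x.
Hypothesis p_vertex : forall sigma sigma' v, sigma \in faces Delta 2 ->
  sigma' \in faces Delta 2 -> v \in sigma -> v \in sigma' ->
  forall m, (mdeg m <= s)%N -> peval (mderivm m (p sigma)) v = peval (mderivm m (p sigma')) v.

(** Distinct triangles that meet share a vertex or an edge. In the first case the derivatives agree
    by [p_vertex], as r <= s; in the second by [p_edge]. *)
Lemma p_point sigma sigma' x m : sigma \in faces Delta 2 -> sigma' \in faces Delta 2 ->
  realization sigma x -> realization sigma' x -> (mdeg m <= r)%N ->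
  peval (mderivm m (p sigma)) x = peval (mderivm m (p sigma')) x.
Proof.
move=> s2 s2' sx sx' mr.
have sD : sigma \in Delta by move: s2; rewrite mem_faces => /andP[].
have sD' : sigma' \in Delta by move: s2'; rewrite mem_faces => /andP[].
have [->|ss'] := eqVneq sigma sigma'; first by [].
have Ix := realizationI cx sD sD' sx sx'.
have [v vI] : exists v, v \in sigma `&` sigma'.
  apply/fset0Pn; apply/eqP => I0; move: Ix; rewrite I0 => /realizationP[a [_ a1 _]].
  by move: a1; rewrite big_seq_fset0 => /eqP; rewrite eq_sym oner_eq0.
have /andP[vs vs'] : (v \in sigma) && (v \in sigma') by rewrite -in_fsetI.
have [[w wI vw]|nw] := pselect (exists2 w, w \in sigma `&` sigma' & v != w); last first.
  have xv : x = v.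
    apply: realization_vertex; case: Ix => k [c [a [c0 c1 ca xE]]]; exists k, c, a; split=> // i.
    have ai : a i \in sigma `&` sigma' := ca i.
    rewrite /= inE; apply: contrapT => /negP av; apply: nw; exists (a i) => //.
    by rewrite eq_sym.
  by rewrite xv; apply: p_vertex => //; exact: leq_trans rs.
have /andP[ws ws'] : (w \in sigma) && (w \in sigma') by rewrite -in_fsetI.
have ID : sigma `&` sigma' \in Delta.
  by apply: (face_subset cx sD); [apply/fset0Pn; exists v | exact: fsubsetIl].
have IE : sigma `&` sigma' = [fset v; w].
  have [//|I2] := mem_face_edge cx ID vI wI vw; exfalso.
  have card t : t \in faces Delta 2 -> #|` t| = 3%N by rewrite mem_faces => /andP[_ /eqP].
  have e1 : sigma `&` sigma' = sigma by apply/eqP; rewrite eqEfcard fsubsetIl !card.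
  have e2 : sigma `&` sigma' = sigma' by apply/eqP; rewrite eqEfcard fsubsetIr !card.
  by rewrite -e1 e2 eqxx in ss'.
rewrite IE in Ix; have := p_edge s2 s2' vs vs' ws ws' vw Ix.
move=> /vanishes_mderivm/(_ mr)/eqP.
by rewrite mderivmB pevalB subr_eq0 => /eqP.
Qed.

(** The derivatives are read off a chosen triangle through each point; by [p_point] the choice does
    not matter up to order r. Points near x lie in triangles through x, so continuity and difference
    quotients at x involve finitely many polynomials only. *)
Lemma spline_of_polynomials : exists2 f : K -> R^o, splines Delta r s d f &
  forall sigma (x : K), sigma \in faces Delta 2 -> realization sigma (val x) ->
    f x = peval (p sigma) (val x).
Proof.
have /choice[T hT] : forall x, exists sigma, K x ->
    sigma \in faces Delta 2 /\ realization sigma x.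
  move=> x; have [Kx|nK] := pselect (K x); last by exists fset0.
  by have [sigma s2 sx] := triangles Kx; exists sigma.
have KP (x : K) : K (val x) by exact: set_valP.
pose mu i j : multinom 2 := mnm_add (mnm_muln (mnm1 0) i) (mnm_muln (mnm1 1) j).
have mu_deg i j : mdeg (mu i j) = (i + j)%N.
  by rewrite /mu mdegD !mdegMn !mdeg1 !mul1n.
pose g i j x := peval (mderivm (mu i j) (p (T x))) x.
have gE i j sigma x : (i + j <= r)%N -> sigma \in faces Delta 2 -> realization sigma x ->
    g i j x = peval (mderivm (mu i j) (p sigma)) x.
  move=> ij s2 sx; have sD : sigma \in Delta by move: s2; rewrite mem_faces => /andP[].
  have [t2 tx] := hT x (mem_carrier sD sx).
  by apply: p_point => //; rewrite mu_deg.
have mu00 q : mderivm (mu 0%N 0%N) q = q.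
  by rewrite /mu !mulm0n add0m mderivm0m.
have fE sigma (x : K) : sigma \in faces Delta 2 -> realization sigma (val x) ->
    g 0%N 0%N (val x) = peval (p sigma) (val x).
  by move=> s2 sx; rewrite (gE 0%N 0%N sigma) // mu00.
have near_T x : nbhs x (fun y => K y -> [/\ T y \in faces Delta 2, realization (T y) y &
    realization (T y) x]).
  apply: filterS (near_faces cx x) => y hy Ky; have [t2 ty] := hT y Ky; split=> //.
  by apply: hy ty; move: t2; rewrite mem_faces => /andP[].
have cont i j : (i + j <= r)%N -> {within K, continuous (g i j)}.
  move=> ij; apply/subspace_continuousP => x Kx; apply/cvgrPdist_lt => e e0.
  have nE : nbhs x (fun y => forall sigma, sigma \in Delta ->
      `|peval (mderivm (mu i j) (p sigma)) x - peval (mderivm (mu i j) (p sigma)) y| < e).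
    apply: near_all_seq => sigma _.
    by have /cvgrPdist_lt/(_ e e0) := @peval_continuous R 2 (mderivm (mu i j) (p sigma)) x.
  apply: filterS (filterI nE (near_T x)) => y [h1 h2] Ky.
  have [t2 ty tx] := h2 Ky.
  have tD : T y \in Delta by move: t2; rewrite mem_faces => /andP[].
  have := h1 _ tD; rewrite -(gE i j (T y) x ij t2 tx) -(gE i j (T y) y ij t2 ty).
  exact.
have deriv i j (k : 'I_2) x : (i + j < r)%N -> interior K x ->
    is_derive x (delta_mx 0 k : 'rV[R]_2) (g i j)
      (g (i + (nat_of_ord k == 0%N))%N (j + (nat_of_ord k == 1%N))%N x).
  move=> ij iK; apply: is_derive_cvg.
  set i' := (i + (nat_of_ord k == 0%N))%N; set j' := (j + (nat_of_ord k == 1%N))%N.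
  have ij' : (i' + j' <= r)%N.
    by rewrite /i' /j'; case: k {i' j'} => -[|[|//]] ? /=; lia.
  have mderivS q : mderivm (mu i' j') q = mderiv k (mderivm (mu i j) q).
    rewrite -mderivmU1m -mderivmDm; congr (mderivm _ q); apply/mnmP => l.
    rewrite !mnmDE !mulmnE !mnm1E /i' /j'; case: k {i' j' ij'} => -[|[|//]] ?; case: l => -[|[|//]] ? /=; lia.
  apply/cvgrPdist_lt => e e0.
  have nE : nbhs (0 : R)^' (fun h => forall sigma, sigma \in Delta ->
      `|peval (mderivm (mu i' j') (p sigma)) x -
        h^-1 *: (peval (mderivm (mu i j) (p sigma)) (h *: delta_mx 0 k + x) -
                 peval (mderivm (mu i j) (p sigma)) x)| < e).
    apply: near_all_seq => sigma _.
    have [d1 d2] := peval_is_derive (mderivm (mu i j) (p sigma)) x k.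
    have h : (fun h : R => h^-1 *: (peval (mderivm (mu i j) (p sigma)) (h *: delta_mx 0 k + x) -
                 peval (mderivm (mu i j) (p sigma)) x)) @ 0^' -->
        peval (mderivm (mu i' j') (p sigma)) x.
      by rewrite mderivS -d2; exact: d1.
    by move/cvgrPdist_lt: h => /(_ e e0).
  have nK : nbhs x (fun y => K y /\ (K y -> [/\ T y \in faces Delta 2, realization (T y) y &
    realization (T y) x])) by exact: filterI.
  have nK' : nbhs (0 : R)^' (fun h => let y := h *: delta_mx 0 k + x in
     K y /\ (K y -> [/\ T y \in faces Delta 2, realization (T y) y & realization (T y) x])).
    have h2 : (fun h : R => h *: delta_mx 0 k + x) @ (0 : R) --> (x : 'rV[R]_2).
      have h0 : (fun h : R => h *: (delta_mx 0 k : 'rV[R]_2)) @ (0 : R) --> (0 : R) *: (delta_mx 0 k : 'rV[R]_2).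
        by apply: cvgZr_tmp; exact: cvg_id.
      have := cvgD h0 (cvg_cst x); rewrite scale0r add0r; exact.
    by apply: cvg_within; exact: h2 _ nK.
  apply: filterS (filterI nE nK') => h [h1 [Ky h2]].
  have [t2 ty tx] := h2 Ky.
  have tD : T (h *: delta_mx 0 k + x) \in Delta by move: t2; rewrite mem_faces => /andP[].
  have ij0 : (i + j <= r)%N := ltnW ij.
  rewrite (gE i' j' _ x ij' t2 tx) (gE i j _ x ij0 t2 tx) (gE i j _ _ ij0 t2 ty).
  exact: h1.
exists (fun x : K => g 0%N 0%N (val x)); last exact: fE.
split.
  exists g; split=> // i j x ij ix; split.
    by have := deriv i j 0 x ij ix; rewrite /= addn1 addn0.
  by have := deriv i j 1 x ij ix; rewrite /= addn0 addn1.
exists p; split.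
  by move=> sigma s2; split; [exact: p_size | move=> x; exact: fE].
by move=> v _ sigma sigma' s2 s2' vs vs' m ms; apply: p_vertex.
Qed.

End SplineOfPolynomials.
End SplineSpace.

(** * Admissible jumps on one edge *)

Section EdgeConditions.
Context {R : realType}.
Implicit Types (v w x a b : 'rV[R]_2) (M : 'M[R]_3).

Definition edge_monomial r s d M (i : edge_index r s d) : {mpoly R[3]} :=
  frame_monomial M d ((val i).1 + (val i).2) (val i).1.

Lemma edge_monomialE r s d M (i : edge_index r s d) : edge_monomial M i =
  coord M 0 ^+ (val i).1 * coord M 1 ^+ (val i).2 *
  coord M 2 ^+ (d - ((val i).1 + (val i).2)).
Proof. by rewrite /edge_monomial /frame_monomial addKn. Qed.

Lemma frame_monomial_homog M d k j : (j <= k <= d)%N ->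
  frame_monomial M d k j \is ishomog1 d mdeg.
Proof. by move=> jkd; rewrite frame_monomial_sum //; exact: frame_sum_homog. Qed.

Lemma edge_monomial_homog r s d M (i : edge_index r s d) :
  edge_monomial M i \is ishomog1 d mdeg.
Proof.
apply: frame_monomial_homog; rewrite leq_addr /=.
exact: leq_trans (ltnW (valP i)) (leq_subr _ _).
Qed.

Lemma edge_monomial_free r s d M (c : edge_index r s d -> R) : M \in unitmx ->
  \sum_i c i *: edge_monomial M i = 0 -> forall i, c i = 0.
Proof.
move=> uM; apply: frame_monomial_free => // [i|i i'].
  by rewrite leq_addr /=; apply: leq_trans (ltnW (valP i)) (leq_subr _ _).
case: i i' => [[a b] ?] [[a' b'] ?] /= e1 e2; apply: val_inj => /=.
by congr (_, _); apply: val_inj => //=; apply: (@addnI a); rewrite e1 e2.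
Qed.

Lemma vertex_ideal_coord M v (i j : 'I_3) : M \in unitmx -> row i M = embed v -> i != j ->
  vertex_ideal v (coord M j).
Proof.
move=> uM Mi ij; apply: vertex_ideal_linear_form; rewrite -Mi -row_mul colE mulmxA.
rewrite mulmxV // mul1mx; apply/matrixP => x y; rewrite !mxE.
by rewrite (negbTE ij).
Qed.

(** For exponents i, j of X, Y: at the end [a] the factors Y and Z vanish, and their exponents add
    up to d - i > s; symmetrically at [b]. The exponent of Z exceeds r because i + j < d - r. *)
Lemma edge_monomial_ideal r s d M (i : edge_index r s d) (l : {mpoly R[3]}) (c : R) a b v :
  M \in unitmx -> row 0 M = embed a -> row 1 M = embed b -> coord M 2 = c *: l ->
  v \in [fset a; b] -> ideal_gen [set l ^+ r.+1]%classic (edge_monomial M i) /\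
    ideal_pow (vertex_ideal v) s.+1 (edge_monomial M i).
Proof.
move=> uM M0 M1 M2 vab; rewrite edge_monomialE.
have := valP i; have := ltn_ord (val i).1; have := ltn_ord (val i).2.
case: (val i) => [[al /= al_lt] [be /= be_lt]] _ _ abd; split.
  have -> : (d - (al + be) = (d - (al + be) - r.+1) + r.+1)%N by lia.
  by rewrite exprD {2}M2 exprZn -mul_mpolyC !mulrA; apply/ideal_genM/ideal_gen_mem.
set n := (d - _)%N.
have prodE (x y : {mpoly R[3]}) j k : x ^+ j * y ^+ k = \prod_(z <- nseq j x ++ nseq k y) z.
  by rewrite big_cat !big_nseq -!Monoid.iteropE.
move: vab; rewrite !inE => /orP[] /eqP ->.
  rewrite -mulrA; apply: ideal_genM; rewrite prodE.
  apply: ideal_pow_prod; last by rewrite size_cat !size_nseq /n; lia.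
  by move=> x; rewrite mem_cat => /orP[] /nseqP[-> _]; apply: (vertex_ideal_coord uM M0).
rewrite [X in X * _]mulrC -mulrA; apply: ideal_genM; rewrite prodE.
apply: ideal_pow_prod; last by rewrite size_cat !size_nseq /n; lia.
by move=> x; rewrite mem_cat => /orP[] /nseqP[-> _]; apply: (vertex_ideal_coord uM M1).
Qed.

Lemma dehom_edge_monomial r s d M (i : edge_index r s d) : dehom (edge_monomial M i) =
  dehom (coord M 0) ^+ (val i).1 * dehom (coord M 1) ^+ (val i).2 *
  dehom (coord M 2) ^+ (d - ((val i).1 + (val i).2)).
Proof. by rewrite edge_monomialE !rmorphM !rmorphXn. Qed.

Lemma edge_monomial_vanishes_edge r s d M (i : edge_index r s d) x :
  peval (coord M 2) (embed x) = 0 -> vanishes r.+1 (dehom (edge_monomial M i)) x.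
Proof.
rewrite -peval_dehom dehom_edge_monomial mulrC => Zx.
apply: (vanishes_leq _ (vanishes_exp (d - ((val i).1 + (val i).2)) Zx (k := 0) I)).
by rewrite addn0 ltn_subRL addnC -ltn_subRL; exact: (valP i).
Qed.

Lemma edge_monomial_vanishes_vertex r s d M (i : edge_index r s d) a b v :
  M \in unitmx -> row 0 M = embed a -> row 1 M = embed b -> v \in [fset a; b] ->
  vanishes s.+1 (dehom (edge_monomial M i)) v.
Proof.
move=> uM M0 M1 vab; rewrite dehom_edge_monomial.
have := valP i; have := ltn_ord (val i).1; have := ltn_ord (val i).2.
case: (val i) => [[al /= al_lt] [be /= be_lt]] _ _ abd; set n := (d - _)%N.
move: vab; rewrite !inE => /orP[] /eqP ->.
  have Y0 : peval (dehom (coord M 1)) a = 0 by rewrite peval_dehom -M0 peval_coord.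
  have Z0 : peval (dehom (coord M 2)) a = 0 by rewrite peval_dehom -M0 peval_coord.
  have rot (p q t : {mpoly R[2]}) : p * q * t = q * (t * p).
    by rewrite [RHS]mulrCA [q * p]mulrC [LHS]mulrC.
  rewrite rot.
  have h := vanishes_exp n Z0 (k := 0) (p := dehom (coord M 0) ^+ al) I.
  by apply: (@vanishes_leq _ _ s.+1 _ _ _ _ (vanishes_exp be Y0 h)); rewrite /n; lia.
have X0 : peval (dehom (coord M 0)) b = 0 by rewrite peval_dehom -M1 peval_coord.
have Z0 : peval (dehom (coord M 2)) b = 0 by rewrite peval_dehom -M1 peval_coord.
rewrite -mulrA [X in _ * X]mulrC.
have h := vanishes_exp n Z0 (k := 0) (p := dehom (coord M 1) ^+ be) I.
by apply: (@vanishes_leq _ _ s.+1 _ _ _ _ (vanishes_exp al X0 h)); rewrite /n; lia.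
Qed.

Lemma slope_cross v w z : slope v w = slope v z -> cross (w - v) (z - v) = 0.
Proof.
rewrite /slope /cross !mxE; case: eqP => [ew|nw]; case: eqP => [ez|nz] //.
  by rewrite -ew -ez !subrr mul0r mulr0 subrr.
have dw : w 0 0 - v 0 0 != 0 by rewrite subr_eq0; apply/eqP => e; apply: nw.
have dz : z 0 0 - v 0 0 != 0 by rewrite subr_eq0; apply/eqP => e; apply: nz.
move=> [] /eqP; rewrite eqr_div // => /eqP e.
by move: e; lra.
Qed.

Lemma free_family_fin (V : lmodType R) (I : finType) (h : I -> V) :
  (forall c : I -> R, \sum_i c i *: h i = 0 -> forall i, c i = 0) ->
  free_family (fun k : 'I_#|I| => h (enum_val k)).
Proof.
move=> free_h c c0 k.
have := free_h (fun i => c (enum_rank i)).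
rewrite (reindex _ (onW_bij _ (@enum_val_bij I))) /=.
under eq_bigr => j _ do rewrite enum_valK.
by move=> /(_ c0 (enum_val k)); rewrite enum_valK.
Qed.

End EdgeConditions.

Section TriangleVanishing.
Context {R : realType}.
Variable Delta : {fset {fset 'rV[R]_2}}.
Hypothesis cx : simplicial_complex Delta.

(** The sides at v and v itself, embedded in R^3, form a frame in which the triangle is the
    two-parameter region of [homog_eq0_cone]. *)
Lemma homog_eq0_triangle d sigma (F : {mpoly R[3]}) : sigma \in faces Delta 2 ->
  F \is ishomog1 d mdeg -> (forall x, realization sigma x -> peval F (embed x) = 0) -> F = 0.
Proof.
move=> s2 hF F0; have /fset0Pn[v vs] : sigma != fset0.
  by apply: (face_neq0 cx); move: s2; rewrite mem_faces => /andP[].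
have [w [z [sE D0]]] := triangle_at cx s2 vs; rewrite sE in s2 F0.
pose M : 'M[R]_3 := \matrix_(i < 3) nth 0 [:: embed w - embed v; embed z - embed v; embed v] i.
have M0 : row 0 M = embed w - embed v by rewrite rowK.
have M1 : row 1 M = embed z - embed v by rewrite rowK.
have M2 : row 2 M = embed v by rewrite rowK.
have [v0 v1 v2] := embedE v; have [w0 w1 w2] := embedE w; have [z0 z1 z2] := embedE z.
have uM : M \in unitmx.
  rewrite -row_free_unit -kermx_eq0; apply/eqP/row_matrixP => i; rewrite row0.
  have : row i (kermx M) *m M = 0 by apply/sub_kermxP/row_sub.
  move: (row i _) => y yM.
  have E j : y 0 0 * (embed w 0 j - embed v 0 j) + y 0 1 * (embed z 0 j - embed v 0 j)
      + y 0 2 * embed v 0 j = 0.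
    have := yM; rewrite mulmx_sum_row !big_ord_recl big_ord0.
    rewrite (_ : lift ord0 ord0 = 1); last exact: val_inj.
    rewrite (_ : lift ord0 (lift ord0 ord0) = 2); last exact: val_inj.
    rewrite M0 M1 M2 addr0 addrA => /rowP/(_ j).
    by rewrite [RHS]mxE => <-; rewrite [RHS]mxE [X in _ = X + _]mxE; congr (_ + _ + _);
      rewrite [RHS]mxE //; congr (_ * _); rewrite [RHS]mxE; congr (_ + _); rewrite [RHS]mxE.
  have := E 0; have := E 1; have := E 2; rewrite v0 v1 v2 w0 w1 w2 z0 z1 z2 => e2 e1 e0.
  have y2 : y 0 2 = 0 by move: e2; lra.
  have := D0; rewrite /cross !mxE => D1.
  have y0 : y 0 0 = 0.
    apply: (mulIf (negbT (gt_eqF D1))); rewrite mul0r.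
    move: e0 e1; rewrite y2 !mul0r !addr0 => e0 e1.
    transitivity ((y 0 0 * (w 0 0 - v 0 0) + y 0 1 * (z 0 0 - v 0 0)) * (z 0 1 - v 0 1)
      - (y 0 0 * (w 0 1 - v 0 1) + y 0 1 * (z 0 1 - v 0 1)) * (z 0 0 - v 0 0)); first by ring.
    by rewrite e0 e1 !mul0r subrr.
  have y1 : y 0 1 = 0.
    apply: (mulIf (negbT (gt_eqF D1))); rewrite mul0r.
    move: e0 e1; rewrite y2 !mul0r !addr0 => e0 e1.
    transitivity ((y 0 0 * (w 0 1 - v 0 1) + y 0 1 * (z 0 1 - v 0 1)) * (w 0 0 - v 0 0)
      - (y 0 0 * (w 0 0 - v 0 0) + y 0 1 * (z 0 0 - v 0 0)) * (w 0 1 - v 0 1)); first by ring.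
    by rewrite e0 e1 !mul0r subrr.
  apply/rowP => -[[|[|[|//]]] k]; rewrite mxE.
  - by rewrite -y0; congr (y 0 _); apply: val_inj.
  - by rewrite -y1; congr (y 0 _); apply: val_inj.
  - by rewrite -y2; congr (y 0 _); apply: val_inj.
apply: (homog_eq0_cone uM hF) => t u t0 u0 tu.
have -> : row 2 M + u *: (t *: row 0 M + row 1 M) =
    embed (v + (u * t) *: (w - v) + u *: (z - v)).
  rewrite M0 M1 M2; have [e0 e1 e2] := embedE (v + (u * t) *: (w - v) + u *: (z - v)).
  have E j : (embed v + u *: (t *: (embed w - embed v) + (embed z - embed v))) 0 j =
      embed v 0 j + u * (t * (embed w 0 j - embed v 0 j) + (embed z 0 j - embed v 0 j)).
    rewrite [LHS]mxE [X in _ + X]mxE [X in _ + _ * X]mxE [X in _ + _ * (X + _)]mxE.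
    by rewrite [X in _ + _ * (_ * X + _)]mxE [X in _ + _ * (_ + X)]mxE
      [X in _ + _ * (_ * (_ + X) + _)]mxE [X in _ + _ * (_ + (_ + X))]mxE.
  apply/rowP => -[[|[|[|//]]] k]; rewrite E.
  - rewrite (_ : Ordinal k = 0); last exact: val_inj.
    by rewrite e0 v0 w0 z0 !mxE; ring.
  - rewrite (_ : Ordinal k = 1); last exact: val_inj.
    by rewrite e1 v1 w1 z1 !mxE; ring.
  - rewrite (_ : Ordinal k = 2); last exact: val_inj.
    by rewrite e2 v2 w2 z2; ring.
apply: F0; apply/(realization_triangle _ s2); exists (u * t), u; split=> //.
  exact: mulr_ge0.
by move: tu; rewrite mulrDr mulr1.
Qed.

End TriangleVanishing.

(** * Jumps across interior edges *)

Section InteriorEdges.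
Context {R : realType}.
Variable Delta : {fset {fset 'rV[R]_2}}.
Hypothesis cx : simplicial_complex Delta.
Variables f g : 'rV[R]_2 -> 'rV[R]_2.
Hypothesis cf : {within carrier Delta, continuous f}.
Hypothesis cg : {within @closed_disk R, continuous g}.
Hypothesis fK : forall x, carrier Delta x -> closed_disk (f x) /\ g (f x) = x.
Hypothesis gD : forall y, closed_disk y -> carrier Delta (g y) /\ f (g y) = y.
Implicit Types (u v w x y z : 'rV[R]_2) (sigma tau : {fset 'rV[R]_2}).
Local Notation K := (carrier Delta).

Lemma interior_facesP tau i : reflect
  (tau \in faces Delta i /\ exists2 x, realization tau x & interior K x)
  (tau \in interior_faces Delta i).
Proof.
rewrite /interior_faces; apply: (iffP idP).
  rewrite inE /= => /andP[ti /asboolP nb]; split=> //.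
  apply: contrapT => h; apply: nb => x tx; split.
    by apply: (mem_carrier _ tx); move: ti; rewrite mem_faces => /andP[].
  by move=> xK; apply: h; exists x.
move=> [ti [x tx xK]]; rewrite inE /=; apply/andP; split=> //.
by apply/asboolP => /(_ x tx)[_].
Qed.

Lemma interior_vertex_edge v u : v \in interior_vertices Delta -> u \in neighbors Delta v ->
  [fset v; u] \in interior_faces Delta 1.
Proof.
move=> /interior_vertexE[_ vK]; rewrite (mem_neighbors cx) => /andP[e vu].
apply/interior_facesP; split; first by rewrite mem_faces e cardfs2 vu.
by exists v => //; apply: mem_realization; rewrite !inE eqxx.
Qed.

Lemma interior_edges_at v : v \in interior_vertices Delta ->
  [fset tau in interior_faces Delta 1 | v \in tau] =
  [fset [fset v; u] | u in neighbors Delta v].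
Proof.
move=> vi; apply/fsetP => tau; apply/idP/imfsetP => [|[u /= uv ->]]; last first.
  rewrite inE /=; apply/andP; split; last by rewrite !inE eqxx.
  exact: interior_vertex_edge.
rewrite inE /= => /andP[/interior_facesP[+ _] vt]; rewrite mem_faces => /andP[tD /eqP t2].
have [u [vu tE]] := cardfs2_mem t2 vt; exists u => //.
by rewrite /= (mem_neighbors cx) -tE tD.
Qed.

Lemma fset2_inj v u u' : v != u -> v != u' -> [fset v; u] = [fset v; u'] -> u = u'.
Proof.
move=> vu _ e; have : u \in [fset v; u'] by rewrite -e !inE eqxx orbT.
by rewrite !inE eq_sym (negbTE vu) => /eqP.
Qed.

Lemma interior_edge_triangles v w : [fset v; w] \in interior_faces Delta 1 ->
  exists z z', [/\ [fset v; w; z] \in faces Delta 2, [fset v; w; z'] \in faces Delta 2,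
    0 < cross (w - v) (z - v) & cross (w - v) (z' - v) < 0].
Proof.
move=> /interior_facesP[+ [x tx xK]]; rewrite mem_faces cardfs2 => /andP[eD].
have [//|vw _] := eqVneq v w.
have [z [z2 zp]] := interior_edge_left cx vw eD tx xK.
have eC : [fset v; w] = [fset w; v] by rewrite fsetUC.
rewrite eC in tx eD; rewrite eq_sym in vw.
have [z' [z2' zp']] := interior_edge_left cx vw eD tx xK.
exists z, z'; split=> //; first by rewrite eC.
rewrite (_ : cross _ _ = - cross (v - w) (z' - w)) ?oppr_lt0 //.
by rewrite /cross !mxE; ring.
Qed.

(** The sides of a triangle at v have different slopes. This gives the positive denominator t - 1 in
    [Omega]. *)
Lemma nb_slopes_gt1 v : [fset v] \in Delta -> (1 < nb_slopes Delta v)%N.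
Proof.
move=> vD; have [sigma s2 vs] := face_in_triangle cx cf cg fK gD vD.
have {}vs : v \in sigma by move/fsubsetP: vs; apply; rewrite inE.
have [w [z [sE D0]]] := triangle_at cx s2 vs; rewrite sE in s2.
have [wn zn] := triangle_neighbors cx s2.
have sl : slope v w != slope v z by apply/eqP => /slope_cross e; rewrite e ltxx in D0.
have := cardfs2 (slope v w) (slope v z); rewrite sl => {sl} <-.
by apply: fsubset_leq_card; apply/fsubsetP => o; rewrite !inE => /orP[]/eqP ->; apply: in_imfset.
Qed.

(** Two distinct triangles on an edge lie on opposite sides of it, and the sign says which of them
    is on the left. *)
Lemma potential_difference (V : zmodType) (J : 'rV[R]_2 -> 'rV[R]_2 -> V)
    (F : {fset 'rV[R]_2} -> V) :
  (forall v w z z', [fset v; w; z] \in faces Delta 2 -> [fset v; w; z'] \in faces Delta 2 ->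
    0 < cross (w - v) (z - v) -> cross (w - v) (z' - v) < 0 ->
    F [fset v; w; z] - F [fset v; w; z'] = J v w) ->
  forall sigma sigma' v w, sigma \in faces Delta 2 -> sigma' \in faces Delta 2 ->
    v \in sigma -> v \in sigma' -> w \in sigma -> w \in sigma' -> v != w ->
    [\/ F sigma - F sigma' = 0, F sigma - F sigma' = J v w | F sigma - F sigma' = - J v w].
Proof.
move=> FJ sigma sigma' v w s2 s2' vs vs' ws ws' vw.
have [z [_ _ sE D]] := triangleP cx s2 vs ws vw.
have [z' [_ _ sE' D']] := triangleP cx s2' vs' ws' vw.
have [ss'|ss'] := eqVneq sigma sigma'; first by constructor 1; rewrite ss' subrr.
rewrite {}sE {}sE' in s2 s2' ss' *.
have := opposite_sides cx s2 s2' ss'; have [zp|zn|z0] := ltrgt0P (cross (w - v) (z - v)).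
- by rewrite pmulr_rlt0 // => zn'; constructor 2; apply: FJ.
- by rewrite nmulr_rlt0 // => zp'; constructor 3; rewrite -opprB (FJ v w z' z).
- by rewrite z0 eqxx in D.
Qed.

End InteriorEdges.

(** * The space of edge jumps *)

Section CofactorSpace.
Context {R : realType}.
Variable Delta : {fset {fset 'rV[R]_2}}.
Hypothesis cx : simplicial_complex Delta.
Variable ell : {fset 'rV[R]_2} -> {mpoly R[3]}.
Hypothesis ell_edge : forall tau, tau \in faces Delta 1 -> edge_form tau (ell tau).
Variables r s d : nat.
Implicit Types (u v w : 'rV[R]_2) (sigma tau : {fset 'rV[R]_2}).

Lemma edge_form_peval tau (x : 'rV[R]_2) : tau \in faces Delta 1 -> realization tau x ->
  peval (ell tau) (embed x) = 0.
Proof. by move=> /ell_edge[_ _ h] tx; apply/h/cone_embed. Qed.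

(** Besides the frame, the chosen end [a tau] orients the edge, which later fixes the sign of its
    jump. *)
Lemma exists_edge_frames : exists (a : {fset 'rV[R]_2} -> 'rV[R]_2)
    (M : {fset 'rV[R]_2} -> 'M[R]_3), forall tau, tau \in faces Delta 1 ->
  exists b c, [/\ [/\ tau = [fset a tau; b], a tau != b & M tau \in unitmx],
    row 0 (M tau) = embed (a tau), row 1 (M tau) = embed b, c != 0
    & coord (M tau) 2 = c *: ell tau].
Proof.
pose P tau (aM : 'rV[R]_2 * 'M[R]_3) := tau \in faces Delta 1 ->
  exists b c, [/\ [/\ tau = [fset aM.1; b], aM.1 != b & aM.2 \in unitmx],
    row 0 aM.2 = embed aM.1, row 1 aM.2 = embed b, c != 0 & coord aM.2 2 = c *: ell tau].
have /choice[h hP] : forall tau, exists aM, P tau aM.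
  move=> tau; have [t1|nt1] := boolP (tau \in faces Delta 1); last first.
    by exists (0, 0) => t1; rewrite t1 in nt1.
  have := t1; rewrite mem_faces => /andP[tD /eqP t2].
  have /fset0Pn[a at_] : tau != fset0 by rewrite -cardfs_gt0 t2.
  have [b [ab tE]] := cardfs2_mem t2 at_.
  have [hl l0 _] := ell_edge t1.
  have la : peval (ell tau) (embed a) = 0.
    by apply: edge_form_peval => //; apply: mem_realization.
  have lb : peval (ell tau) (embed b) = 0.
    by apply: edge_form_peval => //; apply: mem_realization; rewrite tE !inE eqxx orbT.
  have [M [c [uM M0 M1 c0 M2]]] := edge_frame hl l0 ab la lb.
  by exists (a, M) => _; exists b, c.
by exists (fun tau => (h tau).1), (fun tau => (h tau).2) => tau /hP.
Qed.

Variables (a : {fset 'rV[R]_2} -> 'rV[R]_2) (M : {fset 'rV[R]_2} -> 'M[R]_3).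
Hypothesis frames : forall tau, tau \in faces Delta 1 ->
  exists b c, [/\ [/\ tau = [fset a tau; b], a tau != b & M tau \in unitmx],
    row 0 (M tau) = embed (a tau), row 1 (M tau) = embed b, c != 0
    & coord (M tau) 2 = c *: ell tau].
Local Notation E1 := (interior_faces Delta 1).
Local Notation I := (E1 * edge_index r s d)%type.

(** The vector [x] lists the coefficients of all jumps. The filtered sum extends the jump by 0 to
    sets that are not interior edges. *)
Definition edge_cofactor (x : 'rV[R]_#|{: I}|) tau : {mpoly R[3]} :=
  \sum_(t : E1 | val t == tau) \sum_ab x 0 (enum_rank (t, ab)) *: edge_monomial (M tau) ab.

Lemma edge_cofactorE x (t : E1) : edge_cofactor x (val t) =
  \sum_ab x 0 (enum_rank (t, ab)) *: edge_monomial (M (val t)) ab.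
Proof. by rewrite /edge_cofactor (big_pred1 t) // => t'; rewrite /= val_eqE. Qed.

Lemma edge_cofactor0 x tau : tau \notin E1 -> edge_cofactor x tau = 0.
Proof.
by move=> nt; rewrite /edge_cofactor big1 // => t /eqP te; rewrite -te (valP t) in nt.
Qed.

Lemma edge_cofactor_linear c x y tau :
  edge_cofactor (c *: x + y) tau = c *: edge_cofactor x tau + edge_cofactor y tau.
Proof.
rewrite scaler_sumr -big_split; apply: eq_bigr => t _ /=.
rewrite scaler_sumr -big_split; apply: eq_bigr => ab _ /=.
by rewrite !mxE scalerDl scalerA.
Qed.

Lemma edge_cofactor_ind (P : {mpoly R[3]} -> Prop) x tau :
  P 0 -> (forall c p q, P p -> P q -> P (c *: p + q)) ->
  (tau \in E1 -> forall ab : edge_index r s d, P (edge_monomial (M tau) ab)) ->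
  P (edge_cofactor x tau).
Proof.
move=> P0 PD Pm; have [t1|/edge_cofactor0 -> //] := boolP (tau \in E1).
rewrite -[tau]/(val [` t1]) edge_cofactorE.
by apply: (linear_subspace_sum (A := P)) => [|ab _]; [split | apply: Pm].
Qed.

Lemma interior_edge_face tau : tau \in E1 -> tau \in faces Delta 1.
Proof. by move=> /interior_facesP[]. Qed.

Lemma edge_cofactor_homog x tau : edge_cofactor x tau \is ishomog1 d mdeg.
Proof.
apply: (@edge_cofactor_ind (fun F => F \is ishomog1 d mdeg)) => [|c p q hp hq|_ ab]; first exact: rpred0.
  by apply: rpredD => //; apply: rpredZ.
exact: edge_monomial_homog.
Qed.

Lemma edge_cofactor_eq0 x (t : E1) : edge_cofactor x (val t) = 0 ->
  forall ab, x 0 (enum_rank (t, ab)) = 0.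
Proof.
have [b [c [[_ _ uM] _ _ _ _]]] := frames (interior_edge_face (valP t)).
by rewrite edge_cofactorE => /(edge_monomial_free uM).
Qed.

Lemma edge_cofactor_ideal x tau v : v \in tau ->
  ideal_gen [set ell tau ^+ r.+1]%classic (edge_cofactor x tau) /\
  ideal_pow (vertex_ideal v) s.+1 (edge_cofactor x tau).
Proof.
move=> vt; have lin (A : set {mpoly R[3]}) c p q : ideal_gen A p -> ideal_gen A q ->
    ideal_gen A (c *: p + q).
  move=> Ap Aq; have := @ideal_gen_linear _ A bool [:: true; false] predT
    (fun b => if b then mpolyC 3 c else 1) (fun b => if b then p else q).
  rewrite !big_cons big_nil addr0 mul1r mul_mpolyC; apply.
  by case.
apply: (@edge_cofactor_ind (fun F => ideal_gen [set ell tau ^+ r.+1]%classic F /\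
  ideal_pow (vertex_ideal v) s.+1 F)) => [|c p q [p1 p2] [q1 q2]|t1 ab].
- by split; apply: ideal_gen0.
- by split; apply: lin.
have [b [c [[tE _ uM] M0 M1 _ M2]]] := frames (interior_edge_face t1).
by apply: (edge_monomial_ideal ab uM M0 M1 M2); rewrite -tE.
Qed.

Lemma vanishes_linear n k (x : 'rV[R]_n) c (p q : {mpoly R[n]}) :
  vanishes k p x -> vanishes k q x -> vanishes k (c *: p + q) x.
Proof. by move=> hp hq; apply: vanishesD => //; rewrite -mul_mpolyC; apply: vanishesM. Qed.

Lemma vanishes0 n k (x : 'rV[R]_n) : vanishes k (0 : {mpoly R[n]}) x.
Proof. by elim: k => //= k IH; rewrite /peval meval0; split=> // i; rewrite mderiv0. Qed.

Lemma edge_cofactor_vanishes_edge y tau (x : 'rV[R]_2) : realization tau x ->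
  vanishes r.+1 (dehom (edge_cofactor y tau)) x.
Proof.
move=> tx; apply: (@edge_cofactor_ind (fun F => vanishes r.+1 (dehom F) x)) => [|c p q hp hq|t1 ab].
- by rewrite rmorph0; apply: vanishes0.
- by rewrite rmorphD /= dehomZ; apply: (@vanishes_linear _ r.+1).
have t1' := interior_edge_face t1.
have [b [c [_ _ _ _ M2]]] := frames t1'.
by apply: edge_monomial_vanishes_edge; rewrite M2 pevalZ edge_form_peval ?mulr0.
Qed.

Lemma edge_cofactor_vanishes_vertex y tau v : v \in tau ->
  vanishes s.+1 (dehom (edge_cofactor y tau)) v.
Proof.
move=> vt; apply: (@edge_cofactor_ind (fun F => vanishes s.+1 (dehom F) v)) => [|c p q hp hq|t1 ab].
- by rewrite rmorph0; apply: vanishes0.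
- by rewrite rmorphD /= dehomZ; apply: (@vanishes_linear _ s.+1).
have [b [c [[tE _ uM] M0 M1 _ M2]]] := frames (interior_edge_face t1).
by apply: (edge_monomial_vanishes_vertex ab uM M0 M1); rewrite -tE.
Qed.

Definition edge_sign v tau : R := if v == a tau then 1 else -1.

Definition smoothing_jump x v w : {mpoly R[3]} :=
  edge_sign v [fset v; w] *: edge_cofactor x [fset v; w].

Lemma edge_sign_neq0 v tau : edge_sign v tau != 0.
Proof. by rewrite /edge_sign; case: ifP; rewrite ?oppr_eq0 oner_eq0. Qed.

Lemma smoothing_jump_antisym x v w : smoothing_jump x w v = - smoothing_jump x v w.
Proof.
rewrite /smoothing_jump [[fset w; v]]fsetUC.
have [t1|/edge_cofactor0 ->] := boolP ([fset v; w] \in E1); last by rewrite !scaler0 oppr0.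
have [b [c [[tE ab _] _ _ _ _]]] := frames (interior_edge_face t1).
have := interior_edge_face t1; rewrite mem_faces cardfs2 => /andP[_].
have [//|vw _] := eqVneq v w.
rewrite -scaleNr /edge_sign; congr (_ *: _).
have := eqxx (a [fset v; w]); move: (a [fset v; w]) tE ab => a0 tE ab _.
have : a0 \in [fset v; w] by rewrite tE !inE eqxx.
rewrite !inE => /orP[]/eqP ->; first by rewrite eq_sym (negbTE vw) eqxx.
by rewrite eqxx (negbTE vw) opprK.
Qed.

Lemma smoothing_jump_linear c x y v w :
  smoothing_jump (c *: x + y) v w = c *: smoothing_jump x v w + smoothing_jump y v w.
Proof. by rewrite /smoothing_jump edge_cofactor_linear scalerDr !scalerA mulrC. Qed.

Lemma smoothing_jump_homog x v w : smoothing_jump x v w \is ishomog1 d mdeg.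
Proof. by apply: rpredZ; apply: edge_cofactor_homog. Qed.

Definition vertex_condition gamma x : {mpoly R[3]} :=
  \sum_(u <- neighbors Delta gamma) smoothing_jump x gamma u.

Lemma vertex_condition_linear gamma : linear (vertex_condition gamma).
Proof.
move=> c x y; rewrite /vertex_condition scaler_sumr -big_split.
by apply: eq_bigr => u _; rewrite smoothing_jump_linear.
Qed.

(** All edges at an interior vertex are interior, so the sum over neighbours runs over the very
    edges whose ideals make up [Jbar]. *)
Lemma vertex_condition_Jbar gamma x : gamma \in interior_vertices Delta ->
  degree_part (Jbar Delta ell r s gamma) d (vertex_condition gamma x).
Proof.
move=> gi; split; last by apply: rpred_sum => u _; apply: smoothing_jump_homog.
exists (fun tau => edge_sign gamma tau *: edge_cofactor x tau); split=> [tau|].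
  rewrite inE /= => /andP[_ gt]; rewrite -mul_mpolyC.
  by have [h1 h2] := edge_cofactor_ideal x gt; split; apply: ideal_genM.
rewrite (interior_edges_at cx gi) big_imfset //= => u u'.
by rewrite !(mem_neighbors cx) => /andP[_ gu] /andP[_ gu'] /(fset2_inj gu gu').
Qed.

Lemma has_dim_Jbar gamma : (r <= s)%N -> (s <= d)%N -> gamma \in interior_vertices Delta ->
  has_dim (degree_part (Jbar Delta ell r s gamma) d)
    (\sum_(s.+1 <= k < d.+1) minn k.+1 (nb_slopes Delta gamma * (k - r))).
Proof.
move=> rs sd gi.
(* The far end of an edge, recovered from its vertex set, so that a slope is attached to the edge
   itself. *)
pose other tau := head 0 (enum_fset (tau `\ gamma)).
have otherE u : gamma != u -> other [fset gamma; u] = u.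
  move=> gu; rewrite /other.
  have -> : [fset gamma; u] `\ gamma = [fset u].
    apply/fsetP => w; rewrite !inE; case: (eqVneq w gamma) => [->|//].
    by rewrite (negbTE gu).
  have : u \in enum_fset [fset u] by rewrite inE.
  have := cardfs1 u; rewrite cardfE /=.
  have : {subset enum_fset [fset u] <= [:: u]} by move=> w; rewrite !inE.
  by case: (enum_fset _) => [|w l] //= /(_ w); rewrite !inE eqxx => /(_ isT)/eqP ->.
have -> : nb_slopes Delta gamma = #|` [fset slope gamma (other tau) |
    tau in [fset tau in E1 | gamma \in tau]]|.
  rewrite /nb_slopes; congr (#|` _|); rewrite (interior_edges_at cx gi).
  apply/fsetP => o; apply/imfsetP/imfsetP => [[u /= un ->]|[_ /imfsetP[u /= un ->] ->]].
    exists [fset gamma; u]; first exact: in_imfset.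
    by rewrite otherE //; move: un; rewrite (mem_neighbors cx) => /andP[].
  by exists u => //; rewrite otherE //; move: un; rewrite (mem_neighbors cx) => /andP[].
apply: has_dim_Jbar_sum => // tau.
rewrite (interior_edges_at cx gi) => /imfsetP[u /= un ->].
have t1 := interior_edge_face (interior_vertex_edge cx gi un).
move: un; rewrite (mem_neighbors cx) => /andP[_ gu].
have [hl l0 _] := ell_edge t1.
exists u; rewrite otherE //; split=> //; first by rewrite eq_sym.
  by apply: edge_form_peval => //; apply: mem_realization; rewrite !inE eqxx.
by apply: edge_form_peval => //; apply: mem_realization; rewrite !inE eqxx orbT.
Qed.

End CofactorSpace.

(** * Counting splines *)

Section SplineCount.
Context {R : realType}.
Variable Delta : {fset {fset 'rV[R]_2}}.
Hypothesis cx : simplicial_complex Delta.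
Variables f g : 'rV[R]_2 -> 'rV[R]_2.
Hypothesis cf : {within carrier Delta, continuous f}.
Hypothesis cg : {within @closed_disk R, continuous g}.
Hypothesis fK : forall x, carrier Delta x -> closed_disk (f x) /\ g (f x) = x.
Hypothesis gD : forall y, closed_disk y -> carrier Delta (g y) /\ f (g y) = y.
Variable ell : {fset 'rV[R]_2} -> {mpoly R[3]}.
Hypothesis ell_edge : forall tau, tau \in faces Delta 1 -> edge_form tau (ell tau).
Variables r s d : nat.
Hypothesis rs : (r <= s)%N.
Hypothesis sd : (s <= d)%N.
Variables (a : {fset 'rV[R]_2} -> 'rV[R]_2) (M : {fset 'rV[R]_2} -> 'M[R]_3).
Hypothesis frames : forall tau, tau \in faces Delta 1 ->
  exists b c, [/\ [/\ tau = [fset a tau; b], a tau != b & M tau \in unitmx],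
    row 0 (M tau) = embed (a tau), row 1 (M tau) = embed b, c != 0
    & coord (M tau) 2 = c *: ell tau].
Implicit Types (u v w : 'rV[R]_2) (sigma tau : {fset 'rV[R]_2}).
Local Notation K := (carrier Delta).
Local Notation E1 := (interior_faces Delta 1).
Local Notation I := (E1 * edge_index r s d)%type.
Local Notation jump := (smoothing_jump a M).

Definition potential (x : 'rV[R]_#|{: I}|) (F : {fset 'rV[R]_2} -> {mpoly R[3]}) : Prop :=
  forall v w z z', [fset v; w; z] \in faces Delta 2 -> [fset v; w; z'] \in faces Delta 2 ->
    0 < cross (w - v) (z - v) -> cross (w - v) (z' - v) < 0 ->
    F [fset v; w; z] - F [fset v; w; z'] = jump x v w.

Lemma potential_difference_ind (P : {mpoly R[3]} -> Prop) x F sigma sigma' v w :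
  potential x F -> P 0 -> (forall c p, P p -> P (c *: p)) ->
  P (edge_cofactor M x [fset v; w]) ->
  sigma \in faces Delta 2 -> sigma' \in faces Delta 2 ->
  v \in sigma -> v \in sigma' -> w \in sigma -> w \in sigma' -> v != w ->
  P (F sigma - F sigma').
Proof.
move=> pF P0 PZ Pe s2 s2' vs vs' ws ws' vw.
have [->|->|->] := potential_difference cx pF s2 s2' vs vs' ws ws' vw => //.
  exact: PZ.
by rewrite -scaleNr; apply: PZ.
Qed.

(** Differences across an edge are 0 or a signed jump, which vanishes to order r along the edge. At
    a vertex the equality of derivatives up to order s is carried around the fan, edge by edge. *)
Lemma spline_of_potential x F : potential x F -> (forall sigma, F sigma \is ishomog1 d mdeg) ->
  exists2 h : K -> R^o, splines Delta r s d h &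
    forall sigma (y : K), sigma \in faces Delta 2 -> realization sigma (val y) ->
      h y = peval (F sigma) (embed (val y)).
Proof.
move=> pF hF.
have vZ n k (y : 'rV[R]_n) c (p : {mpoly R[n]}) : vanishes k p y -> vanishes k (c *: p) y.
  by move=> hp; rewrite -mul_mpolyC; apply: vanishesM.
have [sigma s2|sigma sigma' v w s2 s2' vs vs' ws ws' vw y yvw|sigma sigma' v s2 s2' vs vs' m ms|h hS hE] :=
  @spline_of_polynomials R Delta cx (carrier_triangle cx cf cg fK gD) r s d
    (fun sigma => dehom (F sigma)) rs.
- exact: msize_dehom.
- rewrite -rmorphB.
  apply: (@potential_difference_ind (fun p => vanishes r.+1 (dehom p) y) x F sigma sigma' v w) => //.
  + by rewrite rmorph0; apply: vanishes0.
  + by move=> c p hp; rewrite dehomZ; apply: (vZ _ r.+1).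
  + exact: (edge_cofactor_vanishes_edge ell_edge frames).
- apply: (@fan_connected R Delta cx f g cf cg fK gD v (fun sigma' =>
    peval (mderivm m (dehom (F sigma))) v = peval (mderivm m (dehom (F sigma'))) v) sigma) => //.
  move=> sigma1 sigma2 w s1 s2'' v1 v2 w1 w2 vw ->; apply/eqP.
  rewrite -subr_eq0 -pevalB -mderivmB -rmorphB; apply/eqP.
  apply: (@vanishes_mderivm _ _ s.+1) => //.
  apply: (@potential_difference_ind (fun p => vanishes s.+1 (dehom p) v) x F sigma1 sigma2 v w) => //.
  + by rewrite rmorph0; apply: vanishes0.
  + by move=> c p hp; rewrite dehomZ; apply: (vZ _ s.+1).
  + by apply: (edge_cofactor_vanishes_vertex frames); rewrite !inE eqxx.
by exists h => // sigma y s2 ys; rewrite (hE sigma) // peval_dehom.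
Qed.

(** The vertex conditions are the closing conditions of [triangle_potential]. Its values need not be
    homogeneous, so their degree d part is taken, which leaves the jumps unchanged. *)
Lemma exists_potential x :
  (forall gamma, gamma \in interior_vertices Delta -> vertex_condition a M gamma x = 0) ->
  exists2 F, potential x F & forall sigma, F sigma \is ishomog1 d mdeg.
Proof.
move=> hx.
have [F hF] := @triangle_potential R Delta cx f g cf cg fK gD _ (jump x)
  (smoothing_jump_antisym frames x) hx.
exists (fun sigma => pihomog mdeg d (F sigma)) => [v w z z' s2 s2' zp zn|sigma]; last exact: pihomogP.
by rewrite -pihomogB hF // pihomog_dE //; apply: smoothing_jump_homog.
Qed.

Lemma jump_sum (J : Type) (t : seq J) (c : J -> R) (y : J -> 'rV[R]_#|{: I}|) v w :
  jump (\sum_(j <- t) c j *: y j) v w = \sum_(j <- t) c j *: jump (y j) v w.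
Proof.
elim: t => [|j t IH]; last by rewrite !big_cons smoothing_jump_linear IH.
have := smoothing_jump_linear a M (-1) (0 : 'rV[R]_#|{: I}|) 0 v w.
by rewrite scaler0 addr0 scaleN1r addNr !big_nil.
Qed.

Lemma jump_eq0 (x : 'rV[R]_#|{: I}|) :
  (forall v w, [fset v; w] \in E1 -> jump x v w = 0) -> x = 0.
Proof.
move=> hx; apply/rowP => i; rewrite mxE -[i]enum_valK; case: (enum_val i) => t ab.
apply: (edge_cofactor_eq0 frames).
have [b [_ [[tE _ _] _ _ _ _]]] := frames (interior_edge_face (valP t)).
have t1 : [fset a (val t); b] \in E1 by rewrite -tE (valP t).
move: (hx _ _ t1); rewrite /smoothing_jump -tE => /eqP.
by rewrite scaler_eq0 (negbTE (edge_sign_neq0 _ _ _)) => /eqP.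
Qed.

(** On each triangle a relation between splines becomes one between forms of degree d, which holds
    identically because a form vanishing on a triangle is 0. Subtraction across interior edges gives
    the relation between the jumps. *)
Lemma splines_free (Q : finType) (y : Q -> 'rV[R]_#|{: I}|)
    (P : Q -> {fset 'rV[R]_2} -> {mpoly R[3]}) (h : Q -> K -> R^o) (c : Q -> R) :
  (forall q, potential (y q) (P q)) -> (forall q sigma, P q sigma \is ishomog1 d mdeg) ->
  (forall q sigma (x : K), sigma \in faces Delta 2 -> realization sigma (val x) ->
    h q x = peval (P q sigma) (embed (val x))) ->
  \sum_q c q *: h q = 0 ->
  \sum_q c q *: y q = 0 /\ forall sigma, sigma \in faces Delta 2 -> \sum_q c q *: P q sigma = 0.
Proof.
move=> pP hP hE h0.
have P0 sigma : sigma \in faces Delta 2 -> \sum_q c q *: P q sigma = 0.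
  move=> s2; apply: (homog_eq0_triangle cx s2 (d := d)).
    by apply: rpred_sum => q _; apply: rpredZ; apply: hP.
  move=> x sx; have Kx : K x by apply: (mem_carrier _ sx); apply: faces_sub s2.
  pose x' : K := SigSub (mem_set Kx).
  have h0x : (\sum_q c q *: h q) x' = 0 by rewrite h0.
  rewrite -h0x fct_sumE /peval raddf_sum /=; apply: eq_bigr => q _.
  by rewrite mevalZ [RHS]/(c q * h q x') (hE q sigma x').
split=> //; apply: jump_eq0 => v w /(interior_edge_triangles cx)[z [z' [s2 s2' zp zn]]].
transitivity (\sum_q c q *: P q [fset v; w; z] - \sum_q c q *: P q [fset v; w; z']).
  by rewrite jump_sum -sumrB; apply: eq_bigr => q _; rewrite -scalerBr (pP q v w z z').
by rewrite !P0 // subrr.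
Qed.

(** Splines with independent jumps are joined to the global monomials, which have no jump. In a
    relation, the jumps kill the first coefficients, and restriction to one triangle kills the
    others. *)
Lemma splines_dim_geq k (Y : 'M[R]_(k, #|{: I}|)) dimS : row_free Y ->
  (forall i gamma, gamma \in interior_vertices Delta -> vertex_condition a M gamma (row i Y) = 0) ->
  has_dim (splines Delta r s d) dimS -> (k + #|edge_index 0 0 d.+1| <= dimS)%N.
Proof.
move=> freeY hY hS; pose Q := ('I_k + edge_index 0 0 d.+1)%type.
have /choice[F hF] : forall i, exists F, potential (row i Y) F /\ forall sigma, F sigma \is ishomog1 d mdeg.
  by move=> i; have [F h1 h2] := exists_potential (hY i); exists F.
pose mono (e : edge_index 0 0 d.+1) : {mpoly R[3]} :=
  frame_monomial 1%:M d ((val e).1 + (val e).2) (val e).1.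
have mono_le (e : edge_index 0 0 d.+1) : ((val e).1 <= (val e).1 + (val e).2 <= d)%N.
  by rewrite leq_addr; exact: (valP e).
pose y (q : Q) := if q is inl i then row i Y else 0.
pose P (q : Q) sigma := match q with inl i => F i sigma | inr e => mono e end.
have pP q : potential (y q) (P q).
  case: q => [i|e] /=; first by have [] := hF i.
  move=> v w z z' _ _ _ _; rewrite subrr.
  by have := jump_sum [::] (fun _ : nat => 0) (fun=> 0) v w; rewrite !big_nil.
have hP q sigma : P q sigma \is ishomog1 d mdeg.
  case: q => [i|e] /=; first by have [_] := hF i; apply.
  by apply: frame_monomial_homog; apply: mono_le.
have /choice[h hh] : forall q, exists h : K -> R^o, splines Delta r s d h /\
    forall sigma (x : K), sigma \in faces Delta 2 -> realization sigma (val x) ->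
      h x = peval (P q sigma) (embed (val x)).
  by move=> q; have [h h1 h2] := spline_of_potential (pP q) (hP q); exists h.
have free_h (c : Q -> R) : \sum_q c q *: h q = 0 -> forall q, c q = 0.
  move=> /(splines_free pP hP (fun q => (hh q).2))[].
  rewrite !big_sumType /= [X in _ + X]big1 ?addr0 => [cY cP|e _]; last by rewrite scaler0.
  have cl i : c (inl i) = 0.
    have : (\row_i c (inl i)) *m Y = 0.
      by rewrite mulmx_sum_row -[RHS]cY; apply: eq_bigr => j _; rewrite mxE.
    by move/eqP; rewrite mulmx_free_eq0 // => /eqP/rowP/(_ i); rewrite !mxE.
  (* The disk is not empty, so there is a triangle to restrict to. *)
  have [sigma s2 _] : exists2 sigma, sigma \in faces Delta 2 & realization sigma (g 0).
    apply: (carrier_triangle cx cf cg fK gD); have [] // := gD (y := 0).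
    by rewrite /closed_disk /= !mxE expr0n /= addr0 ler01.
  have := cP sigma s2; rewrite big_sumType /= big1 => [|i _]; last by rewrite cl scale0r.
  rewrite add0r => c0 [i|e]; first exact: cl.
  apply: (@frame_monomial_free _ 1%:M d _ _ _ (fun e => c (inr e)) (unitmx1 _ _) mono_le _ c0 e).
  case=> [[a1 b1] ?] [[a2 b2] ?] /= e1 e2; apply: val_inj => /=.
  by congr (_, _); apply: val_inj => //=; apply: (@addnI a1); rewrite e1 e2.
have := has_dim_geq hS (free_family_fin free_h) (fun i => (hh (enum_val i)).1).
by rewrite card_sum card_ord.
Qed.

End SplineCount.

Theorem corollary5p5 (R : realType) (Delta : {fset {fset 'rV[R]_2}})
    (ell : {fset 'rV[R]_2} -> {mpoly R[3]}) (r s d : nat) :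
  simplicial_complex Delta ->
  homeomorphic (carrier Delta) closed_disk ->
  (r <= s)%N -> (s <= d)%N ->
  (forall tau, tau \in faces Delta 1 -> edge_form tau (ell tau)) ->
  exists (dimS : nat) (dimJ : 'rV[R]_2 -> nat),
    [/\ has_dim (splines Delta r s d) dimS,
        forall gamma, gamma \in interior_vertices Delta ->
          has_dim (degree_part (Jbar Delta ell r s gamma) d) (dimJ gamma),
        'C(d + 2, 2)%:R
        + ((d%:R - s%:R) ^+ 2 - binz (d%:Z - 2 * s%:Z + r%:Z) 2)
          * #|` interior_faces Delta 1|%:R
        - \sum_(gamma <- interior_vertices Delta) (dimJ gamma)%:R
        <= dimS%:R :> rat
      & forall gamma, gamma \in interior_vertices Delta ->
          (dimJ gamma)%:R = Jbar_dim (nb_slopes Delta gamma) r s d].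
Proof.
move=> cx [f [g [cf cg fK gD]]] rs sd ell_edge.
have [dimS hS] := has_dim_splines (carrier_triangle cx cf cg fK gD) r s d.
(* The count by orders of vanishing; only the last conjunct compares it with the closed formula. *)
pose dimJ gamma := (\sum_(s.+1 <= k < d.+1) minn k.+1 (nb_slopes Delta gamma * (k - r)))%N.
exists dimS, dimJ; split=> // [gamma gi||gamma gi].
- exact: has_dim_Jbar.
- have [a [M frames]] := exists_edge_frames ell_edge.
  pose L gamma : {linear 'rV[R]_#|{: interior_faces Delta 1 * edge_index r s d}| -> {mpoly R[3]}} :=
    HB.pack (vertex_condition a M gamma)
      (GRing.isLinear.Build _ _ _ _ _ (vertex_condition_linear a M gamma)).
  have InP (T : eqType) (t : seq T) x : List.In x t <-> x \in t.
    elim: t => //= y t IH; rewrite inE; split=> [[->|/IH ->]|/predU1P[->|/IH]].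
    - by rewrite eqxx.
    - by rewrite orbT.
    - by left.
    - by right.
  (* All vertex conditions together: the admissible jump vectors have dimension at least the number
     of edge coefficients minus the sum of the [dimJ]. *)
  have [|k [Y [kI freeY hY]]] := @common_kernel R _ _ _ (interior_vertices Delta) L
      (fun gamma => degree_part (Jbar Delta ell r s gamma) d) dimJ.
    move=> gamma /InP gi; split; first exact: has_dim_Jbar.
    by move=> x; apply: (vertex_condition_Jbar cx frames).
  have hY' i gamma : gamma \in interior_vertices Delta -> vertex_condition a M gamma (row i Y) = 0.
    by move=> /InP; apply: hY.
  have := splines_dim_geq cx cf cg fK gD ell_edge rs frames freeY hY' hS.
  move: kI; rewrite card_prod cardfE -!(ler_nat rat) !natrD natrM natr_sum.
  rewrite (card_edge_index rs sd) card_edge_index0.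
  lra.
- move: gi => /interior_vertexE[vD _].
  by rewrite Jbar_dim_sum //; apply: (nb_slopes_gt1 cx cf cg fK gD).
Qed.
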